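(* Let $q = e^{2\pi i z}$ with $z$ in the upper half-plane, let $\eta(z) = q^{1/24}\prod_{n\ge 1}(1-q^n)$ be the Dedekind eta-function, and define $$f(z)=\sum_{m=-\infty}^{\infty}\sum_{n=-\infty}^{\infty} q^{m^2+mn+6n^2},\qquad t_1=\frac{\eta(z)\eta(23z)}{f(z)},$$ $$F(z)=\sum_{m=-\infty}^{\infty}\sum_{n=-\infty}^{\infty} q^{2m^2+mn+3n^2},\qquad t_2=\frac{\eta(z)\eta(23z)}{F(z)}.$$ Write the expansions (near $q=0$) $f(z)=\sum_{n\ge 0} f_n t_1^n$ and $F(z)=\sum_{n\ge 0} F_n t_2^n$. If $p$ is a prime with Legendre symbol $\left(\frac{p}{23}\right)=1$ and $n, r\ge 1$ are integers, then $$f_{np^r}\equiv f_{np^{r-1}} \pmod{p^r}\quad\text{and}\quad F_{np^r}\equiv F_{np^{r-1}} \pmod{p^r}.$$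
   Context: The coefficients $f_n$ and $F_n$ are the (integer) coefficients of $f$ and $F$ expressed as power series in the modular functions $t_1$ and $t_2$ respectively; e.g. $f_0,f_1,\dots = 1,2,6,26,142,\dots$ and $F_0,F_1,\dots = 1,0,2,6,30,\dots$. *)

(* Defs.v *)
From mathcomp Require Import all_boot all_order all_algebra complex.
From mathcomp Require Import all_classical all_reals all_analysis.

Set Implicit Arguments.
Unset Strict Implicit.
Unset Printing Implicit Defensive.

Import Order.TTheory GRing.Theory Num.Theory.
Import numFieldNormedType.Exports.

Local Open Scope classical_set_scope.
Local Open Scope ring_scope.
Local Open Scope complex_scope.

(* [R[i]] seen as a numFieldType, which is what gives it the topology of its
   norm, hence limits of complex sequences. *)
Definition Cplx (R : realType) : numFieldType := R[i].

Definition cexp (R : realType) (z : R[i]) : Cplx R :=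
  (expR (complex.Re z) * cos (complex.Im z))
    +i* (expR (complex.Re z) * sin (complex.Im z)).

Definition e2pii (R : realType) (z : R[i]) : Cplx R :=
  cexp ((0 +i* (pi *+ 2)) * z).

Definition upper_half_plane (R : realType) (z : R[i]) : Prop :=
  0 < complex.Im z.

Definition qvar (R : realType) (z : R[i]) : Cplx R := e2pii z.

(* The factor q^(1/24) is the branch e^(2 pi i z / 24). *)
Definition eta (R : realType) (z : R[i]) : Cplx R :=
  e2pii (z / 24%:R)
    * lim ((fun N : nat => \prod_(1 <= n < N.+1) (1 - qvar z ^+ n)) @ \oo).

(* The bilateral sum of [a], split as (k >= 0) + (k <= -1). *)
Definition sumZ (R : realType) (a : int -> Cplx R) : Cplx R :=
  lim (series (fun k : nat => a k%:Z) @ \oo)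
    + lim (series (fun k : nat => a (- k.+1%:Z)) @ \oo).

Definition theta_qf (R : realType) (a b c : int) (z : R[i]) : Cplx R :=
  sumZ (fun m : int => sumZ (fun n : int =>
    qvar z ^ (a * m ^+ 2 + b * m * n + c * n ^+ 2))).

Definition f (R : realType) (z : R[i]) : Cplx R := theta_qf 1 1 6 z.
Definition F (R : realType) (z : R[i]) : Cplx R := theta_qf 2 1 3 z.

Definition t1 (R : realType) (z : R[i]) : Cplx R :=
  eta z * eta (23%:R * z) / f z.
Definition t2 (R : realType) (z : R[i]) : Cplx R :=
  eta z * eta (23%:R * z) / F z.

(* g = \sum_(n >= 0) c_n t^n for all z in the upper half-plane with |q| small. *)
Definition expands_near_q0 (R : realType) (g t : R[i] -> Cplx R)
    (c : nat -> int) : Prop :=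
  exists2 e : R, 0 < e & forall z : R[i],
    upper_half_plane z -> `|qvar z| < (e%:C : Cplx R) ->
    series (fun n : nat => (c n)%:~R * t z ^+ n) @ \oo --> g z.

(* The Legendre symbol (a / p) for an odd prime p. *)
Definition legendre (a p : nat) : int :=
  if (p %| a)%N then 0
  else if [exists x : 'I_p, x ^ 2 == a %[mod p]]%N then 1
  else -1.

(* Main.v *)
(** Let [theta = q d/dq], let [h = eta(z) eta(23 z)] and let [P = theta h / h].
    The genus of discriminant -23 gives [f - F = 2 h] (Euler's pentagonal number
    theorem) and [f + 2 F = E], where [E = 3 + 2 sum_N sum_(d | N) chi(d) q^N] with
    [chi = (. / 23)] (reduction theory, and the count of the roots of [b^2 + b + 6]
    modulo [m]).  Both [f P - theta f] and [F P - theta F] are then equal to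
    [G = (E P - theta E) / 3], which is an Eisenstein series of weight 3: its
    coefficients are [- (1/24) sum_(d | N) d^2 (chi(d) + 23 chi(N/d))].  When [chi(p) = 1]
    the coefficients of [P] and of [G] satisfy [a(k) = a(k/p) mod p^(v_p(k))], and
    since [P = theta (t f) / (t f)] and [theta t / t = G / f] these congruences pass, as
    in the Dieudonne-Dwork criterion, from the [q]-expansions to the coefficients of
    [f] as a series in [t].  The formal identity [f = sum_n f_n t^n] is extracted from the
    analytic hypothesis by asymptotic expansion as [q] tends to [0] along the
    positive reals. *)

From HB Require Import structures.
From mathcomp Require Import all_fingroup all_solvable all_field.
From mathcomp Require Import zify ring lra.
From mathcomp Require Import all_boot all_order all_algebra complex.
From mathcomp Require Import all_classical all_reals all_analysis.
Require Import Defs.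

Set Implicit Arguments.
Unset Strict Implicit.
Unset Printing Implicit Defensive.

Import Order.TTheory GRing.Theory Num.Theory.
Import numFieldNormedType.Exports.

Local Open Scope ring_scope.

(** * Formal power series *)

(** The map [x |-> x P - theta x] kills [h], because [theta h = h P]. Since [f] and [F] differ by a
    multiple of [h], they have the same image, which can therefore be computed on [E = f + 2 F];
    this is why an identity about an Eisenstein series says something about [f] and [F] separately.
    The weight 3 identity is proved formally rather than in a space of modular forms. Lambert series
    attached to the classes modulo 23 play the role of the Weierstrass functions zeta, p and p' at
    23-torsion points; Liouville's count of the solutions of [m n + m' n' = N] gives their quadratic
    relations, and the identity is an explicit combination of these. The hypothesis is about
    [(p / 23)], whereas roots of [b^2 + b + 6] modulo [p] are about [(-23 / p)]; a Gauss sum in the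
    field with [p^22] elements links the two. The primes 2 and 3 satisfy the hypothesis although
    they divide the denominator 24 of [G]. [G] is integral by construction, as [f P - theta f], so
    24 is cancelled in the integers and never inverted modulo [p]. *)

Record fps (R : Type) := Fps { coef : nat -> R }.

Lemma fpsP (R : Type) (x y : fps R) : coef x =1 coef y -> x = y.
Proof. by case: x y => [x] [y] /= /funext ->. Qed.

HB.instance Definition _ (R : Type) := gen_eqMixin (fps R).
HB.instance Definition _ (R : Type) := gen_choiceMixin (fps R).

Section FpsRing.
Variable R : comNzRingType.
Implicit Types x y z : fps R.

Definition fps_add x y := Fps (fun n => coef x n + coef y n).
Definition fps_opp x := Fps (fun n => - coef x n).
Definition fps_zero : fps R := Fps (fun => 0).
Definition fps_one : fps R := Fps (fun n => (n == 0%N)%:R).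
Definition fps_mul x y := Fps (fun n => \sum_(i < n.+1) coef x i * coef y (n - i)).

Fact fps_addA : associative fps_add.
Proof. by move=> x y z; apply: fpsP => n /=; rewrite addrA. Qed.
Fact fps_addC : commutative fps_add.
Proof. by move=> x y; apply: fpsP => n /=; rewrite addrC. Qed.
Fact fps_add0 : left_id fps_zero fps_add.
Proof. by move=> x; apply: fpsP => n /=; rewrite add0r. Qed.
Fact fps_addN : left_inverse fps_zero fps_opp fps_add.
Proof. by move=> x; apply: fpsP => n /=; rewrite addNr. Qed.

HB.instance Definition _ :=
  GRing.isZmodule.Build (fps R) fps_addA fps_addC fps_add0 fps_addN.

Definition trunc k x : {poly R} := \poly_(i < k) coef x i.

Lemma coef_trunc k x i : (trunc k x)`_i = if (i < k)%N then coef x i else 0.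
Proof. by rewrite coef_poly. Qed.

(** A coefficient of a product sees the factors only up to its own degree, so associativity and
    commutativity are inherited from polynomials by truncation. *)
Lemma fps_mul_poly x y k n : (n < k)%N ->
  coef (fps_mul x y) n = (trunc k x * trunc k y)`_n.
Proof.
move=> nk; rewrite coefM /=; apply: eq_bigr => i _.
by rewrite !coef_trunc !(leq_ltn_trans _ nk) ?leq_subr // -ltnS.
Qed.

Lemma coefM_agree (p q p' q' : {poly R}) n :
  (forall i, (i <= n)%N -> p`_i = p'`_i) -> (forall i, (i <= n)%N -> q`_i = q'`_i) ->
  (p * q)`_n = (p' * q')`_n.
Proof.
move=> hp hq; rewrite !coefM; apply: eq_bigr => i _.
by rewrite hp ?hq ?leq_subr // -ltnS.
Qed.

Fact fps_mulA : associative fps_mul.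
Proof.
move=> x y z; apply: fpsP => n.
rewrite !(@fps_mul_poly _ _ n.+1) //.
have tr u v i : (i <= n)%N ->
    (trunc n.+1 (fps_mul u v))`_i = (trunc n.+1 u * trunc n.+1 v)`_i.
  by move=> ni; rewrite coef_trunc ltnS ni (@fps_mul_poly _ _ n.+1).
rewrite (@coefM_agree _ _ (trunc n.+1 x) (trunc n.+1 y * trunc n.+1 z)) //; last first.
  by move=> i ni; rewrite tr.
rewrite mulrA; symmetry; apply: coefM_agree => // i ni; exact: tr.
Qed.

Fact fps_mulC : commutative fps_mul.
Proof.
by move=> x y; apply: fpsP => n; rewrite !(@fps_mul_poly _ _ n.+1) // mulrC.
Qed.

Fact fps_mul1 : left_id fps_one fps_mul.
Proof.
move=> x; apply: fpsP => n /=; rewrite big_ord_recl /= subn0 mul1r big1 ?addr0 //.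
by move=> i _; rewrite mul0r.
Qed.

Fact fps_mulDl : left_distributive fps_mul fps_add.
Proof.
move=> x y z; apply: fpsP => n /=; rewrite -big_split /=.
by apply: eq_bigr => i _; rewrite mulrDl.
Qed.

Fact fps_1neq0 : fps_one != fps_zero.
Proof.
by apply/eqP => /(congr1 (fun x => coef x 0)) /= /eqP; rewrite oner_eq0.
Qed.

HB.instance Definition _ := GRing.Zmodule_isComNzRing.Build (fps R)
  fps_mulA fps_mulC fps_mul1 fps_mulDl fps_1neq0.

Lemma cfD x y n : coef (x + y) n = coef x n + coef y n. Proof. by []. Qed.
Lemma cfN x n : coef (- x) n = - coef x n. Proof. by []. Qed.
Lemma cfB x y n : coef (x - y) n = coef x n - coef y n. Proof. by []. Qed.
Lemma cf0 n : coef (0 : fps R) n = 0. Proof. by []. Qed.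
Lemma cf1 n : coef (1 : fps R) n = (n == 0%N)%:R. Proof. by []. Qed.
Lemma cfM x y n :
  coef (x * y) n = \sum_(i < n.+1) coef x i * coef y (n - i).
Proof. by []. Qed.
Lemma cfM0 x y : coef (x * y) 0 = coef x 0 * coef y 0.
Proof. by rewrite cfM big_ord_recl big_ord0 addr0. Qed.
Lemma cf_sum (I : Type) (s : seq I) (P : pred I) (F : I -> fps R) n :
  coef (\sum_(i <- s | P i) F i) n = \sum_(i <- s | P i) coef (F i) n.
Proof. exact: (big_morph (fun x => coef x n) (fun x y => cfD x y n) (cf0 n)). Qed.
Lemma cfMn x m n : coef (x *+ m) n = coef x n *+ m.
Proof. by elim: m => [|m IH]; rewrite ?mulr0n // !mulrS cfD IH. Qed.

Definition fpsC (c : R) : fps R := Fps (fun n => if n == 0%N then c else 0).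

Fact fpsC_additive : zmod_morphism fpsC.
Proof. by move=> a b; apply: fpsP => -[|n]; rewrite cfB //= subr0. Qed.
Fact fpsC_monoid : monoid_morphism fpsC.
Proof.
split=> [|a b]; apply: fpsP => -[|n]; rewrite ?cfM ?cf1 //=.
  by rewrite big_ord_recl big_ord0 addr0.
rewrite big1 // => -[[|i] ilt] _ /=; first by rewrite mulr0.
by rewrite mul0r.
Qed.
HB.instance Definition _ := GRing.isZmodMorphism.Build R (fps R) fpsC fpsC_additive.
HB.instance Definition _ := GRing.isMonoidMorphism.Build R (fps R) fpsC fpsC_monoid.

Lemma cfCM c x n : coef (fpsC c * x) n = c * coef x n.
Proof.
rewrite cfM big_ord_recl /= subn0 big1 ?addr0 // => i _.
by rewrite mul0r.
Qed.

Definition fpsXn k : fps R := Fps (fun n => (n == k)%:R).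

Lemma cfXnM k x n : coef (fpsXn k * x) n = if (k <= n)%N then coef x (n - k) else 0.
Proof.
rewrite cfM; case: leqP => kn.
  rewrite (bigD1 (Ordinal (n := n.+1) (m := k) kn)) //= eqxx mul1r big1 ?addr0 //.
  by move=> i /negPf ik; rewrite -val_eqE /= in ik; rewrite ik mul0r.
rewrite big1 // => i _ /=; case: eqP => [ik|_]; last by rewrite mul0r.
by have := ltn_ord i; rewrite ik ltnS leqNgt kn.
Qed.

Definition theta x : fps R := Fps (fun n => coef x n *+ n).

Lemma cf_theta x n : coef (theta x) n = coef x n *+ n. Proof. by []. Qed.

Fact theta_additive : zmod_morphism theta.
Proof. by move=> x y; apply: fpsP => n; rewrite cfB !cf_theta cfB mulrnBl. Qed.
HB.instance Definition _ :=
  GRing.isZmodMorphism.Build (fps R) (fps R) theta theta_additive.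

Lemma thetaM x y : theta (x * y) = theta x * y + x * theta y.
Proof.
apply: fpsP => n; rewrite cfD !cfM cf_theta cfM -sumrMnl -big_split /=.
apply: eq_bigr => i _; rewrite mulrnAl mulrnAr -mulrnDr subnKC //.
by rewrite -ltnS.
Qed.

Lemma theta_fpsC c : theta (fpsC c) = 0.
Proof. by apply: fpsP => -[|n]; rewrite cf_theta ?mulr0n //= mul0rn. Qed.

Lemma theta1 : theta 1 = 0. Proof. by rewrite -(rmorph1 fpsC) theta_fpsC. Qed.

Lemma thetaX x n : theta (x ^+ n.+1) = x ^+ n * theta x *+ n.+1.
Proof.
elim: n => [|n IH]; first by rewrite expr1 expr0 mul1r.
rewrite exprS thetaM IH mulrnAr mulrA -exprS mulrC -[in LHS](mulr1n (_ * theta x)).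
by rewrite -mulrnDr.
Qed.

(** The whole prefix is carried along because each new coefficient of the inverse uses all the
    earlier ones. The initial 1 makes this an inverse only for constant term 1. *)
Fixpoint inv_seq x n : seq R :=
  if n is m.+1 then
    let s := inv_seq x m in
    rcons s (- \sum_(i < m.+1) coef x i.+1 * nth 0 s (m - i))
  else [:: 1].

Lemma size_inv_seq x n : size (inv_seq x n) = n.+1.
Proof. by elim: n => //= n IH; rewrite size_rcons IH. Qed.

Definition fps_inv x : fps R := Fps (fun n => nth 0 (inv_seq x n) n).

Lemma nth_inv_seq x n m : (m <= n)%N -> nth 0 (inv_seq x n) m = coef (fps_inv x) m.
Proof.
elim: n => [|n IH]; first by case: m.
rewrite leq_eqVlt => /predU1P[->//|]; rewrite ltnS => mn.
by rewrite /= nth_rcons size_inv_seq ltnS mn IH.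
Qed.

Lemma cf_invS x n : coef (fps_inv x) n.+1 =
  - \sum_(i < n.+1) coef x i.+1 * coef (fps_inv x) (n - i).
Proof.
rewrite /= nth_rcons size_inv_seq ltnn eqxx; congr (- _).
by apply: eq_bigr => i _; rewrite nth_inv_seq ?leq_subr.
Qed.

Lemma fps_mulV x : coef x 0 = 1 -> x * fps_inv x = 1.
Proof.
move=> x0; apply: fpsP => -[|n]; first by rewrite cfM0 x0 mul1r.
by rewrite cfM big_ord_recl x0 mul1r subn0 cf_invS /= addNr.
Qed.

End FpsRing.

Section FpsMap.
Variables (R S : comNzRingType) (g : {rmorphism R -> S}).

Definition fps_map (x : fps R) : fps S := Fps (fun n => g (coef x n)).

Lemma cf_map x n : coef (fps_map x) n = g (coef x n). Proof. by []. Qed.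

Fact fps_map_additive : zmod_morphism fps_map.
Proof. by move=> x y; apply: fpsP => n; rewrite cf_map !cfB rmorphB. Qed.
Fact fps_map_monoid : monoid_morphism fps_map.
Proof.
split=> [|x y]; apply: fpsP => n; first by rewrite cf_map cf1 rmorph_nat.
rewrite cf_map !cfM rmorph_sum; apply: eq_bigr => i _; exact: rmorphM.
Qed.
HB.instance Definition _ :=
  GRing.isZmodMorphism.Build (fps R) (fps S) fps_map fps_map_additive.
HB.instance Definition _ :=
  GRing.isMonoidMorphism.Build (fps R) (fps S) fps_map fps_map_monoid.

Lemma fps_map_theta x : fps_map (theta x) = theta (fps_map x).
Proof. by apply: fpsP => n; rewrite !(cf_map, cf_theta) rmorphMn. Qed.

End FpsMap.

(** * Liouville sums *)

(** The generalized Lambert series, the sum of [w m n q^(m n)] over positive [m] and [n]; the bound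
    [N] on both indices loses nothing when [m n = N]. *)
Definition lam (w : nat -> nat -> rat) : fps rat :=
  Fps (fun N => \sum_(1 <= m < N.+1) \sum_(1 <= n < N.+1 | (m * n == N)%N) w m n).

Section Liouville.
Variable N : nat.
Let I := 'I_N.+1.
Implicit Type g : nat -> nat -> nat -> nat -> rat.

(** All four entries are positive and the two products add up to [N], so each entry fits in
    ['I_N.+1]; a finite index type makes reindexing possible. *)
Definition quad (t : (I * I) * (I * I)) :=
  [&& 0 < t.1.1, 0 < t.1.2, 0 < t.2.1, 0 < t.2.2 &
      t.1.1 * t.1.2 + t.2.1 * t.2.2 == N]%N.

Definition qsum g : rat := \sum_(t | quad t) g t.1.1 t.1.2 t.2.1 t.2.2.

Lemma big_nat1_ord (K : nat) (P : pred nat) (F : nat -> rat) :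
  \sum_(1 <= i < K | P i) F i = \sum_(i < K | (0 < i)%N && P i) F i.
Proof.
rewrite -(big_mkord (fun i => (0 < i)%N && P i)).
case: K => [|K]; first by rewrite !big_geq.
by rewrite [RHS]big_ltn_cond //= [LHS]big_nat_cond [RHS]big_nat_cond;
  apply: eq_bigl => i; case: (0 < i)%N.
Qed.

Lemma cf_lam w i : (i <= N)%N -> coef (lam w) i =
  \sum_(p : I * I | [&& 0 < p.1, 0 < p.2 & p.1 * p.2 == i]%N) w p.1 p.2.
Proof.
move=> iN; rewrite /= (@big_nat_widen _ _ _ _ _ N.+1) ?ltnS //.
rewrite big_nat1_ord.
transitivity (\sum_(j < N.+1 | (0 < j)%N) \sum_(k < N.+1 | (0 < k)%N && (j * k == i)%N) w j k);
  last first.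
  by rewrite pair_big_dep /=; apply: eq_bigl => -[].
rewrite [RHS](bigID (fun j : I => (j < i.+1)%N)) /= [X in _ = _ + X]big1 ?addr0; last first.
  move=> j /andP[j0]; rewrite -leqNgt => ij; apply: big1 => k /andP[k0 /eqP jk]; exfalso.
  by move: ij; rewrite -jk leqNgt ltnS leq_pmulr.
apply: eq_big => // j /andP[j0 /= ji].
rewrite (@big_nat_widen _ _ _ _ _ N.+1) ?ltnS // big_nat1_ord.
apply: eq_bigl => k; case: ltnP => //= k0; case: eqP => //= jk.
by rewrite ltnS -jk leq_pmull.
Qed.

Lemma cf_lamM w1 w2 : coef (lam w1 * lam w2) N =
  qsum (fun m n m' n' => w1 m n * w2 m' n').
Proof.
rewrite cfM /qsum.
have quad_le (t : (I * I) * (I * I)) : quad t -> (t.1.1 * t.1.2 < N.+1)%N.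
  by case/and5P => _ _ _ _ /eqP sN; rewrite ltnS; apply: leq_trans (leq_addr _ _) (eq_leq sN).
rewrite [RHS](partition_big (fun t : (I * I) * (I * I) => inord (t.1.1 * t.1.2) : I) xpredT) //.
apply: eq_bigr => i _; rewrite !cf_lam ?leq_subr // -1?ltnS // big_distrlr pair_big /=.
apply: eq_bigl => -[[a b] [c d]] /=; rewrite /quad /=.
case: (ltnP 0 a) => //= a0; case: (ltnP 0 b) => //= b0; rewrite ?andbF //=.
case: (ltnP 0 c) => //= c0; case: (ltnP 0 d) => //= d0; rewrite ?andbF //=.
apply/andP/andP => [[/eqP abi /eqP cdi]|[/eqP sN]].
  have iN : (i <= N)%N by rewrite -ltnS.
  rewrite abi cdi subnKC // eqxx; split => //.
  by apply/eqP/val_inj; rewrite /= inordK.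
move/eqP/(congr1 val) => /=; rewrite inordK; last first.
  by rewrite ltnS; apply: leq_trans (leq_addr _ _) (eq_leq sN).
by move=> <-; rewrite eqxx -[X in (_ == X - _)%N]sN addKn.
Qed.

Lemma eq_qsum g1 g2 :
  (forall m n m' n', (0 < m)%N -> (0 < n)%N -> (0 < m')%N -> (0 < n')%N ->
    g1 m n m' n' = g2 m n m' n') -> qsum g1 = qsum g2.
Proof. by move=> h; apply: eq_bigr => t /and5P[? ? ? ? _]; apply: h. Qed.

Lemma qsumD g1 g2 :
  qsum (fun m n m' n' => g1 m n m' n' + g2 m n m' n') = qsum g1 + qsum g2.
Proof. exact: big_split. Qed.

Lemma qsumB g1 g2 :
  qsum (fun m n m' n' => g1 m n m' n' - g2 m n m' n') = qsum g1 - qsum g2.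
Proof. exact: sumrB. Qed.

Lemma qsum_swap g : qsum g = qsum (fun m n m' n' => g m' n' m n).
Proof.
rewrite /qsum (reindex_inj (h := fun t : (I * I) * (I * I) => (t.2, t.1))) /=.
  by apply: eq_bigl => -[[a b] [c d]]; rewrite /quad /= addnC; case: (0 < a)%N; case: (0 < b)%N; case: (0 < c)%N; case: (0 < d)%N.
by apply: inv_inj => -[].
Qed.

Lemma qsum_tr g : qsum g = qsum (fun m n m' n' => g n m n' m').
Proof.
rewrite /qsum (reindex_inj (h := fun t : (I * I) * (I * I) =>
    ((t.1.2, t.1.1), (t.2.2, t.2.1)))) /=.
  apply: eq_bigl => -[[a b] [c d]]; rewrite /quad /= [(b * a)%N]mulnC [(d * c)%N]mulnC.
  by case: (0 < a)%N; case: (0 < b)%N; case: (0 < c)%N; case: (0 < d)%N.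
by apply: inv_inj => -[[? ?] [? ?]].
Qed.

Lemma lam_tr w : lam w = lam (fun m n => w n m).
Proof.
apply: fpsP => k /=; rewrite [LHS]big_mkcond.
rewrite (eq_bigr (fun m => \sum_(1 <= n < k.+1) if (m * n == k)%N then w m n else 0)).
  rewrite exchange_big /=; apply: eq_bigr => n _.
  by rewrite [RHS]big_mkcond; apply: eq_bigr => m _; rewrite mulnC.
by move=> m _; rewrite big_mkcond.
Qed.

(* Liouville's substitution (m, n, m', n') -> (m, n - n', m + m', n'). *)
Lemma qsum_shear g :
  qsum (fun m n m' n' => (n' < n)%N%:R * g m n m' n') =
  qsum (fun m n m' n' => (m < m')%N%:R * g m (n + n')%N (m' - m)%N n').
Proof.
have E (A : nat -> nat -> nat -> nat -> bool) g1 :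
    qsum (fun m n m' n' => (A m n m' n')%:R * g1 m n m' n') =
    \sum_(t | quad t && A t.1.1 t.1.2 t.2.1 t.2.2) g1 t.1.1 t.1.2 t.2.1 t.2.2.
  rewrite big_mkcondr; apply: eq_bigr => t _.
  by case: (A _ _ _ _); rewrite ?mul1r ?mul0r.
rewrite (E (fun m n m' n' => n' < n)%N) (E (fun m n m' n' => m < m')%N
  (fun m n m' n' => g m (n + n') (m' - m) n')%N).
pose h (t : (I * I) * (I * I)) : (I * I) * (I * I) :=
  ((t.1.1, inord (t.1.2 + t.2.2)), (inord (t.2.1 - t.1.1), t.2.2)).
pose h' (t : (I * I) * (I * I)) : (I * I) * (I * I) :=
  ((t.1.1, inord (t.1.2 - t.2.2)), (inord (t.1.1 + t.2.1), t.2.2)).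
rewrite (reindex_onto h h'); last first.
  move=> [[a b] [c d]] /andP[/and5P[/= a0 b0 c0 d0 /eqP sN] db].
  have bN := ltn_ord b; have aN := ltn_ord a; have cN := ltn_ord c.
  have acN : (a + c < N.+1)%N by nia.
  congr ((_, _), (_, _)); apply: val_inj => /=; rewrite !inordK //; lia.
(* [inord] sends out-of-range values to 0, which the positivity conditions of [quad] exclude; so no
   overflow can satisfy the reindexed condition. *)
have inordE k : (k < N.+1)%N || ((inord k : I) == 0 :> nat).
  by case: ltnP => //= kN; rewrite /inord /insubd insubN // -leqNgt.
apply: eq_big => [[[a b] [c d]]|[[a b] [c d]]]; rewrite /quad /=.
  have bN := ltn_ord b; have aN := ltn_ord a; have cN := ltn_ord c.
  have camN : (c - a < N.+1)%N by lia.
  rewrite (inordK camN).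
  apply/idP/idP.
    case/andP => /andP[/and5P[a0 bd0 ca0 d0 /eqP sN] dbd] _.
    have bdN : (b + d < N.+1)%N.
      by case/orP: (inordE (b + d)%N) => // /eqP E0; rewrite E0 in bd0.
    rewrite inordK // in sN dbd.
    have b0 : (0 < b)%N by lia.
    have c0 : (0 < c)%N by lia.
    rewrite a0 b0 c0 d0 /=; apply/andP; split; last lia.
    by apply/eqP; nia.
  case/andP => /and5P[a0 b0 c0 d0 /eqP sN] ac.
  have bdN : (b + d < N.+1)%N by nia.
  rewrite a0 d0 inordK // addn_gt0 b0 /= subn_gt0 ac /=.
  rewrite -[X in _ && X]/(_ == _).
  apply/andP; split; first by apply/andP; split; [apply/eqP; nia | lia].
  rewrite /h' /= (inordK camN) inordK //.
  apply/eqP; congr ((_, _), (_, _)); apply: val_inj => /=; rewrite inordK //; lia.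
case/andP => /andP[/and5P[_ bd0 _ _ _] _] _.
have cN := ltn_ord c.
have bdN : (b + d < N.+1)%N.
  by case/orP: (inordE (b + d)%N) => // /eqP E0; rewrite E0 in bd0.
by rewrite !inordK //; lia.
Qed.

(** For [n = n'] the equation becomes [(m + m') n = N]; with [M = m + m'] the diagonal is a single
    Lambert series. *)
Lemma qsum_diag g :
  qsum (fun m n m' n' => (n == n')%:R * g m n m' n') =
  coef (lam (fun M n => \sum_(1 <= m < M) g m n (M - m)%N n)) N.
Proof.
rewrite cf_lam //.
transitivity (\sum_(u : (I * I) * I |
    [&& 0 < u.1.1, 0 < u.1.2, u.1.1 * u.1.2 == N, 0 < u.2 & u.2 < u.1.1]%N)
    g u.2 u.1.2 (u.1.1 - u.2)%N u.1.2); last first.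
  rewrite (eq_bigr (fun p : I * I => \sum_(m : I | (0 < m)%N && (m < p.1)%N)
      g m p.2 (p.1 - m)%N p.2)); last first.
    move=> [M n] _ /=; rewrite (@big_nat_widen _ _ _ _ _ N.+1); last exact: ltnW.
    by rewrite big_nat1_ord.
  rewrite pair_big_dep /=; apply: eq_bigl => -[[M n] m] /=.
  by case: (0 < M)%N; case: (0 < n)%N; case: (0 < m)%N; case: (_ == N); rewrite ?andbF.
rewrite /qsum.
under eq_bigr => t _ do rewrite mulr_natl mulrb.
rewrite -big_mkcondr.
pose h (u : (I * I) * I) : (I * I) * (I * I) :=
  ((u.2, u.1.2), (inord (u.1.1 - u.2), u.1.2)).
pose h' (t : (I * I) * (I * I)) : (I * I) * I := ((inord (t.1.1 + t.2.1), t.1.2), t.1.1).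
rewrite (reindex_onto h h'); last first.
  move=> [[a b] [c d]] /andP[/and5P[/= a0 b0 c0 d0 /eqP sN] /eqP bd].
  have acN : (a + c < N.+1)%N by nia.
  have cN := ltn_ord c.
  congr ((_, _), (_, _)); apply: val_inj => //=; rewrite !inordK //; lia.
apply: eq_big => [[[M n] m]|[[M n] m]]; rewrite /quad /=; have MN := ltn_ord M;
  have MmN : (M - m < N.+1)%N by lia.
  rewrite (inordK MmN) eqxx andbT /h' /= (inordK MmN).
  apply/idP/idP.
    case/andP => /and5P[m0 n0 Mm0 _ /eqP sN] _.
    by apply/and5P; split => //; [lia | apply/eqP; nia | lia].
  case/and5P => M0 n0 /eqP sN m0 mM.
  apply/andP; split; first by apply/and5P; split => //; [lia | apply/eqP; nia].
  by apply/eqP; congr ((_, _), _); apply: val_inj; rewrite /= inordK; lia.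
by move=> _; rewrite inordK.
Qed.

Lemma qsum_diag_tr g :
  qsum (fun m n m' n' => (m == m')%:R * g m n m' n') =
  coef (lam (fun m k => \sum_(1 <= n < k) g m n m (k - n)%N)) N.
Proof. by rewrite qsum_tr (qsum_diag (fun m n m' n' => g n m n' m')) lam_tr. Qed.

End Liouville.

(** * Residue classes modulo 23 and counting in arithmetic progressions *)

Definition dl (a : 'F_23) (m : nat) : rat := (m%:R == a)%:R.
Definition sg a m := dl a m - dl (- a) m.
Definition ev a m := dl a m + dl (- a) m.

Lemma dlM a b m : dl a m * dl b m = (a == b)%:R * dl a m.
Proof.
rewrite /dl; case: (eqVneq a b) => [->|ab]; first by case: eqP => _; rewrite ?mul0r ?mulr1.
case: (eqVneq _ a) => [->|_]; last by rewrite mul0r mulr0.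
by rewrite (negPf ab) mul0r mulr0.
Qed.

(* The representative of [a] in [1, 23]. *)
Definition repr1 (a : 'F_23) : nat := if a == 0 then 23%N else a.

(** Minus the first Bernoulli polynomial at [repr1 a / 23]. Representing the class 0 by 23 rather
    than 0 makes [cnt_closed] hold uniformly in the classes. *)
Definition cc (a : 'F_23) : rat := 1 / 2 - (repr1 a)%:R / 23.

Lemma repr1_bound a : (0 < repr1 a <= 23)%N.
Proof.
rewrite /repr1; case: eqP => // a0; have /= := ltn_ord a => alt.
apply/andP; split; last exact: ltnW.
by rewrite lt0n; apply/eqP => h; apply: a0; apply: val_inj.
Qed.

Lemma dl_repr1 a m : dl a m = ((m + 23 - repr1 a) %% 23 == 0)%N%:R.
Proof.
rewrite /dl -val_eqE /= val_Fp_nat //.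
have a23 : (a < 23)%N by exact: ltn_ord.
have := repr1_bound a; rewrite /repr1; case: eqP => [->|_] /= bd;
  congr (_%:R); congr nat_of_bool; lia.
Qed.

Lemma ccN a : a != 0 -> cc (- a) = - cc a.
Proof.
move=> a0; rewrite /cc /repr1 oppr_eq0 (negPf a0).
have -> : ((- a : 'F_23) : nat) = (23 - a)%N.
  have -> : ((- a : 'F_23) : nat) = ((23 - a) %% 23)%N by [].
  have : (0 < a)%N by rewrite lt0n; apply: contraNneq a0 => h; apply/eqP/val_inj.
  by move=> a1; rewrite modn_small //; lia.
have alt : (a <= 23)%N by have := ltn_ord a => /= h; apply: ltnW.
rewrite natrB //; lra.
Qed.

Lemma cc0 : cc 0 = - (1 / 2). Proof. by rewrite /cc /repr1 eqxx; lra. Qed.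

Section Residue.
Variables a : 'F_23.

Let cnt M := ((M + 22 - repr1 a) %/ 23)%N.

Lemma cntS M : (0 < M)%N -> cnt M.+1 = (cnt M + ((M + 23 - repr1 a) %% 23 == 0))%N.
Proof. by move=> M0; rewrite /cnt; have := repr1_bound a; lia. Qed.

Lemma cnt1 : cnt 1 = 0%N.
Proof. by rewrite /cnt; have := repr1_bound a; lia. Qed.

Lemma sum_dl M : (0 < M)%N -> \sum_(1 <= m < M) dl a m = (cnt M)%:R.
Proof.
elim: M => // -[_ _|M IH _].
  by rewrite big_geq // cnt1.
by rewrite big_nat_recr //= IH // dl_repr1 [in RHS]cntS // natrD.
Qed.

Lemma sum_mul_dl M : (0 < M)%N -> \sum_(1 <= m < M) m%:R * dl a m =
  (cnt M)%:R * (repr1 a)%:R + 23 / 2 * (cnt M)%:R * ((cnt M)%:R - 1).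
Proof.
elim: M => // -[_ _|M IH _].
  by rewrite big_geq // cnt1 !(mul0r, mulr0) addr0.
rewrite big_nat_recr //= IH // dl_repr1 (cntS (M := M.+1)) //.
case: eqP => [h|_] /=; last by rewrite addn0 mulr0 addr0.
have -> : M.+1%:R = (repr1 a + 23 * cnt M.+1)%N%:R :> rat.
  by congr (_%:R); move: h; rewrite /cnt; have := repr1_bound a; lia.
rewrite (natrD _ (repr1 a)) natrM (natrD _ (cnt _) 1).
set x := (cnt M.+1)%:R; set y := (repr1 a)%:R; lra.
Qed.

(** The integers counted form a progression of step 23 from [repr1 a] to [M - repr1 b], because
    [M - m] then lies in the class [b]. *)
Lemma cnt_closed b M : (0 < M)%N -> M%:R = a + b ->
  (cnt M)%:R = M%:R / 23 + cc a + cc b.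
Proof.
move=> M0 hM; rewrite /cc.
have h : ((repr1 a + repr1 b) %% 23 = M %% 23)%N.
  have/(congr1 (@nat_of_ord _)) := hM; rewrite val_Fp_nat //.
  have -> : (((a + b)%R : 'F_23) : nat) = ((a + b) %% 23)%N by [].
  move=> ->; rewrite /repr1.
  case: eqP => [->|_]; case: eqP => [->|_] /=; rewrite ?modn_mod; lia.
have E : (cnt M * 23 + repr1 a + repr1 b = M + 23)%N.
  by rewrite /cnt; have := repr1_bound a; have := repr1_bound b; lia.
have : (cnt M * 23 + repr1 a + repr1 b)%N%:R = (M + 23)%N%:R :> rat by rewrite E.
rewrite (natrD _ (_ + _)%N) (natrD _ (_ * _)%N) natrM (natrD _ M).
by set x := (cnt M)%:R; set y := (repr1 a)%:R; set z := (repr1 b)%:R => h'; lra.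
Qed.

Lemma dl_sub b M m : (m < M)%N -> dl a m * dl b (M - m)%N = dl (a + b) M * dl a m.
Proof.
move=> mM; rewrite /dl natrB 1?ltnW //.
case: (eqVneq _ a) => [->|_]; last by rewrite mul0r mulr0.
by rewrite subr_eq addrC mulr1 mul1r.
Qed.

Lemma sum_dl2 b M : (0 < M)%N -> \sum_(1 <= m < M) dl a m * dl b (M - m)%N =
  dl (a + b) M * (M%:R / 23 + cc a + cc b).
Proof.
move=> M0; rewrite (eq_big_nat _ _ (F2 := fun m => dl (a + b) M * dl a m)); last first.
  by move=> m /andP[_ mM]; rewrite dl_sub.
rewrite -mulr_sumr sum_dl // /dl; case: eqP => [h|_]; last by rewrite !mul0r.
by rewrite (cnt_closed M0 h).
Qed.

Lemma sum_mul_dl2 b M : (0 < M)%N ->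
  \sum_(1 <= m < M) m%:R * (dl a m * dl b (M - m)%N) =
  dl (a + b) M * ((M%:R / 23 + cc a + cc b) * (M%:R + 23 * (cc b - cc a)) / 2).
Proof.
move=> M0; rewrite (eq_big_nat _ _ (F2 := fun m => dl (a + b) M * (m%:R * dl a m))); last first.
  by move=> m /andP[_ mM]; rewrite dl_sub // mulrCA.
rewrite -mulr_sumr sum_mul_dl // /dl; case: eqP => [h|_]; last by rewrite !mul0r.
have E : (repr1 a)%:R = 23 / 2 - 23 * cc a by rewrite /cc; lra.
by rewrite E (cnt_closed M0 h); field.
Qed.

End Residue.

Definition wt1 (m n m' n' : nat) : rat := 1.
Definition wtm (m n m' n' : nat) : rat := m%:R.
Definition wtm' (m n m' n' : nat) : rat := m'%:R.
Definition wtn (m n m' n' : nat) : rat := n%:R.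
Definition wtn' (m n m' n' : nat) : rat := n'%:R.

(** * Two ways of splitting a sum over [m n + m' n' = N] *)

Section Relations.
Variable N : nat.
Implicit Types (w : nat -> nat -> nat -> nat -> rat) (a b c : 'F_23).

Definition U w a b := qsum N (fun m n m' n' => w m n m' n' * (dl a m * dl b m')).
Definition V w a b :=
  qsum N (fun m n m' n' => (m < m')%N%:R * (w m n m' n' * (dl a m * dl b m'))).
Definition diagN w a b := coef (lam (fun M n =>
  \sum_(1 <= m < M) w m n (M - m)%N n * (dl a m * dl b (M - m)%N))) N.
Definition diagM w a b := coef (lam (fun m k =>
  \sum_(1 <= n < k) w m n m (k - n)%N * (dl a m * dl b m))) N.

Lemma trichotomy (p q : nat) (x : rat) :
  x = (p < q)%N%:R * x + (q < p)%N%:R * x + (p == q)%:R * x.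
Proof. by case: ltngtP => _; rewrite !(mul0r, mul1r, addr0, add0r). Qed.

Lemma U_split_m w a b :
  U w a b = V w a b + V (fun m n m' n' => w m' n' m n) b a + diagM w a b.
Proof.
rewrite /U (@eq_qsum N _ (fun m n m' n' =>
  ((m < m')%N%:R * (w m n m' n' * (dl a m * dl b m')) +
  (m' < m)%N%:R * (w m n m' n' * (dl a m * dl b m'))) +
  (m == m')%:R * (w m n m' n' * (dl a m * dl b m')))); last first.
  by move=> m n m' n' _ _ _ _; exact: trichotomy.
rewrite !qsumD; congr (_ + _ + _).
  rewrite qsum_swap; apply: eq_qsum => m n m' n' _ _ _ _.
  by rewrite (mulrC (dl a m')).
by rewrite (qsum_diag_tr N (fun m n m' n' => w m n m' n' * (dl a m * dl b m'))).
Qed.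

(** After Liouville's substitution the new third entry is [m + m'], of class [a + b]; hence both
    off-diagonal parts are [V]-sums with second class [s]. Playing this against [U_split_m] for
    suitable pairs of classes eliminates all [V]-sums and leaves only diagonals, which are single
    Lambert series. *)
Lemma U_split_n w a b s : a + b = s ->
  U w a b = V (fun m n m' n' => w m (n + n')%N (m' - m)%N n') a s
    + V (fun m n m' n' => w (m' - m)%N n' m (n + n')%N) b s + diagN w a b.
Proof.
move=> <-; rewrite /U (@eq_qsum N _ (fun m n m' n' =>
  ((n' < n)%N%:R * (w m n m' n' * (dl a m * dl b m')) +
  (n < n')%N%:R * (w m n m' n' * (dl a m * dl b m'))) +
  (n == n')%:R * (w m n m' n' * (dl a m * dl b m')))); last first.
  by move=> m n m' n' _ _ _ _; rewrite [n == n']eq_sym; exact: trichotomy.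
have dlD x y m m' : (m < m')%N -> dl x m * dl y (m' - m)%N = dl x m * dl (x + y) m'.
  by move=> mm'; rewrite dl_sub // mulrC.
rewrite !qsumD; congr (_ + _ + _).
- rewrite (qsum_shear N (fun m n m' n' => w m n m' n' * (dl a m * dl b m'))).
  apply: eq_qsum => m n m' n' _ _ _ _.
  by case: ltnP => mm'; rewrite ?mul0r // dlD.
- rewrite qsum_swap (qsum_shear N (fun m n m' n' => w m' n' m n * (dl a m' * dl b m))).
  apply: eq_qsum => m n m' n' _ _ _ _; case: ltnP => mm'; rewrite ?mul0r //.
  by rewrite [dl a _ * _]mulrC dlD // addrC.
by rewrite (qsum_diag N (fun m n m' n' => w m n m' n' * (dl a m * dl b m'))).
Qed.

Lemma eq_V w1 w2 a b :
  (forall m n m' n', (m < m')%N -> w1 m n m' n' = w2 m n m' n') -> V w1 a b = V w2 a b.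
Proof.
move=> h; apply: eq_qsum => m n m' n' _ _ _ _.
by case: ltnP => mm'; rewrite ?mul0r // h.
Qed.

Lemma VD w1 w2 a b :
  V (fun m n m' n' => w1 m n m' n' + w2 m n m' n') a b = V w1 a b + V w2 a b.
Proof. by rewrite /V -qsumD; apply: eq_qsum => *; ring. Qed.

Lemma VB w1 w2 a b :
  V (fun m n m' n' => w1 m n m' n' - w2 m n m' n') a b = V w1 a b - V w2 a b.
Proof. by rewrite /V -qsumB; apply: eq_qsum => *; ring. Qed.

Lemma qsum_sgsg w a b :
  qsum N (fun m n m' n' => w m n m' n' * (sg a m * sg b m')) =
  U w a b - U w a (- b) - U w (- a) b + U w (- a) (- b).
Proof. by rewrite /U -!(qsumB, qsumD); apply: eq_qsum => *; rewrite /sg; ring. Qed.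

Lemma qsum_evsg w a b :
  qsum N (fun m n m' n' => w m n m' n' * (ev a m * sg b m')) =
  U w a b - U w a (- b) + U w (- a) b - U w (- a) (- b).
Proof. by rewrite /U -!(qsumB, qsumD); apply: eq_qsum => *; rewrite /sg /ev; ring. Qed.

Lemma U1_m a b : U wt1 a b = V wt1 a b + V wt1 b a + diagM wt1 a b.
Proof. exact: U_split_m. Qed.
Lemma U1_n a b s : a + b = s -> U wt1 a b = V wt1 a s + V wt1 b s + diagN wt1 a b.
Proof. exact: U_split_n. Qed.
Lemma Un_m a b : U wtn a b = V wtn a b + V wtn' b a + diagM wtn a b.
Proof. exact: U_split_m. Qed.
Lemma Un_n a b s : a + b = s ->
  U wtn a b = V wtn a s + V wtn' a s + V wtn' b s + diagN wtn a b.
Proof.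
move=> abs; rewrite (U_split_n _ abs) -VD; congr (_ + _ + _).
by apply: eq_V => m n m' n' _; rewrite /wtn /wtn' natrD.
Qed.
Lemma Um_m a b : U wtm a b = V wtm a b + V wtm' b a + diagM wtm a b.
Proof. exact: U_split_m. Qed.
Lemma Um_n a b s : a + b = s ->
  U wtm a b = V wtm a s + (V wtm' b s - V wtm b s) + diagN wtm a b.
Proof.
move=> abs; rewrite (U_split_n _ abs) -VB; congr (_ + _ + _).
by apply: eq_V => m n m' n' mm'; rewrite /wtm /wtm' natrB // ltnW.
Qed.

Lemma diagM_neq w a b : a != b -> diagM w a b = 0.
Proof.
move=> ab; rewrite /diagM /= big1 // => m _; rewrite big1 // => k _.
by rewrite big1 // => n _; rewrite dlM (negPf ab) mul0r mulr0.
Qed.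

End Relations.

Lemma eq_lam v w : (forall m n, (0 < m)%N -> (0 < n)%N -> v m n = w m n) -> lam v = lam w.
Proof.
move=> h; apply: fpsP => N /=; apply: eq_big_nat => m /andP[m0 _].
by rewrite big_nat_cond [RHS]big_nat_cond; apply: eq_bigr => n /andP[/andP[n0 _] _]; exact: h.
Qed.

Lemma lamD v w : lam v + lam w = lam (fun m n => v m n + w m n).
Proof.
by apply: fpsP => N; rewrite cfD /= -big_split; apply: eq_bigr => m _; rewrite -big_split.
Qed.

Lemma lamZ c w : fpsC c * lam w = lam (fun m n => c * w m n).
Proof.
apply: fpsP => N; rewrite cfCM /= mulr_sumr; apply: eq_bigr => m _.
by rewrite mulr_sumr.
Qed.

Lemma lamN w : - lam w = lam (fun m n => - w m n).
Proof. by apply: fpsP => N; rewrite cfN /= -sumrN; apply: eq_bigr => m _; rewrite -sumrN. Qed.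

Definition psi a := lam (fun m n => sg a m).
Definition dS a := lam (fun m n => n%:R * ev a m).
Definition mS a := lam (fun m n => m%:R * ev a m).

Section Diagonals.
Implicit Types a b : 'F_23.

Definition nd1 a b := lam (fun M n => dl (a + b) M * (M%:R / 23 + cc a + cc b)).
Definition ndn a b := lam (fun M n => n%:R * (dl (a + b) M * (M%:R / 23 + cc a + cc b))).
Definition ndm a b := lam (fun M n =>
  dl (a + b) M * ((M%:R / 23 + cc a + cc b) * (M%:R + 23 * (cc b - cc a)) / 2)).
Definition md1 a := lam (fun m k => dl a m * (k%:R - 1)).
Definition mdn a := lam (fun m k => dl a m * (k%:R * (k%:R - 1) / 2)).
Definition mdm a := lam (fun m k => m%:R * dl a m * (k%:R - 1)).

Lemma diagN1 N a b : diagN N wt1 a b = coef (nd1 a b) N.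
Proof.
rewrite /diagN; congr coef; apply: eq_lam => M n M0 _.
by under eq_bigr do rewrite mul1r; exact: sum_dl2.
Qed.

Lemma diagNn N a b : diagN N wtn a b = coef (ndn a b) N.
Proof.
rewrite /diagN; congr coef; apply: eq_lam => M n M0 _.
by rewrite /wtn -mulr_sumr; congr (_ * _); exact: sum_dl2.
Qed.

Lemma diagNm N a b : diagN N wtm a b = coef (ndm a b) N.
Proof. by rewrite /diagN; congr coef; apply: eq_lam => M n M0 _; exact: sum_mul_dl2. Qed.

Lemma sum_const1 k (x : rat) : (0 < k)%N -> \sum_(1 <= n < k) x = (k%:R - 1) * x.
Proof.
by move=> k0; rewrite sumr_const_nat -(mulr_natl x) natrB.
Qed.

Lemma sum_id k : (0 < k)%N -> \sum_(1 <= n < k) n%:R = k%:R * (k%:R - 1) / 2 :> rat.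
Proof.
elim: k => // -[_ _|k IH _]; first by rewrite big_geq // subrr mulr0 mul0r.
rewrite big_nat_recr //= IH // -[in RHS]natr1; set x := k.+1%:R; lra.
Qed.

Lemma diagM1 N a : diagM N wt1 a a = coef (md1 a) N.
Proof.
rewrite /diagM; congr coef; apply: eq_lam => m k _ k0.
by under eq_bigr do rewrite mul1r dlM eqxx mul1r; rewrite sum_const1 // mulrC.
Qed.

Lemma diagMn N a : diagM N wtn a a = coef (mdn a) N.
Proof.
rewrite /diagM; congr coef; apply: eq_lam => m k _ k0.
under eq_bigr do rewrite dlM eqxx mul1r.
by rewrite -mulr_suml sum_id // mulrC.
Qed.

Lemma diagMm N a : diagM N wtm a a = coef (mdm a) N.
Proof.
rewrite /diagM; congr coef; apply: eq_lam => m k _ k0.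
under eq_bigr do rewrite dlM eqxx mul1r.
by rewrite sum_const1 // mulrC.
Qed.

End Diagonals.

(** * Quadratic relations between Lambert series by elimination of the [V]-sums *)

Section RawRelations.
Implicit Types a b c : 'F_23.

Lemma opp_neq a : a != 0 -> a != - a.
Proof.
apply: contra => /eqP h; have : a *+ 2 == 0 by rewrite mulr2n {1}h addNr.
by rewrite -mulr_natr mulf_eq0 => /orP[//|].
Qed.

Lemma cf_psiM N a b : coef (psi a * psi b) N =
  U N wt1 a b - U N wt1 a (- b) - U N wt1 (- a) b + U N wt1 (- a) (- b).
Proof. by rewrite cf_lamM -qsum_sgsg; apply: eq_qsum => *; rewrite mul1r. Qed.

Lemma cf_dSM N a b : coef (dS a * psi b) N =
  U N wtn a b - U N wtn a (- b) + U N wtn (- a) b - U N wtn (- a) (- b).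
Proof. by rewrite cf_lamM -qsum_evsg; apply: eq_qsum => *; rewrite mulrA. Qed.

Lemma cf_mSM N a b : coef (mS a * psi b) N =
  U N wtm a b - U N wtm a (- b) + U N wtm (- a) b - U N wtm (- a) (- b).
Proof. by rewrite cf_lamM -qsum_evsg; apply: eq_qsum => *; rewrite mulrA. Qed.

(** The terms with equal signs are split along [n], those with opposite signs along [m]. Since
    [a + b = - c] and cyclically, the same twelve [V]-sums occur on both sides and cancel; the
    diagonals [m = m'] vanish because the two classes differ. *)
Lemma fay_raw a b c : a != 0 -> b != 0 -> c != 0 -> a + b + c = 0 ->
  psi a * psi b + psi b * psi c + psi c * psi a =
  nd1 a b + nd1 b c + nd1 c a + (nd1 (- a) (- b) + nd1 (- b) (- c) + nd1 (- c) (- a)).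
Proof.
move=> a0 b0 c0 abc.
have ab : a + b = - c by apply/eqP; rewrite -addr_eq0 abc.
have bc : b + c = - a by apply/eqP; rewrite -addr_eq0 addrC addrA abc.
have ca : c + a = - b by apply/eqP; rewrite -addr_eq0 -addrA addrC abc.
have nab : - a + - b = c by rewrite -opprD ab opprK.
have nbc : - b + - c = a by rewrite -opprD bc opprK.
have nca : - c + - a = b by rewrite -opprD ca opprK.
have neq (x y z : 'F_23) : x + y = - z -> z != 0 -> (x != - y) /\ (- x != y).
  move=> h z0; split; apply: contra z0 => /eqP h2.
    by rewrite -oppr_eq0 -h h2 addNr.
  by rewrite -oppr_eq0 -h -h2 addrN.
have [ab1 ab2] := neq _ _ _ ab c0.
have [bc1 bc2] := neq _ _ _ bc a0.
have [ca1 ca2] := neq _ _ _ ca b0.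
apply: fpsP => N; rewrite !cfD !cf_psiM -!diagN1.
rewrite (U1_n N ab) (U1_n N bc) (U1_n N ca) (U1_n N nab) (U1_n N nbc) (U1_n N nca).
rewrite (U1_m N a (- b)) (U1_m N (- a) b) (U1_m N b (- c)) (U1_m N (- b) c).
rewrite (U1_m N c (- a)) (U1_m N (- c) a) !diagM_neq //; ring.
Qed.

(** Splitting the pair [(a, - a)] along [n] produces [V]-sums with second class 0; computing [U a 0]
    in both ways turns them into the [V a a] that occur in [U a a]. The same device serves the next
    two lemmas. *)
Lemma sq_raw a : a != 0 -> psi a * psi a =
  md1 a + md1 (- a) - (nd1 a 0 + nd1 (- a) 0 + nd1 a (- a)) *+ 2.
Proof.
move=> a0; apply: fpsP => N.
have na0 : - a != 0 by rewrite oppr_eq0.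
rewrite cf_psiM cfB cfMn !cfD -!diagN1 -!diagM1.
rewrite (U1_m N a a) (U1_m N (- a) (- a)).
have E1 := U1_n N (addrN a).
have E2 := U1_n N (addNr a).
have E3 := U1_n N (addr0 a); rewrite (U1_m N a 0) (diagM_neq _ _ a0) in E3.
have E4 := U1_n N (addr0 (- a)); rewrite (U1_m N (- a) 0) (diagM_neq _ _ na0) in E4.
have E5 : diagN N wt1 (- a) a = diagN N wt1 a (- a).
  by rewrite !diagN1; congr coef; apply: eq_lam => M n _ _; rewrite addrC; ring.
lra.
Qed.

Lemma heat_raw a : a != 0 -> dS a * psi a = mdn a - mdn (- a) - ndn a 0 + ndn (- a) 0.
Proof.
move=> a0; apply: fpsP => N.
have na0 : - a != 0 by rewrite oppr_eq0.
rewrite cf_dSM cfD !cfB -!diagNn -!diagMn.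
rewrite (Un_m N a a) (Un_m N (- a) (- a)).
have E1 := Un_n N (addrN a).
have E2 := Un_n N (addNr a).
have E3 := Un_n N (addr0 a); rewrite (Un_m N a 0) (diagM_neq _ _ a0) in E3.
have E4 := Un_n N (addr0 (- a)); rewrite (Un_m N (- a) 0) (diagM_neq _ _ na0) in E4.
have E5 : diagN N wtn (- a) a = diagN N wtn a (- a).
  by rewrite !diagNn; congr coef; apply: eq_lam => M n _ _; rewrite addrC; ring.
lra.
Qed.

(** With weight [m] the [V]-sums of [mS a * psi a] no longer cancel by themselves; what is left of
    them is exactly what [mS 0 * psi a] contributes. *)
Lemma cube_raw a : a != 0 -> mS a * psi a - mS 0 * psi a =
  mdm a - mdm (- a) - (ndm a 0 - ndm (- a) 0) - (ndm a 0 - ndm (- a) 0) - ndm 0 a + ndm 0 (- a)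
  - ndm a (- a) + ndm (- a) a.
Proof.
move=> a0; apply: fpsP => N.
have na0 : - a != 0 by rewrite oppr_eq0.
have a0' : 0 != a by rewrite eq_sym.
have na0' : 0 != - a by rewrite eq_sym.
rewrite cfB !cf_mSM oppr0 !(cfB, cfD, cfMn) -!diagNm -!diagMm.
rewrite (Um_m N a a) (Um_m N (- a) (- a)).
have E1 := Um_n N (addrN a).
have E2 := Um_n N (addNr a).
have E3 := Um_n N (addr0 a); rewrite (Um_m N a 0) (diagM_neq _ _ a0) in E3.
have E4 := Um_n N (addr0 (- a)); rewrite (Um_m N (- a) 0) (diagM_neq _ _ na0) in E4.
have E5 := Um_n N (add0r a).
have E6 := Um_n N (add0r (- a)).
have E7 := Um_m N 0 a; rewrite (diagM_neq _ _ a0') in E7.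
have E8 := Um_m N 0 (- a); rewrite (diagM_neq _ _ na0') in E8.
lra.
Qed.

Lemma deriv_raw a b : a != 0 -> a + a = b ->
  dS a * psi a - dS a * psi b - (dS b * psi a) *+ 2 =
  ndn a a - ndn (- a) (- a) - ndn (- a) b + ndn a (- b) + (ndn b (- a) - ndn (- b) a) *+ 2.
Proof.
move=> a0 aab; apply: fpsP => N.
have na0 : - a != 0 by rewrite oppr_eq0.
have b0 : b != 0.
  rewrite -aab; apply: contra (opp_neq a0) => /eqP h.
  by rewrite -subr_eq0 opprK h.
have ab : a != b by apply: contra a0 => /eqP h; rewrite -(addrK a a) aab -h subrr.
have anb : - a != - b by rewrite eqr_opp.
have s1 : - a + b = a by rewrite -aab addKr.
have s2 : b + - a = a by rewrite addrC.
have s3 : a + - b = - a by rewrite -opprB s2.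
have s4 : - b + a = - a by rewrite addrC.
have s5 : - a + - a = - b by rewrite -opprD aab.
rewrite !(cfB, cfD, cfMn) !cf_dSM -!diagNn.
have [E1 E2] := (Un_n N aab, Un_n N s5).
have E3 := Un_m N a b; rewrite (diagM_neq _ _ ab) in E3.
have E4 := Un_m N (- a) (- b); rewrite (diagM_neq _ _ anb) in E4.
have E5 := Un_m N b a; rewrite eq_sym in ab; rewrite (diagM_neq _ _ ab) in E5.
have E6 := Un_m N (- b) (- a); rewrite eq_sym in anb; rewrite (diagM_neq _ _ anb) in E6.
have [E7 E8] := (Un_n N s1, Un_n N s2).
have [E9 E10] := (Un_n N s3, Un_n N s4).
have E11 := Un_m N a (- a); rewrite (diagM_neq _ _ (opp_neq a0)) in E11.
have E12 := Un_m N (- a) a; rewrite (diagM_neq _ _ (_ : - a != a)) 1?eq_sym ?opp_neq // in E12.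
lra.
Qed.

End RawRelations.

Lemma theta_lam w : theta (lam w) = lam (fun m n => m%:R * n%:R * w m n).
Proof.
apply: fpsP => N; rewrite cf_theta /= -sumrMnl; apply: eq_bigr => m _.
rewrite -sumrMnl; apply: eq_bigr => n /eqP mn.
by rewrite -natrM mn mulr_natl.
Qed.

Lemma dl0 m : dl 0 m = (23 %| m)%N%:R.
Proof. by rewrite dl_repr1 /repr1 eqxx addnK. Qed.

Lemma cf_lam_dl0 g N : coef (lam (fun m n => dl 0 m * g (m %/ 23)%N n)) N =
  if (23 %| N)%N then coef (lam g) (N %/ 23) else 0.
Proof.
case: ifP => dN; last first.
  rewrite /= big1 // => m _; rewrite big1 // => n /eqP mn.
  by rewrite dl0; case: (boolP (23 %| m)%N) => [dm|]; rewrite ?mul0r //;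
    rewrite -mn dvdn_mulr in dN.
rewrite (@cf_lam N) // (@cf_lam N) ?leq_div //.
pose h (p : 'I_N.+1 * 'I_N.+1) : 'I_N.+1 * 'I_N.+1 := (inord (23 * p.1), p.2).
pose h' (p : 'I_N.+1 * 'I_N.+1) : 'I_N.+1 * 'I_N.+1 := (inord (p.1 %/ 23), p.2).
rewrite (bigID (fun p : 'I_N.+1 * 'I_N.+1 => 23 %| p.1)%N) /= [X in _ + X]big1 ?addr0; last first.
  by move=> p /andP[_ np]; rewrite dl0 (negPf np) mul0r.
rewrite (reindex_onto h h'); last first.
  move=> [m n] /andP[_ /= dm]; congr (_, _); apply: val_inj => /=.
  have mN := ltn_ord m.
  have mN' : (m %/ 23 < N.+1)%N by lia.
  by rewrite inordK inordK //; lia.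
have inordE k : (k < N.+1)%N || ((inord k : 'I_N.+1) == 0 :> nat).
  by case: ltnP => //= kN; rewrite /inord /insubd insubN // -leqNgt.
apply: eq_big => [[m n]|[m n]] /=.
  apply/idP/idP.
    case/andP => /andP[/and3P[m0 n0 /eqP mn] dm] _.
    have mN : (23 * m < N.+1)%N.
      by case/orP: (inordE (23 * m)%N) => // /eqP E0; rewrite E0 in m0.
    rewrite inordK // in m0 mn; rewrite n0 (_ : (0 < m)%N) /=; last by lia.
    by apply/eqP; move: mn; rewrite -mulnA => mn; lia.
  case/and3P => m0 n0 /eqP mn.
  have E : (23 * m * n = N)%N by rewrite -mulnA mn mulnC divnK.
  have mN : (23 * m < N.+1)%N by nia.
  have mN' : (m < N.+1)%N by lia.
  rewrite inordK // n0 muln_gt0 m0 (introT eqP E) dvdn_mulr //= /h' /= inordK // mulKn //.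
  by apply/eqP; congr (_, _); apply: val_inj; rewrite /= inordK.
case/andP => /andP[/and3P[m0 n0 /eqP mn] dm] _.
have mN : (23 * m < N.+1)%N.
  by case/orP: (inordE (23 * m)%N) => // /eqP E0; rewrite E0 in m0.
by rewrite inordK // mulKn // dl0 dvdn_mulr // mul1r.
Qed.

(** Both are the sum of [sigma(N) q^(23 N)]: with [m = 23 m'] the two sides differ by exchanging
    [m'] and [n]. *)
Lemma lam_dl0_sym : lam (fun m n => dl 0 m * n%:R) = lam (fun m n => dl 0 m * (m%:R / 23)).
Proof.
have -> : lam (fun m n => dl 0 m * (m%:R / 23)) =
    lam (fun m n => dl 0 m * ((m %/ 23)%N%:R)).
  apply: eq_lam => m n _ _; rewrite dl0.
  case: (boolP (23 %| m)%N) => [dm|_]; last by rewrite !mul0r.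
  by rewrite !mul1r -{1}(divnK dm) natrM mulfK.
apply: fpsP => N; rewrite (cf_lam_dl0 (fun _ n => n%:R)) (cf_lam_dl0 (fun m _ => m%:R)).
by rewrite (lam_tr (fun m _ => m%:R)).
Qed.

(* The coefficients below were found by linear algebra: the weight 3 identity is a
   combination of the three-term relations multiplied by [j k], plus the
   relations for [T]. *)
Definition csum (A : zmodType) (g : nat -> A) : A :=
  g 1%N + g 2%N + g 3%N + g 4%N - g 5%N + g 6%N - g 7%N + g 8%N + g 9%N - g 10%N - g 11%N.

Definition tsum (A : zmodType) (g : nat -> A) : A :=
  g 1%N + g 2%N + g 3%N + g 4%N + g 5%N + g 6%N + g 7%N + g 8%N + g 9%N + g 10%N + g 11%N.

Section Certificate.
Variables (A : comNzRingType) (j w T : nat -> A).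
Let s k := j k * j k + w k *+ 2.
Hypothesis three_term_lt : forall a b, (0 < a)%N -> (0 < b)%N -> (a + b < 23)%N ->
  j a * j b - j b * j (a + b)%N - j (a + b)%N * j a = w a + w b + w (a + b)%N.
Hypothesis three_term_eq : forall a b c, (0 < a)%N -> (0 < b)%N -> (0 < c)%N ->
  (a + b + c = 23)%N -> j a * j b + j b * j c + j c * j a = w a + w b + w c.
Hypothesis double_lt : forall k, (0 < k)%N -> (2 * k < 23)%N ->
  T k + T (2 * k)%N = (j k *+ 2 - j (2 * k)%N) * (s k - s (2 * k)%N) *+ 2.
Hypothesis double_gt : forall k, (0 < k)%N -> (2 * k < 23)%N ->
  T k - T (23 - 2 * k)%N = (j k *+ 2 + j (23 - 2 * k)%N) * (s k - s (23 - 2 * k)%N) *+ 2.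

Lemma certificate :
  (23 * csum T + 23 * csum (fun k => j k ^+ 3) - 483 * csum (fun k => j k * w k)
   - 24 * csum j * tsum s) *+ 2 = 0.
Proof.
(* The relations [e1] to [e44] are, up to order and global sign, all the triples of nonzero classes
   modulo 23 with sum 0, written with representatives between 1 and 11; [e45] to [e55] are the
   doublings of the eleven classes. *)
have e1 : j 1 * j 1 - j 1 * j 2 - j 2 * j 1 - (w 1 + w 1 + w 2) = 0.
  by apply/eqP; rewrite subr_eq0 (three_term_lt (a := 1) (b := 1)).
have e2 : j 1 * j 2 - j 2 * j 3 - j 3 * j 1 - (w 1 + w 2 + w 3) = 0.
  by apply/eqP; rewrite subr_eq0 (three_term_lt (a := 1) (b := 2)).
have e3 : j 1 * j 3 - j 3 * j 4 - j 4 * j 1 - (w 1 + w 3 + w 4) = 0.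
  by apply/eqP; rewrite subr_eq0 (three_term_lt (a := 1) (b := 3)).
have e4 : j 1 * j 4 - j 4 * j 5 - j 5 * j 1 - (w 1 + w 4 + w 5) = 0.
  by apply/eqP; rewrite subr_eq0 (three_term_lt (a := 1) (b := 4)).
have e5 : j 1 * j 5 - j 5 * j 6 - j 6 * j 1 - (w 1 + w 5 + w 6) = 0.
  by apply/eqP; rewrite subr_eq0 (three_term_lt (a := 1) (b := 5)).
have e6 : j 1 * j 6 - j 6 * j 7 - j 7 * j 1 - (w 1 + w 6 + w 7) = 0.
  by apply/eqP; rewrite subr_eq0 (three_term_lt (a := 1) (b := 6)).
have e7 : j 1 * j 7 - j 7 * j 8 - j 8 * j 1 - (w 1 + w 7 + w 8) = 0.
  by apply/eqP; rewrite subr_eq0 (three_term_lt (a := 1) (b := 7)).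
have e8 : j 1 * j 8 - j 8 * j 9 - j 9 * j 1 - (w 1 + w 8 + w 9) = 0.
  by apply/eqP; rewrite subr_eq0 (three_term_lt (a := 1) (b := 8)).
have e9 : j 1 * j 9 - j 9 * j 10 - j 10 * j 1 - (w 1 + w 9 + w 10) = 0.
  by apply/eqP; rewrite subr_eq0 (three_term_lt (a := 1) (b := 9)).
have e10 : j 1 * j 10 - j 10 * j 11 - j 11 * j 1 - (w 1 + w 10 + w 11) = 0.
  by apply/eqP; rewrite subr_eq0 (three_term_lt (a := 1) (b := 10)).
have e11 : j 1 * j 11 + j 11 * j 11 + j 11 * j 1 - (w 1 + w 11 + w 11) = 0.
  by apply/eqP; rewrite subr_eq0 three_term_eq.
have e12 : j 2 * j 2 - j 2 * j 4 - j 4 * j 2 - (w 2 + w 2 + w 4) = 0.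
  by apply/eqP; rewrite subr_eq0 (three_term_lt (a := 2) (b := 2)).
have e13 : j 2 * j 3 - j 3 * j 5 - j 5 * j 2 - (w 2 + w 3 + w 5) = 0.
  by apply/eqP; rewrite subr_eq0 (three_term_lt (a := 2) (b := 3)).
have e14 : j 2 * j 4 - j 4 * j 6 - j 6 * j 2 - (w 2 + w 4 + w 6) = 0.
  by apply/eqP; rewrite subr_eq0 (three_term_lt (a := 2) (b := 4)).
have e15 : j 2 * j 5 - j 5 * j 7 - j 7 * j 2 - (w 2 + w 5 + w 7) = 0.
  by apply/eqP; rewrite subr_eq0 (three_term_lt (a := 2) (b := 5)).
have e16 : j 2 * j 6 - j 6 * j 8 - j 8 * j 2 - (w 2 + w 6 + w 8) = 0.
  by apply/eqP; rewrite subr_eq0 (three_term_lt (a := 2) (b := 6)).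
have e17 : j 2 * j 7 - j 7 * j 9 - j 9 * j 2 - (w 2 + w 7 + w 9) = 0.
  by apply/eqP; rewrite subr_eq0 (three_term_lt (a := 2) (b := 7)).
have e18 : j 2 * j 8 - j 8 * j 10 - j 10 * j 2 - (w 2 + w 8 + w 10) = 0.
  by apply/eqP; rewrite subr_eq0 (three_term_lt (a := 2) (b := 8)).
have e19 : j 2 * j 9 - j 9 * j 11 - j 11 * j 2 - (w 2 + w 9 + w 11) = 0.
  by apply/eqP; rewrite subr_eq0 (three_term_lt (a := 2) (b := 9)).
have e20 : j 2 * j 10 + j 10 * j 11 + j 11 * j 2 - (w 2 + w 10 + w 11) = 0.
  by apply/eqP; rewrite subr_eq0 three_term_eq.
have e21 : j 3 * j 3 - j 3 * j 6 - j 6 * j 3 - (w 3 + w 3 + w 6) = 0.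
  by apply/eqP; rewrite subr_eq0 (three_term_lt (a := 3) (b := 3)).
have e22 : j 3 * j 4 - j 4 * j 7 - j 7 * j 3 - (w 3 + w 4 + w 7) = 0.
  by apply/eqP; rewrite subr_eq0 (three_term_lt (a := 3) (b := 4)).
have e23 : j 3 * j 5 - j 5 * j 8 - j 8 * j 3 - (w 3 + w 5 + w 8) = 0.
  by apply/eqP; rewrite subr_eq0 (three_term_lt (a := 3) (b := 5)).
have e24 : j 3 * j 6 - j 6 * j 9 - j 9 * j 3 - (w 3 + w 6 + w 9) = 0.
  by apply/eqP; rewrite subr_eq0 (three_term_lt (a := 3) (b := 6)).
have e25 : j 3 * j 7 - j 7 * j 10 - j 10 * j 3 - (w 3 + w 7 + w 10) = 0.
  by apply/eqP; rewrite subr_eq0 (three_term_lt (a := 3) (b := 7)).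
have e26 : j 3 * j 8 - j 8 * j 11 - j 11 * j 3 - (w 3 + w 8 + w 11) = 0.
  by apply/eqP; rewrite subr_eq0 (three_term_lt (a := 3) (b := 8)).
have e27 : j 3 * j 9 + j 9 * j 11 + j 11 * j 3 - (w 3 + w 9 + w 11) = 0.
  by apply/eqP; rewrite subr_eq0 three_term_eq.
have e28 : j 3 * j 10 + j 10 * j 10 + j 10 * j 3 - (w 3 + w 10 + w 10) = 0.
  by apply/eqP; rewrite subr_eq0 three_term_eq.
have e29 : j 4 * j 4 - j 4 * j 8 - j 8 * j 4 - (w 4 + w 4 + w 8) = 0.
  by apply/eqP; rewrite subr_eq0 (three_term_lt (a := 4) (b := 4)).
have e30 : j 4 * j 5 - j 5 * j 9 - j 9 * j 4 - (w 4 + w 5 + w 9) = 0.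
  by apply/eqP; rewrite subr_eq0 (three_term_lt (a := 4) (b := 5)).
have e31 : j 4 * j 6 - j 6 * j 10 - j 10 * j 4 - (w 4 + w 6 + w 10) = 0.
  by apply/eqP; rewrite subr_eq0 (three_term_lt (a := 4) (b := 6)).
have e32 : j 4 * j 7 - j 7 * j 11 - j 11 * j 4 - (w 4 + w 7 + w 11) = 0.
  by apply/eqP; rewrite subr_eq0 (three_term_lt (a := 4) (b := 7)).
have e33 : j 4 * j 8 + j 8 * j 11 + j 11 * j 4 - (w 4 + w 8 + w 11) = 0.
  by apply/eqP; rewrite subr_eq0 three_term_eq.
have e34 : j 4 * j 9 + j 9 * j 10 + j 10 * j 4 - (w 4 + w 9 + w 10) = 0.
  by apply/eqP; rewrite subr_eq0 three_term_eq.
have e35 : j 5 * j 5 - j 5 * j 10 - j 10 * j 5 - (w 5 + w 5 + w 10) = 0.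
  by apply/eqP; rewrite subr_eq0 (three_term_lt (a := 5) (b := 5)).
have e36 : j 5 * j 6 - j 6 * j 11 - j 11 * j 5 - (w 5 + w 6 + w 11) = 0.
  by apply/eqP; rewrite subr_eq0 (three_term_lt (a := 5) (b := 6)).
have e37 : j 5 * j 7 + j 7 * j 11 + j 11 * j 5 - (w 5 + w 7 + w 11) = 0.
  by apply/eqP; rewrite subr_eq0 three_term_eq.
have e38 : j 5 * j 8 + j 8 * j 10 + j 10 * j 5 - (w 5 + w 8 + w 10) = 0.
  by apply/eqP; rewrite subr_eq0 three_term_eq.
have e39 : j 5 * j 9 + j 9 * j 9 + j 9 * j 5 - (w 5 + w 9 + w 9) = 0.
  by apply/eqP; rewrite subr_eq0 three_term_eq.
have e40 : j 6 * j 6 + j 6 * j 11 + j 11 * j 6 - (w 6 + w 6 + w 11) = 0.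
  by apply/eqP; rewrite subr_eq0 three_term_eq.
have e41 : j 6 * j 7 + j 7 * j 10 + j 10 * j 6 - (w 6 + w 7 + w 10) = 0.
  by apply/eqP; rewrite subr_eq0 three_term_eq.
have e42 : j 6 * j 8 + j 8 * j 9 + j 9 * j 6 - (w 6 + w 8 + w 9) = 0.
  by apply/eqP; rewrite subr_eq0 three_term_eq.
have e43 : j 7 * j 7 + j 7 * j 9 + j 9 * j 7 - (w 7 + w 7 + w 9) = 0.
  by apply/eqP; rewrite subr_eq0 three_term_eq.
have e44 : j 7 * j 8 + j 8 * j 8 + j 8 * j 7 - (w 7 + w 8 + w 8) = 0.
  by apply/eqP; rewrite subr_eq0 three_term_eq.
have e45 : T 1 + T 2 - (j 1 *+ 2 - j 2) * (s 1 - s 2) *+ 2 = 0.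
  by apply/eqP; rewrite subr_eq0 (double_lt (k := 1)).
have e46 : T 2 + T 4 - (j 2 *+ 2 - j 4) * (s 2 - s 4) *+ 2 = 0.
  by apply/eqP; rewrite subr_eq0 (double_lt (k := 2)).
have e47 : T 3 + T 6 - (j 3 *+ 2 - j 6) * (s 3 - s 6) *+ 2 = 0.
  by apply/eqP; rewrite subr_eq0 (double_lt (k := 3)).
have e48 : T 4 + T 8 - (j 4 *+ 2 - j 8) * (s 4 - s 8) *+ 2 = 0.
  by apply/eqP; rewrite subr_eq0 (double_lt (k := 4)).
have e49 : T 5 + T 10 - (j 5 *+ 2 - j 10) * (s 5 - s 10) *+ 2 = 0.
  by apply/eqP; rewrite subr_eq0 (double_lt (k := 5)).
have e50 : T 6 - T 11 - (j 6 *+ 2 + j 11) * (s 6 - s 11) *+ 2 = 0.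
  by apply/eqP; rewrite subr_eq0 (double_gt (k := 6)).
have e51 : T 7 - T 9 - (j 7 *+ 2 + j 9) * (s 7 - s 9) *+ 2 = 0.
  by apply/eqP; rewrite subr_eq0 (double_gt (k := 7)).
have e52 : T 8 - T 7 - (j 8 *+ 2 + j 7) * (s 8 - s 7) *+ 2 = 0.
  by apply/eqP; rewrite subr_eq0 (double_gt (k := 8)).
have e53 : T 9 - T 5 - (j 9 *+ 2 + j 5) * (s 9 - s 5) *+ 2 = 0.
  by apply/eqP; rewrite subr_eq0 (double_gt (k := 9)).
have e54 : T 10 - T 3 - (j 10 *+ 2 + j 3) * (s 10 - s 3) *+ 2 = 0.
  by apply/eqP; rewrite subr_eq0 (double_gt (k := 10)).
have e55 : T 11 - T 1 - (j 11 *+ 2 + j 1) * (s 11 - s 1) *+ 2 = 0.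
  by apply/eqP; rewrite subr_eq0 (double_gt (k := 11)).
transitivity (
  (136 * j 1 - 12 * j 2 + 92 * j 6 + 40 * j 7 - 36 * j 8 + 162 * j 11) * (j 1 * j 1 - j 1 * j 2 - j 2 * j 1 - (w 1 + w 1 + w 2)) +
  (190 * j 1 - 2 * j 2 + 10 * j 3 - 46 * j 5 - 92 * j 7 - 32 * j 8 + 168 * j 10 + 336 * j 11) * (j 1 * j 2 - j 2 * j 3 - j 3 * j 1 - (w 1 + w 2 + w 3)) +
  (142 * j 1 + 18 * j 2 - 2 * j 3 + 142 * j 4 + 198 * j 6 + 272 * j 8 - 310 * j 9 + 36 * j 10 - 424 * j 11) * (j 1 * j 3 - j 3 * j 4 - j 4 * j 1 - (w 1 + w 3 + w 4)) +
  (94 * j 1 + 30 * j 2 + 2 * j 4 + 50 * j 5 - 2 * j 6 + 68 * j 7 - 304 * j 8 + 160 * j 9 - 186 * j 11) * (j 1 * j 4 - j 4 * j 5 - j 5 * j 1 - (w 1 + w 4 + w 5)) +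
  (142 * j 1 + 272 * j 2 + 424 * j 3 + 2 * j 5 + 142 * j 6 - 310 * j 8 - 36 * j 9 - 198 * j 10 - 18 * j 11) * (j 1 * j 5 - j 5 * j 6 - j 6 * j 1 - (w 1 + w 5 + w 6)) +
  (2 * j 1 - 304 * j 2 + 186 * j 3 - 68 * j 4 + 94 * j 6 + 50 * j 7 + 160 * j 8 + 2 * j 10 - 30 * j 11) * (j 1 * j 6 - j 6 * j 7 - j 7 * j 1 - (w 1 + w 6 + w 7)) +
  (10 * j 1 - 336 * j 4 + 32 * j 5 + 46 * j 6 + 2 * j 7 + 190 * j 8 - 92 * j 10 + 168 * j 11) * (j 1 * j 7 - j 7 * j 8 - j 8 * j 1 - (w 1 + w 7 + w 8)) +
  (- 2 * j 1 + 198 * j 2 - 310 * j 3 + 424 * j 4 - 272 * j 5 - 18 * j 7 + 142 * j 8 + 142 * j 9 + 36 * j 11) * (j 1 * j 8 - j 8 * j 9 - j 9 * j 1 - (w 1 + w 8 + w 9)) +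
  (- 50 * j 1 - 304 * j 3 - 30 * j 5 - 68 * j 6 - 186 * j 7 - 2 * j 8 + 94 * j 9 - 2 * j 10 - 160 * j 11) * (j 1 * j 9 - j 9 * j 10 - j 10 * j 1 - (w 1 + w 9 + w 10)) +
  (- 2 * j 1 - 32 * j 4 + 168 * j 5 - 336 * j 6 + 92 * j 8 + 46 * j 9 - 10 * j 10 - 190 * j 11) * (j 1 * j 10 - j 10 * j 11 - j 11 * j 1 - (w 1 + w 10 + w 11)) +
  (- 12 * j 1 + 92 * j 3 - 36 * j 4 - 162 * j 6 - 40 * j 8 - 136 * j 11) * (j 1 * j 11 + j 11 * j 11 + j 11 * j 1 - (w 1 + w 11 + w 11)) +
  (- 162 * j 1 + 136 * j 2 - 12 * j 4 + 36 * j 7 - 40 * j 9 - 92 * j 11) * (j 2 * j 2 - j 2 * j 4 - j 4 * j 2 - (w 2 + w 2 + w 4)) +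
  (160 * j 1 - 50 * j 2 + 2 * j 3 - 94 * j 5 - 304 * j 6 + 2 * j 7 + 186 * j 9 - 30 * j 10 + 68 * j 11) * (j 2 * j 3 - j 3 * j 5 - j 5 * j 2 - (w 2 + w 3 + w 5)) +
  (- 336 * j 1 + 190 * j 2 - 168 * j 3 - 2 * j 4 + 10 * j 6 + 32 * j 7 + 92 * j 9 - 46 * j 10) * (j 2 * j 4 - j 4 * j 6 - j 6 * j 2 - (w 2 + w 4 + w 6)) +
  (- 36 * j 1 - 2 * j 2 + 198 * j 4 - 142 * j 5 - 310 * j 6 - 142 * j 7 + 424 * j 8 + 18 * j 9 - 272 * j 10) * (j 2 * j 5 - j 5 * j 7 - j 7 * j 2 - (w 2 + w 5 + w 7)) +
  (424 * j 1 + 142 * j 2 - 36 * j 3 + 18 * j 4 + 310 * j 5 - 2 * j 6 - 272 * j 7 + 142 * j 8 - 198 * j 11) * (j 2 * j 6 - j 6 * j 8 - j 8 * j 2 - (w 2 + w 6 + w 8)) +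
  (- 168 * j 1 + 10 * j 2 + 92 * j 3 - 190 * j 7 - 336 * j 8 - 2 * j 9 + 32 * j 10 - 46 * j 11) * (j 2 * j 7 - j 7 * j 9 - j 9 * j 2 - (w 2 + w 7 + w 9)) +
  (186 * j 1 + 94 * j 2 + 30 * j 4 - 160 * j 5 + 304 * j 7 + 2 * j 8 - 68 * j 9 + 50 * j 10 + 2 * j 11) * (j 2 * j 8 - j 8 * j 10 - j 10 * j 2 - (w 2 + w 8 + w 10)) +
  (30 * j 1 + 2 * j 2 - 2 * j 3 - 304 * j 4 + 186 * j 6 - 160 * j 7 - 68 * j 8 - 50 * j 9 - 94 * j 11) * (j 2 * j 9 - j 9 * j 11 - j 11 * j 2 - (w 2 + w 9 + w 11)) +
  (18 * j 1 + 142 * j 2 + 198 * j 3 + 272 * j 4 + 36 * j 5 + 424 * j 6 + 310 * j 7 + 2 * j 10 - 142 * j 11) * (j 2 * j 10 + j 10 * j 11 + j 11 * j 2 - (w 2 + w 10 + w 11)) +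
  (- 36 * j 1 - 40 * j 2 + 136 * j 3 - 92 * j 5 - 12 * j 6 + 162 * j 10) * (j 3 * j 3 - j 3 * j 6 - j 6 * j 3 - (w 3 + w 3 + w 6)) +
  (- 2 * j 1 + 186 * j 2 - 50 * j 3 + 94 * j 4 + 68 * j 5 - 2 * j 7 + 30 * j 8 - 304 * j 9 - 160 * j 10) * (j 3 * j 4 - j 4 * j 7 - j 7 * j 3 - (w 3 + w 4 + w 7)) +
  (- 310 * j 1 + 142 * j 3 - 36 * j 4 - 142 * j 5 + 272 * j 6 - 198 * j 7 - 2 * j 8 + 424 * j 9 - 18 * j 10) * (j 3 * j 5 - j 5 * j 8 - j 8 * j 3 - (w 3 + w 5 + w 8)) +
  (- 32 * j 1 + 92 * j 2 + 190 * j 3 - 2 * j 6 + 168 * j 7 + 46 * j 8 + 10 * j 9 + 336 * j 10) * (j 3 * j 6 - j 6 * j 9 - j 9 * j 3 - (w 3 + w 6 + w 9)) +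
  (92 * j 1 - 2 * j 3 + 46 * j 4 + 336 * j 5 - 10 * j 7 - 168 * j 8 - 190 * j 10 + 32 * j 11) * (j 3 * j 7 - j 7 * j 10 - j 10 * j 3 - (w 3 + w 7 + w 10)) +
  (- 304 * j 1 - 68 * j 2 + 94 * j 3 + 160 * j 4 + 2 * j 5 + 30 * j 6 - 50 * j 8 - 186 * j 10 - 2 * j 11) * (j 3 * j 8 - j 8 * j 11 - j 11 * j 3 - (w 3 + w 8 + w 11)) +
  (272 * j 1 + 142 * j 3 - 310 * j 4 - 198 * j 5 + 18 * j 6 + 36 * j 7 - 2 * j 9 - 424 * j 10 - 142 * j 11) * (j 3 * j 9 + j 9 * j 11 + j 11 * j 3 - (w 3 + w 9 + w 11)) +
  (- 40 * j 1 - 12 * j 3 + 162 * j 5 + 92 * j 9 - 136 * j 10 + 36 * j 11) * (j 3 * j 10 + j 10 * j 10 + j 10 * j 3 - (w 3 + w 10 + w 10)) +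
  (92 * j 1 - 162 * j 2 + 136 * j 4 + 40 * j 5 - 12 * j 8 - 36 * j 9) * (j 4 * j 4 - j 4 * j 8 - j 8 * j 4 - (w 4 + w 4 + w 8)) +
  (46 * j 1 - 168 * j 2 - 32 * j 3 + 10 * j 4 + 2 * j 5 + 92 * j 6 + 336 * j 7 + 190 * j 9) * (j 4 * j 5 - j 5 * j 9 - j 9 * j 4 - (w 4 + w 5 + w 9)) +
  (- 68 * j 1 + 160 * j 2 + 30 * j 3 - 50 * j 4 - 186 * j 5 + 2 * j 6 - 2 * j 9 - 94 * j 10 + 304 * j 11) * (j 4 * j 6 - j 6 * j 10 - j 10 * j 4 - (w 4 + w 6 + w 10)) +
  (198 * j 1 + 424 * j 2 + 142 * j 4 - 36 * j 6 - 142 * j 7 + 18 * j 8 + 272 * j 9 + 310 * j 10 + 2 * j 11) * (j 4 * j 7 - j 7 * j 11 - j 11 * j 4 - (w 4 + w 7 + w 11)) +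
  (- 336 * j 2 + 46 * j 3 + 190 * j 4 - 92 * j 5 - 168 * j 6 - 2 * j 8 - 32 * j 9 - 10 * j 11) * (j 4 * j 8 + j 8 * j 11 + j 11 * j 4 - (w 4 + w 8 + w 11)) +
  (- 36 * j 2 + 272 * j 3 - 2 * j 4 - 18 * j 5 - 424 * j 7 + 198 * j 8 + 142 * j 9 - 142 * j 10 + 310 * j 11) * (j 4 * j 9 + j 9 * j 10 + j 10 * j 4 - (w 4 + w 9 + w 10)) +
  (- 136 * j 5 - 36 * j 6 - 92 * j 7 - 162 * j 9 + 12 * j 10 + 40 * j 11) * (j 5 * j 5 - j 5 * j 10 - j 10 * j 5 - (w 5 + w 5 + w 10)) +
  (- 32 * j 2 - 336 * j 3 + 92 * j 4 - 10 * j 5 + 190 * j 6 - 46 * j 7 - 168 * j 9 + 2 * j 11) * (j 5 * j 6 - j 6 * j 11 - j 11 * j 5 - (w 5 + w 6 + w 11)) +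
  (- 68 * j 3 - 2 * j 4 - 2 * j 5 + 160 * j 6 - 94 * j 7 + 186 * j 8 + 30 * j 9 + 304 * j 10 + 50 * j 11) * (j 5 * j 7 + j 7 * j 11 + j 11 * j 5 - (w 5 + w 7 + w 11)) +
  (46 * j 2 - 168 * j 4 - 190 * j 5 - 32 * j 6 + 10 * j 8 - 336 * j 9 + 2 * j 10 - 92 * j 11) * (j 5 * j 8 + j 8 * j 10 + j 10 * j 5 - (w 5 + w 8 + w 10)) +
  (- 36 * j 3 + 12 * j 5 - 40 * j 6 + 162 * j 7 + 92 * j 8 + 136 * j 9) * (j 5 * j 9 + j 9 * j 9 + j 9 * j 5 - (w 5 + w 9 + w 9)) +
  (- 36 * j 2 - 162 * j 3 - 40 * j 4 + 136 * j 6 - 92 * j 10 + 12 * j 11) * (j 6 * j 6 + j 6 * j 11 + j 11 * j 6 - (w 6 + w 6 + w 11)) +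
  (- 310 * j 2 + 18 * j 3 - 424 * j 5 + 142 * j 6 + 2 * j 7 - 36 * j 8 + 198 * j 9 - 142 * j 10 - 272 * j 11) * (j 6 * j 7 + j 7 * j 10 + j 10 * j 6 - (w 6 + w 7 + w 10)) +
  (- 2 * j 2 + 160 * j 3 + 186 * j 4 + 304 * j 5 - 50 * j 6 - 30 * j 7 + 94 * j 8 + 2 * j 9 + 68 * j 10) * (j 6 * j 8 + j 8 * j 9 + j 9 * j 6 - (w 6 + w 8 + w 9)) +
  (- 40 * j 3 + 92 * j 4 - 136 * j 7 - 162 * j 8 - 12 * j 9 + 36 * j 10) * (j 7 * j 7 + j 7 * j 9 + j 9 * j 7 - (w 7 + w 7 + w 9)) +
  (92 * j 2 - 162 * j 4 + 36 * j 5 + 12 * j 7 + 136 * j 8 + 40 * j 10) * (j 7 * j 8 + j 8 * j 8 + j 8 * j 7 - (w 7 + w 8 + w 8)) +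
  23 * (T 1 + T 2 - (j 1 *+ 2 - j 2) * (s 1 - s 2) *+ 2) +
  23 * (T 2 + T 4 - (j 2 *+ 2 - j 4) * (s 2 - s 4) *+ 2) +
  23 * (T 3 + T 6 - (j 3 *+ 2 - j 6) * (s 3 - s 6) *+ 2) +
  23 * (T 4 + T 8 - (j 4 *+ 2 - j 8) * (s 4 - s 8) *+ 2) +
  (- 23 * (T 5 + T 10 - (j 5 *+ 2 - j 10) * (s 5 - s 10) *+ 2)) +
  23 * (T 6 - T 11 - (j 6 *+ 2 + j 11) * (s 6 - s 11) *+ 2) +
  (- 23 * (T 7 - T 9 - (j 7 *+ 2 + j 9) * (s 7 - s 9) *+ 2)) +
  23 * (T 8 - T 7 - (j 8 *+ 2 + j 7) * (s 8 - s 7) *+ 2) +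
  23 * (T 9 - T 5 - (j 9 *+ 2 + j 5) * (s 9 - s 5) *+ 2) +
  (- 23 * (T 10 - T 3 - (j 10 *+ 2 + j 3) * (s 10 - s 3) *+ 2)) +
  (- 23 * (T 11 - T 1 - (j 11 *+ 2 + j 1) * (s 11 - s 1) *+ 2))).
  by rewrite /csum /tsum /s; ring.
by rewrite e1 e2 e3 e4 e5 e6 e7 e8 e9 e10 e11 e12 e13 e14 e15 e16 e17 e18 e19 e20 e21 e22 e23 e24 e25 e26 e27 e28 e29 e30 e31 e32 e33 e34 e35 e36 e37 e38 e39 e40 e41 e42 e43 e44 e45 e46 e47 e48 e49 e50 e51 e52 e53 e54 e55 !mulr0 !addr0.
Qed.

(** The first hypothesis is the heat equation, the second the formula for the [m^2]-weighted series.
    They eliminate [t] and [l], after which only the certificate and the constant 72 remain.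
    Everything is multiplied by 24 to stay in a ring without division. *)
Lemma assemble (t l kappa : nat -> A) (e P : A) :
  (forall k, (0 < k <= 11)%N -> 2 * t k = 23 * (T k - 2 * ((s k + e) * j k))) ->
  (forall k, (0 < k <= 11)%N ->
     3 * l k = 46 * t k + 1058 * (j k * e - j k * w k) + kappa k) ->
  csum kappa = 72 -> P = - tsum s - 23 * e ->
  24 * (2 * csum j * P - 2 * csum t) = 72 - 3 * csum l - 69 * csum T.
Proof.
move=> ht hl hk ->.
pose r k := 46 * T k + 46 * (s k + e) * j k + 1058 * (j k * e - j k * w k) + kappa k.
have E k : (0 < k <= 11)%N -> 3 * l k + 69 * T k - 48 * t k = r k.
  move=> k11; rewrite hl //; have -> : 48 * t k = 46 * t k + 2 * t k by ring.
  by rewrite ht // /r; ring.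
have F : csum (fun k => 3 * l k + 69 * T k - 48 * t k) = csum r by rewrite /csum !E.
have K := certificate; apply/eqP; rewrite -subr_eq0; apply/eqP.
transitivity (csum (fun k => 3 * l k + 69 * T k - 48 * t k) - csum r
   + (csum kappa - 72) + (23 * csum T + 23 * csum (fun k => j k ^+ 3)
   - 483 * csum (fun k => j k * w k) - 24 * csum j * tsum s) *+ 2).
  by rewrite /r /csum /tsum /s; ring.
by rewrite F hk K !subrr !addr0.
Qed.

End Certificate.

(** * Analogues of the Weierstrass functions at the 23-torsion points *)

Definition J a := fpsC (cc a) + psi a.
(** [J a] is, up to sign, the logarithmic derivative of the Jacobi theta function with parameter
    [q^23] at the point whose multiplier is [q^a]; the part [- a / 23] of its constant makes it
    periodic. The constant of [wS a] is minus half the second Bernoulli polynomial at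
    [repr1 a / 23], and [eS] is [- E_2(q^23) / 12]. *)
Definition wS a := fpsC (1 / 24 - cc a ^+ 2 / 2) + fpsC (1 / 23) * mS a.
Definition eS := fpsC (- (1 / 12)) + fpsC (1 / 23) * mS 0.
(** A factor [n] is one derivative in the elliptic variable: [dS] is of the type of the Weierstrass
    function p and [TS] of its derivative. *)
Definition TS a := lam (fun m n => n%:R ^+ 2 * sg a m).
Definition LS a := lam (fun m n => m%:R ^+ 2 * sg a m).

Section Constants.
Variable R : comNzRingType.
Implicit Types x y : R.
Lemma fpsCD x y : fpsC (x + y) = fpsC x + fpsC y. Proof. exact: rmorphD. Qed.
Lemma fpsCM x y : fpsC (x * y) = fpsC x * fpsC y. Proof. exact: rmorphM. Qed.
Lemma cfC x n : coef (fpsC x) n = x * (n == 0%N)%:R.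
Proof. by case: n => [|n]; rewrite /= ?mulr1 ?mulr0. Qed.
Lemma cf_natM k (x : fps R) n : coef (k%:R * x) n = k%:R * coef x n.
Proof. by rewrite !mulr_natl cfMn. Qed.
End Constants.

Section Relations.
Implicit Types a b c : 'F_23.

Lemma J_opp a : a != 0 -> J (- a) = - J a.
Proof.
move=> a0; rewrite /J ccN // rmorphN opprD; congr (_ + _).
by rewrite /psi lamN; apply: eq_lam => m n _ _; rewrite /sg opprK opprB.
Qed.

Lemma mS_opp a : mS (- a) = mS a.
Proof. by apply: eq_lam => m n _ _; rewrite /ev opprK addrC. Qed.

Lemma wS_opp a : a != 0 -> wS (- a) = wS a.
Proof. by move=> a0; rewrite /wS mS_opp ccN // sqrrN. Qed.

Lemma TS_opp a : TS (- a) = - TS a.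
Proof. by rewrite /TS lamN; apply: eq_lam => m n _ _; rewrite /sg opprK; ring. Qed.

Lemma cc_sum a b c : a != 0 -> b != 0 -> c != 0 -> a + b + c = 0 ->
  cc a + cc b + cc c = 1 / 2 \/ cc a + cc b + cc c = - (1 / 2).
Proof.
move=> a0 b0 c0 abc; rewrite /cc /repr1 (negPf a0) (negPf b0) (negPf c0).
have h : ((a + b + c) %% 23 = 0)%N.
  have/(congr1 (@nat_of_ord _)) := abc.
  have -> : (((a + b + c)%R : 'F_23) : nat) = (((a + b) %% 23 + c) %% 23)%N by [].
  by rewrite modnDml.
have pos (x : 'F_23) : x != 0 -> (0 < x < 23)%N.
  move=> x0; apply/andP; split; last exact: ltn_ord.
  by rewrite lt0n; apply: contraNneq x0 => h0; apply/eqP/val_inj.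
have := (pos _ a0, pos _ b0, pos _ c0) => -[[pa pb] pc].
have [E|E] : (a + b + c = 23 \/ a + b + c = 46)%N by lia.
  left; have : (a + b + c)%N%:R = 23 :> rat by rewrite E.
  by rewrite natrD (natrD _ a b); lra.
right; have : (a + b + c)%N%:R = 46 :> rat by rewrite E.
by rewrite natrD (natrD _ a b); lra.
Qed.

(** Together with [sq] this is the classical [(zeta(x) + zeta(y) + zeta(z))^2 = p(x) + p(y) + p(z)]
    for [x + y + z = 0]. The constants agree because only the square of [cc a + cc b + cc c] enters,
    and it is 1/4 in both cases of [cc_sum]. *)
Lemma fay a b c : a != 0 -> b != 0 -> c != 0 -> a + b + c = 0 ->
  J a * J b + J b * J c + J c * J a = wS a + wS b + wS c.
Proof.
move=> a0 b0 c0 abc.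
have ab : a + b = - c by apply/eqP; rewrite -addr_eq0 abc.
have bc : b + c = - a by apply/eqP; rewrite -addr_eq0 addrC addrA abc.
have ca : c + a = - b by apply/eqP; rewrite -addr_eq0 -addrA addrC abc.
have nab : - a + - b = c by rewrite -opprD ab opprK.
have nbc : - b + - c = a by rewrite -opprD bc opprK.
have nca : - c + - a = b by rewrite -opprD ca opprK.
have lin : nd1 a b + nd1 b c + nd1 c a + (nd1 (- a) (- b) + nd1 (- b) (- c) + nd1 (- c) (- a))
    + (fpsC (cc b + cc c) * psi a + fpsC (cc c + cc a) * psi b + fpsC (cc a + cc b) * psi c) =
    fpsC (1 / 23) * mS a + fpsC (1 / 23) * mS b + fpsC (1 / 23) * mS c.
  rewrite /nd1 /psi /mS !(lamZ, lamD); apply: eq_lam => m n _ _.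
  by rewrite ab bc ca nab nbc nca !ccN // /sg /ev; field.
have cst : fpsC (cc a * cc b + cc b * cc c + cc c * cc a) =
    fpsC (1 / 24 - cc a ^+ 2 / 2) + fpsC (1 / 24 - cc b ^+ 2 / 2) + fpsC (1 / 24 - cc c ^+ 2 / 2).
  rewrite -!fpsCD; congr fpsC.
  have : (cc a + cc b + cc c) ^+ 2 = 1 / 4.
    by case: (cc_sum a0 b0 c0 abc) => ->; field.
  by rewrite !expr2; lra.
transitivity (fpsC (cc a * cc b + cc b * cc c + cc c * cc a) +
   ((psi a * psi b + psi b * psi c + psi c * psi a) +
    (fpsC (cc b + cc c) * psi a + fpsC (cc c + cc a) * psi b + fpsC (cc a + cc b) * psi c))).
  by rewrite /J; move: (cc a) (cc b) (cc c) => x y z; rewrite !fpsCD !fpsCM; ring.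
by rewrite fay_raw // lin cst /wS; ring.
Qed.

(** Expresses the p-type series through [J] and [wS], so that all later relations live in the ring
    generated by [J], [wS], [TS] and [eS]. *)
Lemma sq a : a != 0 -> dS a = J a * J a + wS a *+ 2 + eS.
Proof.
move=> a0.
have h : dS a = psi a * psi a + (fpsC (2 * cc a) * psi a + fpsC (2 / 23) * mS a
   + (fpsC (1 / 23) * mS 0)).
  rewrite sq_raw // mulr2n /md1 /nd1 /psi /mS /dS !(lamZ, lamD, lamN).
  apply: eq_lam => m n _ _.
  by rewrite !addr0 addrN !ccN // cc0 /sg /ev oppr0; field.
have JJ : J a * J a = fpsC (cc a ^+ 2) + fpsC (2 * cc a) * psi a + psi a * psi a.
  by rewrite /J; move: (cc a) => x; rewrite expr2 mulr_natl mulr2n fpsCM fpsCD; ring.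
rewrite JJ /wS /eS h; apply: fpsP => N.
by rewrite !(cfD, cfCM, cfC, cfMn); field.
Qed.

Lemma theta_J a : theta (J a) = lam (fun m n => m%:R * n%:R * sg a m).
Proof. by rewrite /J raddfD /= theta_fpsC add0r theta_lam. Qed.

(** The heat equation of the theta function, read on its logarithmic derivative; it replaces
    [theta], the derivative in [q], by derivatives in the elliptic variable. *)
Lemma heat a : a != 0 -> theta (J a) *+ 2 = (TS a - (dS a * J a) *+ 2) *+ 23.
Proof.
move=> a0.
have raw := heat_raw a0.
have h : theta (J a) = fpsC 23 * (fpsC (1 / 2) * TS a - (fpsC (cc a) * dS a + dS a * psi a)).
  rewrite raw theta_J.
  rewrite /mdn /ndn /psi /dS /TS !(lamZ, lamD, lamN); apply: eq_lam => m n _ _.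
  by rewrite !addr0 ccN // cc0 /sg /ev; field.
have dJ : dS a * J a = fpsC (cc a) * dS a + dS a * psi a by rewrite /J; ring.
rewrite h dJ; apply: fpsP => N.
by rewrite !(cfD, cfCM, cfC, cfMn, cfN); field.
Qed.

(* Stated for abstract constants because unification unfolds concrete rationals. *)
Lemma lam_comb (c0 c1 c2 c3 c4 c5 : rat)
    (v0 v1 v2 v3 v4 u1 u2 u3 u4 u5 u6 u7 u8 : nat -> nat -> rat) :
  (forall m n, (0 < m)%N -> (0 < n)%N -> c0 * v0 m n = c1 * v1 m n +
     (c2 * v2 m n + c3 * v3 m n + c4 * v4 m n) + c5 * (u1 m n - u2 m n -
     (u3 m n - u4 m n) - (u3 m n - u4 m n) - u5 m n + u6 m n - u7 m n + u8 m n)) ->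
  fpsC c0 * lam v0 = fpsC c1 * lam v1 +
     (fpsC c2 * lam v2 + fpsC c3 * lam v3 + fpsC c4 * lam v4) + fpsC c5 * (lam u1 - lam u2 -
     (lam u3 - lam u4) - (lam u3 - lam u4) - lam u5 + lam u6 - lam u7 + lam u8).
Proof. by move=> h; rewrite !(lamZ, lamN, lamD); exact: eq_lam. Qed.

(** The last constant cancels the constant terms of the two products, [LS a] having none. It equals
    529 times the third Bernoulli polynomial at [repr1 a / 23]. *)
Lemma cube a : a != 0 -> LS a *+ 3 =
  46 * theta (J a) + 1058 * (J a * eS - J a * wS a) + fpsC (1058 * cc a * (1 / 8 - cc a ^+ 2 / 2)).
Proof.
move=> a0.
have Jw : J a * wS a = fpsC (cc a * (1 / 24 - cc a ^+ 2 / 2))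
    + fpsC (1 / 24 - cc a ^+ 2 / 2) * psi a + fpsC (cc a * (1 / 23)) * mS a
    + fpsC (1 / 23) * (mS a * psi a).
  by rewrite /J /wS; move: (cc a) (1 / 23 : rat) (1 / 24 - _) => x y z; rewrite !fpsCM; ring.
have Je : J a * eS = fpsC (cc a * - (1 / 12)) + fpsC (- (1 / 12)) * psi a
    + fpsC (cc a * (1 / 23)) * mS 0 + fpsC (1 / 23) * (mS 0 * psi a).
  by rewrite /J /eS; move: (cc a) (1 / 23 : rat) (- (1 / 12) : rat) => x y z; rewrite !fpsCM; ring.
have raw := cube_raw a0.
have h : fpsC 3 * LS a = fpsC 46 * theta (J a)
   + (fpsC (- (1058 / 8) + 529 * cc a ^+ 2) * psi a
      + fpsC (46 * cc a) * mS 0 + fpsC (- 46 * cc a) * mS a) + fpsC (- 46) * (mS a * psi a - mS 0 * psi a).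
  rewrite raw theta_J; apply: lam_comb => m n _ _.
  rewrite (addr0 a) (addr0 (- a)) (add0r a) (add0r (- a)) (addrN a) (addNr a).
  by rewrite (ccN a0) cc0 /sg /ev (oppr0 'F_23); move: (cc a) => x; field.
have -> : LS a *+ 3 = fpsC 3 * LS a by apply: fpsP => N; rewrite cfMn cfCM; ring.
rewrite h Jw Je.
move: (theta (J a)) (mS a * psi a) (mS 0 * psi a) (psi a) (mS a) (mS 0) (cc a).
move=> t y y0 p s s0 x; apply: fpsP => N; clear.
by rewrite !(cfD, cf_natM, cfCM, cfC, cfMn, cfN); field.
Qed.

(** The addition formula, where [zeta(x) + zeta(y) + zeta(z)] is up to sign half of
    [(p'(x) - p'(y)) / (p(x) - p(y))], taken at [x = z = a] and [y = - 2 a]. *)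
Lemma deriv a b : a != 0 -> a + a = b ->
  TS a + TS b = ((J a *+ 2 - J b) * (dS a - dS b)) *+ 2.
Proof.
move=> a0 aab.
have b0 : b != 0.
  rewrite -aab; apply: contra (opp_neq a0) => /eqP h.
  by rewrite -subr_eq0 opprK h.
have raw := deriv_raw a0 aab.
have s1 : - a + b = a by rewrite -aab addKr.
have s2 : b + - a = a by rewrite addrC.
have s3 : a + - b = - a by rewrite -opprB s2.
have s4 : - b + a = - a by rewrite addrC.
have s5 : - a + - a = - b by rewrite -opprD aab.
have h : TS a + TS b = (dS a * psi a - dS a * psi b - (dS b * psi a) *+ 2) *+ 2
    + (dS a * psi a + dS b * psi b) *+ 2
    + (fpsC (4 * cc a - 2 * cc b) * dS a + fpsC (- 4 * cc a + 2 * cc b) * dS b).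
  rewrite raw !heat_raw // !mulr2n.
  rewrite /mdn /ndn /dS /TS !(lamZ, lamD, lamN); apply: eq_lam => m n _ _.
  rewrite (addr0 a) (addr0 (- a)) (addr0 b) (addr0 (- b)) aab s1 s2 s3 s4 s5.
  by rewrite (ccN a0) (ccN b0) cc0 /sg /ev; move: (cc a) (cc b) => x y; field.
rewrite h.
have -> : (J a *+ 2 - J b) * (dS a - dS b) =
  fpsC (2 * cc a - cc b) * (dS a - dS b) + (psi a *+ 2 - psi b) * (dS a - dS b).
  rewrite /J (_ : 2 * cc a - cc b = cc a + cc a + (- cc b)); last by ring.
  by move: (cc a) (cc b) => x y; rewrite !fpsCD rmorphN; ring.
have -> : (psi a *+ 2 - psi b) * (dS a - dS b) =
  (dS a * psi a) *+ 2 - (dS b * psi a) *+ 2 - dS a * psi b + dS b * psi b by ring.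
move: (dS a * psi a) (dS b * psi a) (dS a * psi b) (dS b * psi b) (dS a) (dS b) (cc a) (cc b).
move=> y1 y2 y3 y4 p s x z; apply: fpsP => N; clear.
by rewrite !(cfD, cfCM, cfC, cfMn, cfN); field.
Qed.

End Relations.

(** * The weight 3 Eisenstein identity *)

Lemma fpsC_nat (R : comNzRingType) n : fpsC n%:R = n%:R :> fps R.
Proof. exact: rmorph_nat. Qed.

Definition qres := [:: 1; 2; 3; 4; 6; 8; 9; 12; 13; 16; 18]%N.

Definition chi (m : nat) : int :=
  if (23 %| m)%N then 0 else if (m %% 23 \in qres)%N then 1 else -1.

Lemma dl_lt k m : (k < 23)%N -> dl k%:R m = (m %% 23 == k)%N%:R.
Proof. by move=> k23; rewrite /dl -val_eqE /= !val_Fp_nat // (modn_small k23). Qed.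

Lemma natF_neq0 k : (0 < k < 23)%N -> k%:R != 0 :> 'F_23.
Proof.
move=> /andP[k0 k23]; rewrite -val_eqE /= val_Fp_nat // modn_small //.
by rewrite -lt0n.
Qed.

Lemma natF_sub k : (k <= 23)%N -> (23 - k)%N%:R = - k%:R :> 'F_23.
Proof. by move=> k23; rewrite natrB // (_ : 23%:R = 0) ?sub0r //; apply/val_inj. Qed.

Lemma sg_lt k m : (0 < k < 23)%N ->
  sg k%:R m = (m %% 23 == k)%N%:R - (m %% 23 == 23 - k)%N%:R.
Proof.
move=> /andP[k0 k23]; rewrite /sg -natF_sub ?(ltnW k23) // !dl_lt //; lia.
Qed.

Lemma ev_lt k m : (0 < k < 23)%N ->
  ev k%:R m = (m %% 23 == k)%N%:R + (m %% 23 == 23 - k)%N%:R.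
Proof.
move=> /andP[k0 k23]; rewrite /ev -natF_sub ?(ltnW k23) // !dl_lt //; lia.
Qed.

(** The signs in [csum] are the values of [chi] on 1, ..., 11; as [chi] is odd, these classes
    together with their opposites give all of it. *)
Lemma csum_sg m : csum (fun k => sg k%:R m) = (chi m)%:~R.
Proof.
rewrite /csum !sg_lt // /chi /dvdn; have : (m %% 23 < 23)%N by rewrite ltn_mod.
by move: (m %% 23)%N => r; do 23 (case: r => [|r] //).
Qed.

Lemma tsum_ev m : tsum (fun k => ev k%:R m) = 1 - dl 0 m.
Proof.
rewrite /tsum !ev_lt // dl0 /dvdn; have : (m %% 23 < 23)%N by rewrite ltn_mod.
by move: (m %% 23)%N => r; do 23 (case: r => [|r] //).
Qed.

Lemma csum_lam (w : nat -> nat -> nat -> rat) :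
  csum (fun k => lam (w k)) = lam (fun m n => csum (fun k => w k m n)).
Proof. by rewrite /csum !(lamN, lamD). Qed.

Lemma tsum_lam (w : nat -> nat -> nat -> rat) :
  tsum (fun k => lam (w k)) = lam (fun m n => tsum (fun k => w k m n)).
Proof. by rewrite /tsum !lamD. Qed.

Lemma csumZ (A : comNzRingType) c (g : nat -> A) : csum (fun k => c * g k) = c * csum g.
Proof. by rewrite /csum; ring. Qed.

Lemma csum_fpsCD (R : comNzRingType) (g : nat -> R) (h : nat -> fps R) :
  csum (fun k => fpsC (g k) + h k) = fpsC (csum g) + csum h.
Proof. by rewrite /csum !(raddfB, raddfD) /=; ring. Qed.

Lemma csum_fpsC (R : comNzRingType) (g : nat -> R) :
  csum (fun k => fpsC (g k)) = fpsC (csum g).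
Proof. by rewrite /csum !(raddfB, raddfD). Qed.

Lemma theta_csum (R : comNzRingType) (g : nat -> fps R) :
  theta (csum g) = csum (fun k => theta (g k)).
Proof. by rewrite /csum !(raddfB, raddfD). Qed.

Lemma cc_lt k : (0 < k < 23)%N -> cc k%:R = 1 / 2 - k%:R / 23.
Proof.
move=> hk; rewrite /cc /repr1 (negPf (natF_neq0 hk)) val_Fp_nat //.
by case/andP: hk => _ hk; rewrite modn_small.
Qed.

Lemma eq_csum (A : zmodType) (g h : nat -> A) :
  (forall k, (0 < k <= 11)%N -> g k = h k) -> csum g = csum h.
Proof. by move=> gh; rewrite /csum !gh. Qed.

(** This is half the generalized Bernoulli number [B_(3, chi) = 144]. After division by 24 it is the
    constant term 3 of [G3]. *)
Lemma csum_cubic : csum (fun k => 1058 * cc k%:R * (1 / 8 - cc k%:R ^+ 2 / 2)) = 72.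
Proof.
pose g (k : nat) : int := k%:Z * (23 - k%:Z) * (23 - 2 * k%:Z).
rewrite (eq_csum (h := fun k => 46^-1 * (g k)%:~R)) => [|k /andP[k0 k11]].
  rewrite csumZ (_ : csum _ = (csum g)%:~R); last by rewrite /csum !(rmorphB, rmorphD).
  have -> : csum g = 46%N%:Z * 72%N%:Z by vm_compute.
  by rewrite intrM -!pmulrn mulKf // pnatr_eq0.
rewrite cc_lt ?k0 ?(leq_ltn_trans k11) // /g !(rmorphM, rmorphB) /= -[k%:~R]/(k%:R).
by move: (k%:R) => x; field.
Qed.

(* Three times the genus theta series, and the logarithmic derivative of
   eta(z) eta(23z). *)
Definition E3 : fps rat := fpsC 3 + lam (fun m _ => 2 * (chi m)%:~R).
Definition Pser : fps rat := 1 + lam (fun _ n => - (n%:R * (1 + (23 %| n)%N%:R))).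
Definition G3 : fps rat := fpsC 3 +
  lam (fun m n => - (1 / 8) * (m%:R ^+ 2 + 23 * n%:R ^+ 2) * (chi m)%:~R).

Definition j k := J k%:R.
Definition w k := wS k%:R.
Definition T k := TS k%:R.

Lemma E3_J : E3 = 2 * csum j.
Proof.
rewrite /E3 (_ : csum j = fpsC (csum (fun k => cc k%:R)) + csum (fun k => psi k%:R)); last first.
  exact: csum_fpsCD.
rewrite csum_lam mulrDr -(fpsC_nat _ 2) -fpsCM lamZ; congr (fpsC _ + _).
by apply: eq_lam => m n _ _; rewrite csum_sg.
Qed.

(** By [sq] the right-hand side is [- tsum dS - 12 eS]. The sum of the [dS] misses the [m] divisible
    by 23, and [- 12 eS = E_2(q^23)] supplies them together with the constant 1. *)
Lemma Pser_sum : Pser = - tsum (fun k => j k * j k + w k *+ 2) - 23 * eS.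
Proof.
have -> : tsum (fun k => j k * j k + w k *+ 2) = tsum (fun k => dS k%:R - eS).
  by rewrite /tsum !sq ?natF_neq0 // /j /w !addrK.
rewrite (_ : tsum _ = tsum (fun k => dS k%:R) - 11 * eS); last by rewrite /tsum; ring.
rewrite tsum_lam.
have -> : Pser = 1 + (lam (fun m n => - (n%:R * tsum (fun k => ev k%:R m)))
    + fpsC (- 24) * lam (fun m n => dl 0 m * n%:R)).
  congr (1 + _).
  transitivity (lam (fun m n => - n%:R) + fpsC (- 23) * lam (fun m n => dl 0 m * n%:R)).
    rewrite lam_dl0_sym [in RHS](lam_tr (fun m _ => dl 0 m * _)) lamZ lamD.
    by apply: eq_lam => m n _ _; rewrite dl0; field.
  rewrite !lamZ !lamD; apply: eq_lam => m n _ _; rewrite tsum_ev; ring.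
have -> : eS = fpsC (- (1 / 12)) + fpsC 2 * lam (fun m n => dl 0 m * n%:R).
  rewrite lam_dl0_sym /eS !lamZ; congr (_ + _); apply: eq_lam => m n _ _.
  by rewrite /ev oppr0; field.
have -> : lam (fun m n => - (n%:R * tsum (fun k => ev k%:R m))) =
    - lam (fun m n => tsum (fun k => n%:R * ev k%:R m)).
  by rewrite lamN; apply: eq_lam => m n _ _; rewrite /tsum; ring.
move: (lam _) (lam _) => x y; apply: fpsP => N; clear.
by rewrite -(fpsC_nat _ 11) -(fpsC_nat _ 23) !(cfD, cfN, cfCM, cfC, cf1); field.
Qed.

Theorem eis_identity : E3 * Pser - theta E3 = G3.
Proof.
have nF k : (0 < k <= 11)%N -> (k%:R : 'F_23) != 0.
  by move=> /andP[k0 k11]; rewrite natF_neq0 // k0 (leq_ltn_trans k11).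
pose kappa k := fpsC (1058 * cc k%:R * (1 / 8 - cc k%:R ^+ 2 / 2)) : fps rat.
have h := @assemble _ j w T _ _ _ _ (fun k => theta (j k)) (fun k => LS k%:R) kappa eS Pser.
have {}h : 24 * (2 * csum j * Pser - 2 * csum (fun k => theta (j k))) =
    72 - 3 * csum (fun k => LS k%:R) - 69 * csum T.
  apply: h; last exact: Pser_sum.
  - move=> a b a0 b0 ab; have s0 : (a + b)%N%:R != 0 :> 'F_23 by rewrite natF_neq0 // addn_gt0 a0.
    have a1 : (0 < a < 23)%N by lia.
    have b1 : (0 < b < 23)%N by lia.
    have ab0 : a%:R + b%:R + - (a + b)%N%:R = 0 :> 'F_23 by rewrite natrD subrr.
    have := @fay a%:R b%:R (- (a + b)%N%:R) (natF_neq0 a1) (natF_neq0 b1).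
    rewrite J_opp // wS_opp // oppr_eq0 /j /w => /(_ s0 ab0) <-; ring.
  - move=> a b c a0 b0 c0 abc; apply: fay; rewrite ?natF_neq0 ?a0 ?b0 ?c0 //; try lia.
    by rewrite -!natrD abc; apply/val_inj.
  - move=> k k0 k23; have k20 : (0 < 2 * k < 23)%N by lia.
    have k00 : (0 < k < 23)%N by lia.
    rewrite /T (@deriv _ (2 * k)%N%:R) ?natF_neq0 //; last by rewrite -natrD addnn mul2n.
    by rewrite !sq ?natF_neq0 // /j /w; congr (_ *+ _); ring.
  - move=> k k0 k23; have k20 : (0 < 2 * k < 23)%N by lia.
    have k00 : (0 < k < 23)%N by lia.
    rewrite /T /j /w natF_sub ?(ltnW k23) // TS_opp J_opp ?natF_neq0 // wS_opp ?natF_neq0 //.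
    rewrite !opprK (@deriv _ (2 * k)%N%:R) ?natF_neq0 //; last by rewrite -natrD addnn mul2n.
    by rewrite !sq ?natF_neq0 //; congr (_ *+ _); ring.
  - move=> k /nF k0; rewrite /j /w /T -(sq k0).
    by transitivity (theta (J k%:R) *+ 2); [ring | rewrite heat //; ring].
  - move=> k /nF k0; rewrite /j /w /kappa -cube //; ring.
  rewrite -[RHS](fpsC_nat _ 72) /kappa csum_fpsC; apply: congr1.
  exact: csum_cubic.
apply: fpsP => N.
have L1 : csum (fun k => LS k%:R) = lam (fun m n => m%:R ^+ 2 * (chi m)%:~R).
  rewrite csum_lam; apply: eq_lam => m n _ _; rewrite -csum_sg; exact: csumZ.
have L2 : csum T = lam (fun m n => n%:R ^+ 2 * (chi m)%:~R).
  rewrite csum_lam; apply: eq_lam => m n _ _; rewrite -csum_sg; exact: csumZ.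
have L3 : G3 = fpsC 3 + (fpsC (- (1 / 8)) * csum (fun k => LS k%:R) + fpsC (- (23 / 8)) * csum T).
  rewrite L1 L2 !lamZ lamD; congr (_ + _); apply: eq_lam => m n _ _.
  by move: (chi m)%:~R => c; field.
have L4 : theta E3 = 2 * csum (fun k => theta (j k)).
  rewrite E3_J thetaM -{1}(fpsC_nat _ 2) theta_fpsC mul0r add0r.
  by congr (_ * _); exact: theta_csum.
rewrite L3 L4 E3_J; have := congr1 (fun x => coef x N) h; rewrite -[2 * csum j * Pser]mulrA.
move: (csum j * Pser) (csum (fun k => LS k%:R)) (csum T) (csum _) => x y z t.
rewrite -(fpsC_nat _ 72) !(cfN, cfD, cf_natM, cfCM, cfC); lra.
Qed.

(** * From q-expansions to expansions in t *)

(** The two maps need to be inverse to each other only on the supports, so that sums over ranges of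
    different lengths, padded with zeros, can be compared directly. *)
Lemma sum_bij (I J : eqType) (A : nmodType) (s : seq I) (t : seq J)
    (h : I -> J) (h' : J -> I) (F : I -> A) (G : J -> A) :
  uniq s -> uniq t ->
  (forall i, i \in s -> F i != 0 -> [/\ h i \in t, h' (h i) = i & G (h i) = F i]) ->
  (forall j, j \in t -> G j != 0 -> [/\ h' j \in s, h (h' j) = j & F (h' j) = G j]) ->
  \sum_(i <- s) F i = \sum_(j <- t) G j.
Proof.
move=> us ut hF hG.
have nz (K : eqType) (r : seq K) (H : K -> A) :
    \sum_(k <- r) H k = \sum_(k <- [seq k <- r | H k != 0]) H k.
  rewrite big_filter [RHS]big_mkcond; apply: eq_bigr => k _.
  by case: eqP => //= ->.
rewrite nz [RHS]nz.
have pe : perm_eq [seq h i | i <- s & F i != 0] [seq j <- t | G j != 0].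
  apply: uniq_perm; last 1 first.
  - move=> j; apply/mapP/idP.
      case=> i; rewrite mem_filter => /andP[Fi si] ->.
      by have [h1 _ h3] := hF i si Fi; rewrite mem_filter h3 Fi.
    rewrite mem_filter => /andP[Gj tj]; have [h1 h2 h3] := hG j tj Gj.
    by exists (h' j); rewrite ?mem_filter ?h3 ?Gj.
  - rewrite map_inj_in_uniq ?filter_uniq // => i i'.
    rewrite !mem_filter => /andP[Fi si] /andP[Fi' si'] E.
    by have [_ <- _] := hF i si Fi; have [_ <- _] := hF i' si' Fi'; rewrite E.
  - by rewrite filter_uniq.
rewrite -(perm_big _ pe) big_map [LHS]big_seq [RHS]big_seq; apply: eq_bigr => i.
by rewrite mem_filter => /andP[Fi si]; have [_ _ <-] := hF i si Fi.
Qed.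

Section Order.
Variable R : comNzRingType.
Implicit Types x t : fps R.

Lemma cfX_small t n k : coef t 0 = 0 -> (k < n)%N -> coef (t ^+ n) k = 0.
Proof.
move=> t0; elim: n k => // n IH k; rewrite ltnS => kn; rewrite exprS cfM big_ord_recl t0 mul0r add0r.
rewrite big1 // => i _; rewrite IH ?mulr0 // lift0.
by have := ltn_ord i; lia.
Qed.

Lemma cfX_diag t n : coef t 0 = 0 -> coef (t ^+ n) n = coef t 1 ^+ n.
Proof.
move=> t0; elim: n => [|n IH]; first by rewrite expr0 cf1.
rewrite exprS cfM big_ord_recl t0 mul0r add0r big_ord_recl /= subSS subn0 IH -exprS.
rewrite big1 ?addr0 // => i _; rewrite cfX_small ?mulr0 // /bump /=.
by have := ltn_ord i; lia.
Qed.

Lemma cfXn k n : coef (fpsXn R k) n = (n == k)%:R. Proof. by []. Qed.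

Lemma fpsXnM i j : fpsXn R i * fpsXn R j = fpsXn R (i + j)%N.
Proof.
apply: fpsP => n; rewrite cfXnM /=; case: leqP => h.
  by rewrite -(eqn_add2l i (n - i)) subnKC.
by case: eqP => // E; move: h; rewrite E ltnNge leq_addr.
Qed.

Lemma fpsXnX i n : fpsXn R i ^+ n = fpsXn R (i * n)%N.
Proof.
elim: n => [|n IH]; first by rewrite muln0; apply: fpsP => -[].
by rewrite exprS IH fpsXnM mulnS.
Qed.

Lemma fps_trunc x k : exists y,
  x = \sum_(i < k) fpsC (coef x i) * fpsXn R i + fpsXn R k * y.
Proof.
exists (Fps (fun n => coef x (n + k))); apply: fpsP => n.
rewrite cfD cfXnM cf_sum; case: leqP => kn.
  rewrite [coef (Fps _) _]/= subnK // big1 ?add0r // => i _; rewrite cfCM cfXn.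
  by case: eqP => [E|_] /=; [have := ltn_ord i; lia | rewrite mulr0].
rewrite addr0 (bigD1 (Ordinal kn)) // cfCM cfXn eqxx mulr1 big1 => [|i ik]; first exact/esym/addr0.
by rewrite cfCM cfXn; case: eqP => [E|_] /=; [rewrite -val_eqE /= E eqxx in ik | rewrite mulr0].
Qed.

Definition dilate (p : nat) x : fps R :=
  Fps (fun k => if (p %| k)%N then coef x (k %/ p) else 0).

Lemma cf_dilate p x k :
  coef (dilate p x) k = if (p %| k)%N then coef x (k %/ p) else 0.
Proof. by []. Qed.

Lemma dilateM p x y : (0 < p)%N -> dilate p (x * y) = dilate p x * dilate p y.
Proof.
move=> p0; apply: fpsP => k; rewrite [RHS]cfM /=.
case: ifP => [pk|npk]; last first.
  rewrite big1 // => i _; case: ifP => pi; rewrite ?mul0r //.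
  case: ifP => pki; rewrite ?mulr0 //.
  have ik : (i <= k)%N by rewrite -ltnS.
  by have := dvdn_add pki pi; rewrite subnK // npk.
rewrite -(big_mkord xpredT (fun i => coef x i * coef y (k %/ p - i)%N)).
rewrite -(big_mkord xpredT (fun i => (if (p %| i)%N then coef x (i %/ p) else 0) *
   (if (p %| k - i)%N then coef y ((k - i) %/ p) else 0))).
have sub j : (k - j * p)%N = ((k %/ p - j) * p)%N by rewrite mulnBl divnK.
apply: (@sum_bij _ _ _ _ _ (fun j => j * p)%N (fun i => i %/ p)%N); rewrite ?iota_uniq //.
  move=> j; rewrite !mem_index_iota ltnS => /= jk _.
  rewrite mulnK // dvdn_mull // sub dvdn_mull // mulnK //.
  by split => //; rewrite ltnS -leq_divRL.
move=> i; rewrite !mem_index_iota ltnS => /= ik.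
case: ifP => pi; rewrite ?mul0r ?eqxx //; case: ifP => pki; rewrite ?mulr0 ?eqxx // => _.
by rewrite divnK // ltnS leq_div2r // divnBr.
Qed.

Lemma dilate1 p : (0 < p)%N -> dilate p 1 = 1.
Proof.
move=> p0; apply: fpsP => k /=; case: ifP => [pk|].
  by rewrite -(eqn_pmul2r p0) divnK // mul0n.
by case: k => //; rewrite dvdn0.
Qed.

Lemma dilateX p x n : (0 < p)%N -> dilate p (x ^+ n) = dilate p x ^+ n.
Proof.
move=> p0; elim: n => [|n IH]; first by rewrite !expr0 dilate1.
by rewrite !exprS dilateM // IH.
Qed.

End Order.

(** * Frobenius congruences for powers of integral power series *)

Section Frobenius.
Variable p : nat.
Hypothesis pr : prime p.

Definition fcong (d : int) (x y : fps int) := exists z, x - y = fpsC d * z.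

(** Up to degree [k] the series is a finite sum of monomials, on which the Frobenius is additive; it
    fixes the coefficients by Fermat and multiplies the exponents by [p]. *)
Lemma frobenius_Fp (x : fps 'F_p) : x ^+ p = dilate p x.
Proof.
have p0 := prime_gt0 pr.
have ch : p \in [pchar (fps 'F_p)].
  have := pchar_Fp pr; rewrite !inE pr /= => /eqP E.
  by apply/eqP; rewrite -fpsC_nat E raddf0.
apply: fpsP => k; have [y ->] := fps_trunc x k.+1.
set S := \sum_(i < _) _; set Z := _ * y.
have -> : (S + Z) ^+ p = S ^+ p + Z ^+ p.
  by rewrite -!(pFrobenius_autE ch) rmorphD.
have -> : S ^+ p = \sum_(i < k.+1) fpsC (coef x i ^+ p) * fpsXn _ (i * p)%N.
  rewrite -(pFrobenius_autE ch) rmorph_sum /=; apply: eq_bigr => i _.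
  by rewrite pFrobenius_autE exprMn fpsXnX rmorphXn.
rewrite /Z exprMn fpsXnX cfD cf_sum cfXnM (_ : (k.+1 * p <= k)%N = false); last first.
  by apply/negbTE; rewrite -ltnNge; exact: leq_trans (leq_pmulr _ p0).
rewrite addr0 cf_dilate; case: ifP => pk; last first.
  rewrite big1 // => i _; rewrite cfCM cfXn.
  by case: eqP => [E|_] /=; [rewrite E dvdn_mull in pk | rewrite mulr0].
have kp : (k %/ p < k.+1)%N by rewrite ltnS leq_div.
rewrite cfD cf_sum cfXnM leqNgt kp addr0.
rewrite (bigD1 (Ordinal kp)) // [RHS](bigD1 (Ordinal kp)) //.
congr (_ + _).
  rewrite !cfCM !cfXn /= divnK // !eqxx !mulr1.
  by have := expf_card (coef x (k %/ p)); rewrite card_Fp.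
rewrite !big1 // => i ik.
  by rewrite cfCM cfXn; case: eqP => [E|_] /=; [rewrite -val_eqE /= E eqxx in ik | rewrite mulr0].
rewrite cfCM cfXn.
case: eqP => [E|_] /=; last by rewrite mulr0.
have := mulnK i p0; rewrite -E => h.
by rewrite -val_eqE /= h eqxx in ik.
Qed.

Lemma fcongP d x y : d != 0 ->
  fcong d x y <-> forall k, (d %| coef x k - coef y k)%Z.
Proof.
move=> d0; split => [[z E] k|h].
  by rewrite -[_ - _]/(coef (x - y) k) E cfCM dvdz_mulr.
exists (Fps (fun k => (coef x k - coef y k) %/ d)%Z); apply: fpsP => k.
by rewrite cfCM /= mulrC divzK.
Qed.

Lemma frobenius_cong (x : fps int) : fcong p%:Z (x ^+ p) (dilate p x).
Proof.
apply/fcongP => [|k]; first by rewrite eqz_nat -lt0n prime_gt0.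
have ch : p \in [pchar 'F_p] by rewrite pchar_Fp.
have im (u : int) : ((p %| u)%Z = (u%:~R == 0 :> 'F_p)) by rewrite (dvdz_pcharf ch).
rewrite im rmorphB /= subr_eq0; apply/eqP.
have := congr1 (fun y => coef y k) (frobenius_Fp (fps_map intr x)).
rewrite -rmorphXn /= => ->.
by case: ifP => // _; rewrite rmorph0.
Qed.

Lemma fcong_exp d x y m : fcong d x y -> fcong d (x ^+ m) (y ^+ m).
Proof.
case=> z E; exists (z * \sum_(i < m) x ^+ (m.-1 - i) * y ^+ i).
by rewrite mulrA -E subrXX.
Qed.

(** In [x^p - y^p = (x - y) * sum_i x^(p-1-i) y^i] each of the [p] terms of the second factor is
    [y^(p-1)] modulo [p], so that factor brings one more [p]. *)
Lemma fcong_exp_p j x y : (0 < j)%N -> fcong (p ^ j)%N%:Z x y ->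
  fcong (p ^ j.+1)%N%:Z (x ^+ p) (y ^+ p).
Proof.
move=> j0 [z E].
have xE : x = y + fpsC (p ^ j)%N%:Z * z by rewrite -E addrC subrK.
have [u Eu] : exists u, \sum_(i < p) x ^+ (p.-1 - i) * y ^+ i = fpsC p%:Z * u.
  have main : forall i : 'I_p, exists v,
      x ^+ (p.-1 - i) * y ^+ i = y ^+ p.-1 + fpsC p%:Z * v.
    move=> i; have [v Ev] := @fcong_exp _ _ _ (p.-1 - i) (ex_intro _ z E).
    exists (fpsC (p ^ j.-1)%N%:Z * v * y ^+ i).
    have ip : (i <= p.-1)%N by rewrite -ltnS prednK ?prime_gt0.
    have -> : x ^+ (p.-1 - i) = y ^+ (p.-1 - i) + fpsC (p ^ j)%N%:Z * v by rewrite -Ev addrC subrK.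
    rewrite mulrDl -exprD subnK //; congr (_ + _).
    by rewrite -(prednK j0) expnS PoszM rmorphM !mulrA.
  have [v hv] := choice main.
  exists (y ^+ p.-1 + \sum_(i < p) v i).
  rewrite (eq_bigr _ (fun i _ => hv i)) big_split /= sumr_const card_ord -mulr_sumr mulrDr.
  by congr (_ + _); rewrite -mulr_natl -fpsC_nat -natz.
exists (z * u); rewrite subrXX E.
by rewrite Eu expnSr PoszM rmorphM; ring.
Qed.

(** Start from the congruence modulo [p] and raise to the power [p] once for each factor [p] of [m];
    the prime-to-[p] part of [m] changes nothing. *)
Lemma dilate_cong x m : (0 < m)%N ->
  fcong (p ^ (logn p m).+1)%N%:Z (x ^+ (p * m)) (dilate p x ^+ m).
Proof.
move=> m0; have [m' nd E] : exists2 m', ~~ (p %| m')%N & m = (p ^ logn p m * m')%N.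
  by have [m' cop E] := pfactor_coprime pr m0; exists m'; [rewrite -prime_coprime | rewrite mulnC].
rewrite {2 3}E !exprM; apply: fcong_exp; elim: (logn p m) => [|v IH].
  by rewrite expn0 !expr1 expn1; exact: frobenius_cong.
by rewrite (expnSr p v) !exprM; apply: fcong_exp_p.
Qed.

End Frobenius.

(** * Gauss congruences and the Dieudonne-Dwork argument *)

Section PLocal.
Variable p : nat.
Hypothesis pr : prime p.

Definition pint (x : rat) := exists a : int, exists2 b : nat, coprime p b & x * b%:R = a%:~R.

Lemma pint_int (z : int) : pint z%:~R.
Proof. by exists z, 1%N; rewrite ?coprimen1 // mulr1. Qed.

Lemma pintD x y : pint x -> pint y -> pint (x + y).
Proof.
move=> [a [b pb E]] [c [d pd E']]; exists (a * d%:Z + c * b%:Z), (b * d)%N.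
  by rewrite coprimeMr pb pd.
by rewrite rmorphD !rmorphM /= -E -E' -!pmulrn; ring.
Qed.

Lemma pintM x y : pint x -> pint y -> pint (x * y).
Proof.
move=> [a [b pb E]] [c [d pd E']]; exists (a * c), (b * d)%N.
  by rewrite coprimeMr pb pd.
by rewrite !rmorphM /= -E -E'; ring.
Qed.

Lemma pintN x : pint x -> pint (- x).
Proof. by move=> hx; rewrite -mulN1r; apply: pintM => //; exact: (pint_int (-1)). Qed.

Lemma pintB x y : pint x -> pint y -> pint (x - y).
Proof. by move=> hx hy; apply: pintD => //; exact: pintN. Qed.

Lemma pint_sum (I : eqType) (s : seq I) (F : I -> rat) :
  (forall i, i \in s -> pint (F i)) -> pint (\sum_(i <- s) F i).
Proof.
elim: s => [|i s IH] h; first by rewrite big_nil; exact: (pint_int 0).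
rewrite big_cons; apply: pintD; first by apply: h; rewrite mem_head.
by apply: IH => j js; apply: h; rewrite inE js orbT.
Qed.

Lemma ppart n : (0 < n)%N -> exists2 m, coprime p m & n = (p ^ logn p n * m)%N.
Proof. by move=> n0; have [m cm E] := pfactor_coprime pr n0; exists m => //; rewrite mulnC. Qed.

Lemma pint_div (a : int) n : (0 < n)%N -> ((p ^ logn p n)%N %| a)%Z -> pint (a%:~R / n%:R).
Proof.
move=> n0 /dvdzP[z ->]; have [m cm E] := ppart n0; exists z, m => //.
have pv0 : (p ^ logn p n)%N%:R != 0 :> rat by rewrite pnatr_eq0 -lt0n expn_gt0 prime_gt0.
have m0 : m%:R != 0 :> rat.
  by rewrite pnatr_eq0; apply: contraTneq n0 => m0; rewrite E m0 muln0.
rewrite {2}E natrM rmorphM /= -pmulrn; field.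
by rewrite pv0 m0.
Qed.

Lemma pint_dvd (c : int) n : (0 < n)%N -> pint (c%:~R / n%:R) -> ((p ^ logn p n)%N %| c)%Z.
Proof.
move=> n0 [a [b cb E]].
have n0' : n%:R != 0 :> rat by rewrite pnatr_eq0 -lt0n.
have : c * b%:Z = a * n%:Z.
  apply: (@intr_inj rat); rewrite !rmorphM /= -!pmulrn -E.
  by rewrite [RHS]mulrAC mulfVK.
move=> /(congr1 absz); rewrite !abszM !absz_nat => h.
rewrite dvdzE absz_nat -(@Gauss_dvdl _ _ b) ?coprimeXl // h dvdn_mull //.
exact: pfactor_dvdnn.
Qed.

(** The coefficient of [q^k] in the sum of [c_n t^n / n]; terms with [n > k] do not contribute when
    [t] has no constant term. *)
Definition phi (c : nat -> int) (t : fps int) k : rat :=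
  \sum_(1 <= n < k.+1) (c n)%:~R / n%:R * (coef (t ^+ n) k)%:~R.

Definition lower (c : nat -> int) n : int := if (p %| n)%N then c (n %/ p)%N else 0.

(** [phi c t (k/p) / p] is the coefficient of [q^k] in the sum of [c_m t(q^p)^m / (p m)]. Replacing
    [t(q^p)^m] by [t^(p m)] costs a multiple of [p^(v_p(m)+1) = p^(v_p(p m))], which the denominator
    [p m] absorbs up to [p]-integers; then [c_n] faces [c_(n/p)]. *)
Lemma phi_dilate c t k : coef t 0 = 0 -> (0 < k)%N ->
  pint (phi c t k - (if (p %| k)%N then phi c t (k %/ p)%N / p%:R else 0)
    - \sum_(1 <= n < k.+1) (c n - lower c n)%:~R / n%:R * (coef (t ^+ n) k)%:~R).
Proof.
move=> t0 k0; have p0 := prime_gt0 pr.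
have pR : p%:R != 0 :> rat by rewrite pnatr_eq0 -lt0n.
have -> : (if (p %| k)%N then phi c t (k %/ p)%N / p%:R else 0) =
    \sum_(1 <= m < (k %/ p).+1) (c m)%:~R / (p * m)%N%:R * (coef (dilate p t ^+ m) k)%:~R.
  case: ifP => pk.
    rewrite /phi mulr_suml; apply: eq_big_nat => m /andP[m0 _].
    rewrite -dilateX // cf_dilate pk natrM; field.
    by rewrite pR pnatr_eq0 -lt0n m0.
  rewrite big1 // => m _; rewrite -dilateX // cf_dilate pk rmorph0 mulr0 //.
rewrite addrAC /phi -sumrB.
rewrite (eq_bigr (fun n => (lower c n)%:~R / n%:R * (coef (t ^+ n) k)%:~R)); last first.
  by move=> n _; rewrite rmorphB /=; ring.
have -> : \sum_(1 <= n < k.+1) (lower c n)%:~R / n%:R * (coef (t ^+ n) k)%:~R =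
    \sum_(1 <= m < (k %/ p).+1) (c m)%:~R / (p * m)%N%:R * (coef (t ^+ (p * m)) k)%:~R :> rat.
  apply: (@sum_bij _ _ _ _ _ (fun n => n %/ p)%N (fun m => p * m)%N); rewrite ?iota_uniq //.
    move=> n; rewrite !mem_index_iota /lower => /andP[n0 nk].
    case: ifP => pn; last by rewrite !mul0r eqxx.
    move=> _; have E : (p * (n %/ p) = n)%N by rewrite mulnC divnK.
    rewrite E; split => //; rewrite ltnS leq_div2r // andbT.
    by rewrite divn_gt0 // dvdn_leq.
  move=> m; rewrite !mem_index_iota /lower => /andP[m0 mk] _.
  rewrite mulKn // dvdn_mulr //; split => //.
  by rewrite muln_gt0 p0 m0 ltnS mulnC -leq_divRL // -ltnS.
rewrite -sumrB; apply: pint_sum => m; rewrite mem_index_iota => /andP[m0 _].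
rewrite -mulrBr mulrAC -rmorphB /= -rmorphM /=; apply: pint_div; first by rewrite muln_gt0 p0.
apply: dvdz_mull.
have /fcongP h := dilate_cong pr t m0.
rewrite lognM // (logn_prime _ pr) eqxx add1n; apply: h.
by rewrite eqz_nat -lt0n expn_gt0 p0.
Qed.

(** Multiplication by [k] is [theta], and [theta (t^n / n) = t^(n-1) theta t] removes the
    denominators. *)
Lemma mul_phi c t k : (0 < k)%N ->
  k%:R * phi c t k = (\sum_(1 <= n < k.+1) c n * coef (t ^+ n.-1 * theta t) k)%:~R.
Proof.
move=> k0; rewrite /phi mulr_sumr rmorph_sum /=; apply: eq_big_nat => -[//|n] _ /=.
have h : coef (t ^+ n.+1) k *+ k = coef (t ^+ n * theta t) k *+ n.+1.
  by rewrite -cf_theta thetaX cfMn.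
have h' : k%:R * (coef (t ^+ n.+1) k)%:~R = n.+1%:R * (coef (t ^+ n * theta t) k)%:~R :> rat.
  by rewrite !mulr_natl -!rmorphMn /= h.
have n0 : n.+1%:R != 0 :> rat by rewrite pnatr_eq0.
rewrite rmorphM /= mulrCA h'; field.
by rewrite addrC natr1.
Qed.

Definition gauss (a : nat -> int) := forall k, (0 < k)%N -> (p %| k)%N ->
  ((p ^ logn p k)%N %| a k - a (k %/ p)%N)%Z.

(** Apply [phi_dilate] to [t = 1 - u] and [c = 1]: the series is then [- log u], and [k] times its
    coefficient is [- l_k]. The differences [c_n - c_(n/p)] are 0 when [p] divides [n] and 1
    otherwise, so the remaining sum is [p]-integral. *)
Lemma logderiv_gauss (u l : fps int) : coef u 0 = 1 -> theta u = u * l -> gauss (coef l).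
Proof.
move=> u0 ul k k0 pk.
have p0 := prime_gt0 pr.
have kp0 : (0 < k %/ p)%N by rewrite divn_gt0 // dvdn_leq.
pose t : fps int := 1 - u.
have t0 : coef t 0 = 0 by rewrite cfB cf1 u0 subrr.
have l0 : coef l 0 = 0.
  by have := congr1 (fun x => coef x 0) ul; rewrite cf_theta mulr0n cfM0 u0 mul1r => <-.
have tt : theta t = - ((1 - t) * l).
  by rewrite /t raddfB /= theta1 sub0r ul; congr (- _); rewrite opprB addrC subrK.
have kphi j : (0 < j)%N -> j%:R * phi (fun=> 1) t j = - (coef l j)%:~R.
  move=> j0; rewrite mul_phi // -rmorphN; congr (_%:~R).
  rewrite (eq_bigr (fun n => coef (t ^+ n.-1 * theta t) j)); last by move=> n _; rewrite mul1r.
  rewrite -cf_sum -mulr_suml tt mulrN mulrA cfN.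
  have -> : (\sum_(1 <= n < j.+1) t ^+ n.-1) * (1 - t) = 1 - t ^+ j.
    rewrite big_add1 /= big_mkord mulrC -[1 in RHS](expr1n _ j) subrXX.
    by congr (_ * _); apply: eq_bigr => i _; rewrite expr1n mul1r.
  rewrite mulrBl mul1r cfB (_ : coef (t ^+ j * l) j = 0) ?subr0 //.
  rewrite cfM big_ord_recr /= subnn l0 mulr0 addr0 big1 // => i _.
  by rewrite cfX_small ?mul0r.
have := phi_dilate (fun=> 1) t0 k0; rewrite pk => h.
have D : pint (\sum_(1 <= n < k.+1) (1 - lower (fun=> 1) n)%:~R / n%:R * (coef (t ^+ n) k)%:~R).
  apply: pint_sum => n; rewrite mem_index_iota => /andP[n0 _].
  apply: pintM; last exact: pint_int.
  apply: pint_div => //; rewrite /lower; case: ifP => pn; first by rewrite subrr dvdz0.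
  by rewrite lognE pn !andbF expn0 dvd1z.
have := pintD h D; rewrite subrK => {}h.
have E : phi (fun=> 1) t k - phi (fun=> 1) t (k %/ p) / p%:R =
    (- (coef l k - coef l (k %/ p)))%:~R / k%:R.
  have kR : k%:R != 0 :> rat by rewrite pnatr_eq0 -lt0n.
  apply: (mulfI kR); rewrite mulrBr kphi // rmorphN rmorphB /=.
  have -> : k%:R * (phi (fun=> 1) t (k %/ p) / p%:R) = - (coef l (k %/ p))%:~R :> rat.
    rewrite -kphi // -{1}(divnK pk) natrM; field.
    by rewrite pnatr_eq0 -lt0n.
  by rewrite mulrCA mulfV // mulr1; ring.
by rewrite E in h; have := pint_dvd k0 h; rewrite !dvdzE abszN.
Qed.

(** With [lt = theta t / t = P - theta f / f] the hypothesis on [G] reads [f * lt = G]. Hence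
    [theta] of the sum of [c_n t^n / n] is [(f - 1) lt = G - P + theta f / f], three series with
    Gauss congruences, and [phi_dilate] carries these over to [c]. *)
Lemma transfer (f t P G : fps int) (c : nat -> int) :
  coef f 0 = 1 -> coef t 0 = 0 -> coef t 1 = 1 ->
  theta (t * f) = t * f * P -> f * P - theta f = G ->
  (forall k, coef f k = \sum_(n < k.+1) c n * coef (t ^+ n) k) ->
  gauss (coef P) -> gauss (coef G) -> gauss c.
Proof.
move=> f0 t0 t1 hP hG fc gP gG.
have p0 := prime_gt0 pr.
pose lf := fps_inv f * theta f.
have ff := fps_mulV f0.
have hlf : theta f = f * lf by rewrite /lf mulrA ff mul1r.
have glf := logderiv_gauss f0 hlf.
pose lt := P - lf.
have hlt : theta t = t * lt.
  have : f * theta t = f * (t * lt).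
    by rewrite /lt; have := hP; rewrite thetaM hlf => h; rewrite -[LHS](addrK (t * (f * lf))) [f * _]mulrC h; ring.
  by move/(congr1 (fun x => fps_inv f * x)); rewrite !mulrA [fps_inv f * f]mulrC ff !mul1r.
have fl : f * lt = G by rewrite /lt mulrBr -hlf hG.
have c0 : c 0%N = 1 by rewrite -f0 fc big_ord_recl big_ord0 expr0 cf1 mulr1 addr0.
(* The coefficients of [(f - 1) * lt]; the sum of the [c_n t^n] starts at [n = 1], whence the
   missing constant [c_0 = 1]. *)
pose A k := coef G k - coef lt k.
have gA k : (0 < k)%N -> (p %| k)%N -> ((p ^ logn p k)%N %| A k - A (k %/ p)%N)%Z.
  move=> k0 pk; rewrite /A /lt !cfB.
  have -> : coef G k - (coef P k - coef lf k) - (coef G (k %/ p) - (coef P (k %/ p) - coef lf (k %/ p))) =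
    (coef G k - coef G (k %/ p)) - (coef P k - coef P (k %/ p)) + (coef lf k - coef lf (k %/ p)) by ring.
  by apply: rpredD; [apply: rpredB; [exact: gG | exact: gP] | exact: glf].
have kphi k : (0 < k)%N -> k%:R * phi c t k = (A k)%:~R.
  move=> k0; rewrite mul_phi //; congr (_%:~R).
  rewrite (eq_big_nat _ _ (F2 := fun n => coef (fpsC (c n) * t ^+ n * lt) k)); last first.
    by move=> -[//|n] _; rewrite [n.+1.-1]/= hlt mulrA -exprSr -mulrA cfCM.
  rewrite /A -fl -cf_sum -mulr_suml.
  have -> : \sum_(1 <= n < k.+1) fpsC (c n) * t ^+ n = \sum_(n < k.+1) fpsC (c n) * t ^+ n - 1.
    by rewrite -[in RHS](big_mkord xpredT (fun n => fpsC (c n) * t ^+ n)) big_ltn // c0 rmorph1 expr0 mulr1 addrC addKr.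
  rewrite mulrBl mul1r cfB; congr (_ - _); rewrite !cfM; apply: eq_bigr => i _; congr (_ * _).
  rewrite cf_sum fc.
  have ik : (i < k.+1)%N := ltn_ord i.
  rewrite (big_ord_widen k.+1 (fun n => c n * coef (t ^+ n) i)) // [RHS]big_mkcond.
  apply: eq_bigr => n _; rewrite cfCM; case: ltnP => // ni.
  by rewrite cfX_small ?mulr0.
have pD k : (0 < k)%N ->
    pint (\sum_(1 <= n < k.+1) (c n - lower c n)%:~R / n%:R * (coef (t ^+ n) k)%:~R).
  move=> k0; have h := phi_dilate c t0 k0.
  have kR : k%:R != 0 :> rat by rewrite pnatr_eq0 -lt0n.
  have phiE : phi c t k = (A k)%:~R / k%:R.
    by apply: (mulfI kR); rewrite kphi // mulrCA mulfV // mulr1.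
  suff q : pint (phi c t k - (if (p %| k)%N then phi c t (k %/ p)%N / p%:R else 0)).
    by have := pintB q h; rewrite opprB addrC subrK.
  case: ifP => pk; last first.
    rewrite subr0 phiE; apply: pint_div => //.
    by rewrite lognE pk !andbF expn0 dvd1z.
  have kp0 : (0 < k %/ p)%N by rewrite divn_gt0 // dvdn_leq.
  have -> : phi c t (k %/ p) / p%:R = (A (k %/ p)%N)%:~R / k%:R.
    have E : k%:R = (k %/ p)%N%:R * p%:R :> rat by rewrite -natrM divnK.
    have kpR : (k %/ p)%N%:R != 0 :> rat by rewrite pnatr_eq0 -lt0n.
    have pR : p%:R != 0 :> rat by rewrite pnatr_eq0 -lt0n.
    by rewrite E -kphi //; field; rewrite kpR pR.
  by rewrite phiE -mulrBl -rmorphB /=; apply: pint_div => //; exact: gA.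
(* The system given by [pD] is triangular with diagonal entries 1, as [t] begins with [q]; solve it
   by strong induction. *)
have pc n : (0 < n)%N -> pint ((c n - lower c n)%:~R / n%:R).
  have [m] := ubnP n; elim: m n => // m IH n; rewrite ltnS => nm n0.
  have := pD n n0; rewrite big_nat_recr //= cfX_diag // t1 expr1n mulr1 => h.
  rewrite -[_ / _](addKr (\sum_(1 <= i < n) (c i - lower c i)%:~R / i%:R * (coef (t ^+ i) n)%:~R)).
  apply: pintD => //; apply: pintN; apply: pint_sum => i; rewrite mem_index_iota => /andP[i0 ni].
  by apply: pintM; [apply: IH => //; exact: leq_trans nm | exact: pint_int].
move=> k k0 pk; have := pint_dvd k0 (pc k k0).
by rewrite /lower pk.
Qed.

End PLocal.

(** * The pentagonal number theorem and f - F *)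

Section Pentagonal.
Variables (A : comNzRingType) (q : A).

Definition tri s := 'C(s.+1, 2).

Lemma triS s : tri s.+1 = (tri s + s.+1)%N.
Proof. by rewrite /tri binS bin1 addnC. Qed.

Definition qprod s n := \prod_(s.+1 <= i < n.+1) (1 - q ^+ i).

(** Shanks's finite form of the pentagonal number theorem. The term [s = 0] is the truncated Euler
    product and the others have order above [n]; writing the quotient of two truncated products as
    [qprod s n] avoids division. *)
Definition shanks n := \sum_(s < n.+1) (-1) ^+ s * qprod s n * q ^+ (s * n + tri s).

(** The differences of corresponding terms telescope, with partial sums [- c m]. *)
Lemma shanks_step n : shanks n.+1 = shanks n
  + (-1) ^+ n.+1 * (q ^+ (n.+1 * n + tri n.+1) + q ^+ (n.+1 * n.+1 + tri n.+1)).
Proof.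
pose c s := (-1) ^+ s * qprod s n * q ^+ (s.+1 * n + tri s.+1).
have qS s : (s <= n)%N -> qprod s n.+1 = qprod s n * (1 - q ^+ n.+1).
  by move=> sn; rewrite /qprod big_nat_recr.
have tele m : (m <= n)%N -> \sum_(s < m.+1) ((-1) ^+ s * qprod s n.+1 * q ^+ (s * n.+1 + tri s)
    - (-1) ^+ s * qprod s n * q ^+ (s * n + tri s)) = - c m.
  elim: m => [|m IH] mn.
    rewrite big_ord1 /= qS // /c !mul0n !mul1n !add0n !expr0.
    by rewrite (_ : tri 1 = 1%N) // addn1; ring.
  rewrite big_ord_recr /= IH 1?ltnW // /c qS //.
  have -> : qprod m n = (1 - q ^+ m.+1) * qprod m.+1 n by rewrite /qprod big_ltn.
  have -> : (m.+1 * n.+1 + tri m.+1 = m.+1 * n + tri m.+1 + m.+1)%N by rewrite mulnS; lia.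
  have -> : (m.+2 * n + tri m.+2 = m.+1 * n + tri m.+1 + m.+1 + n.+1)%N.
    by rewrite (triS m.+1) mulSn; lia.
  rewrite !exprD (exprS (-1) m); move: (q ^+ m.+1) (q ^+ n.+1) => z w; ring.
rewrite /shanks big_ord_recr /=; apply/eqP; rewrite -subr_eq0; apply/eqP.
have := tele n (leqnn n); rewrite sumrB => h.
have -> : qprod n.+1 n.+1 = 1 by rewrite /qprod big_geq.
have qnn : qprod n n = 1 by rewrite /qprod big_geq.
move: h; rewrite /c qnn; set x := \sum_(s < _) _; set y := \sum_(s < _) _ => h.
have -> : x = y - (-1) ^+ n * 1 * q ^+ (n.+1 * n + tri n.+1) by rewrite -h addrC subrK.
by rewrite exprS; ring.
Qed.

Lemma shanks_closed n : shanks n = 1 +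
  \sum_(1 <= s < n.+1) (-1) ^+ s * (q ^+ (s * s.-1 + tri s) + q ^+ (s * s + tri s)).
Proof.
elim: n => [|n IH].
  rewrite big_geq // addr0 /shanks big_ord1 /= /qprod big_geq // mul0n.
  by rewrite (_ : tri 0 = 0%N) // !expr0 !mulr1.
by rewrite shanks_step IH [in RHS]big_nat_recr //= addrA.
Qed.

End Pentagonal.

Definition zr (N : nat) : seq int := [seq k%:Z - N%:Z | k <- iota 0 (N + N).+1].

Lemma zr_uniq N : uniq (zr N).
Proof. by rewrite map_inj_uniq ?iota_uniq // => x y /addIr []. Qed.

Lemma mem_zr N (k : int) : (k \in zr N) = (`|k| <= N)%N.
Proof.
apply/mapP/idP.
  by case=> i; rewrite mem_iota => /= ? ->; lia.
move=> kN; exists `|(k + N%:Z)%R|%N; first by rewrite mem_iota /=; lia.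
lia.
Qed.

Lemma sum_zr (A : zmodType) N (g : int -> A) :
  \sum_(k <- zr N) g k = g 0 + \sum_(1 <= s < N.+1) (g s%:Z + g (- s%:Z)).
Proof.
have zrE K : \sum_(k <- zr K) g k = \sum_(0 <= i < (K + K).+1) g (i%:Z - K%:Z).
  by rewrite /zr big_map /index_iota subn0.
rewrite zrE; elim: N => [|N IH].
  by rewrite big_nat1 subrr [X in _ + X]big_geq // addr0.
rewrite [in RHS]big_nat_recr //= addrA -IH (_ : (N.+1 + N.+1).+1 = (N + N).+3); last by lia.
rewrite [LHS]big_nat_recl // [in LHS]big_nat_recr //= [LHS]addrCA [X in _ + X = _]addrC; congr (_ + _).
  by apply: eq_bigr => i _; congr (g _); lia.
by congr (g _ + g _); lia.
Qed.

Section EtaProduct.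
Variable R : comNzRingType.

Definition prodq s K : fps R := \prod_(1 <= i < K.+1) (1 - fpsXn R (s * i)%N).

Lemma prodq_stable s K n : (0 < s)%N -> (n <= K)%N -> coef (prodq s K) n = coef (prodq s n) n.
Proof.
move=> s0; elim: K => [|K IH] nK; first by have -> : n = 0%N by lia.
move: nK; rewrite leq_eqVlt => /predU1P[-> //|nK].
have -> : prodq s K.+1 = prodq s K - fpsXn R (s * K.+1)%N * prodq s K.
  by rewrite /prodq big_nat_recr //=; ring.
by rewrite cfB cfXnM IH // leqNgt (leq_trans nK) ?subr0 // leq_pmull.
Qed.

Definition psign (k : int) : R := (-1) ^+ `|k|%N.

Lemma tri2 j : (2 * tri j = j * j.+1)%N.
Proof. by elim: j => // j IH; rewrite triS; lia. Qed.

Lemma pentE1 (j : nat) : (0 < j)%N ->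
  (6 * j%:Z - 1) ^+ 2 - 1 = 24 * (j * j.-1 + tri j)%N%:Z.
Proof.
case: j => // j _; have := tri2 j.+1; move: (tri j.+1) => t h.
have h' : 2 * t%:Z = (j%:Z + 1) * (j%:Z + 2) by lia.
have -> : (j.+1 * j.+1.-1 + t)%N%:Z = (j%:Z + 1) * j%:Z + t%:Z by lia.
have -> : j.+1%:Z = j%:Z + 1 by lia.
move: h'; move: t%:Z j%:Z => u v h'.
have -> : 24 * ((v + 1) * v + u) = 24 * ((v + 1) * v) + 12 * (2 * u) by ring.
by rewrite h'; ring.
Qed.

Lemma pentE2 (j : nat) : (6 * (- j%:Z) - 1) ^+ 2 - 1 = 24 * (j * j + tri j)%N%:Z.
Proof.
have := tri2 j; move: (tri j) => t h.
have h' : 2 * t%:Z = j%:Z * (j%:Z + 1) by lia.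
rewrite PoszD PoszM; move: h'; move: t%:Z j%:Z => u v h'.
have -> : 24 * (v * v + u) = 24 * (v * v) + 12 * (2 * u) by ring.
by rewrite h'; ring.
Qed.

Lemma pentagonal s N M : (0 < s)%N -> (N <= M)%N -> coef (prodq s N) N =
  \sum_(k <- zr M) psign k * (s%:Z * ((6 * k - 1) ^+ 2 - 1) == 24 * N%:Z)%:R.
Proof.
move=> s0 NM; rewrite -(prodq_stable s0 NM).
have XE i : fpsXn R s ^+ i = fpsXn R (s * i)%N by exact: fpsXnX.
have sgE j : (-1) ^+ j = fpsC ((-1) ^+ j) :> fps R by rewrite rmorphXn rmorphN rmorph1.
have eqE e : (s%:Z * (24 * e%:Z) == 24 * N%:Z) = (N == s * e)%N.
  by rewrite mulrCA -PoszM -!PoszM eqz_nat eqn_pmul2l // eq_sym.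
have := shanks_closed (fpsXn R s) M.
rewrite /shanks big_ord_recl [nat_of_ord ord0]/= expr0 mul1r mul0n (_ : tri 0 = 0%N) // addn0 expr0 mulr1 => h.
have -> : prodq s M = qprod (fpsXn R s) 0 M by apply: eq_bigr => i _; rewrite XE.
have {}h := congr1 (fun x => coef x N) h.
rewrite cfD cf_sum big1 ?addr0 in h; last first.
  move=> i _; rewrite XE mulrC cfXnM ifF //; apply/negbTE; rewrite -ltnNge lift0.
  have : (0 < tri i.+1)%N by rewrite triS addnS.
  by move: (tri _) => t t0; nia.
rewrite h cfD cf1 cf_sum sum_zr; congr (_ + _).
  by rewrite /psign expr0 mul1r (_ : s%:Z * _ = s%:Z * (24 * 0%:Z)) // eqE muln0.
apply: eq_big_nat => j /andP[j0 _].
rewrite sgE cfCM !XE cfD !cfXn pentE1 // pentE2 !eqE /psign abszN absz_nat.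
by rewrite mulrDr.
Qed.

Definition eprod s : fps R := Fps (fun n => coef (prodq s n) n).

Definition hser : fps R := fpsXn R 1 * eprod 1 * eprod 23.

Lemma pent_nat (k : int) : exists e : nat, (6 * k - 1) ^+ 2 - 1 = 24 * e%:Z.
Proof.
by case: (intP k) => [|n|n]; [exists 0%N | exists (n.+1 * n + tri n.+1)%N; rewrite pentE1
  | exists (n.+1 * n.+1 + tri n.+1)%N; rewrite pentE2].
Qed.

(** Completing the square, 24 times a pentagonal exponent plus 1 is [(6 k - 1)^2]; the extra
    [1 + 23 = 24] accounts for the factor [q]. *)
Lemma cf_hser M : coef hser M = \sum_(k <- zr M) \sum_(l <- zr M)
  psign k * psign l * ((6 * k - 1) ^+ 2 + 23 * (6 * l - 1) ^+ 2 == 24 * M%:Z)%:R.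
Proof.
rewrite /hser -mulrA cfXnM; case: M => [|M] /=.
  by rewrite (_ : zr 0 = [:: 0]) // !big_seq1 (_ : (_ == _ :> int) = false) ?mulr0.
rewrite subSS subn0.
transitivity (\sum_(i < M.+1) (\sum_(k <- zr M.+1) psign k * (1%N%:Z * ((6 * k - 1) ^+ 2 - 1) == 24 * i%:Z)%:R)
  * (\sum_(l <- zr M.+1) psign l * (23%N%:Z * ((6 * l - 1) ^+ 2 - 1) == 24 * (M - i)%N%:Z)%:R)).
  apply: eq_bigr => i _; have iM : (i <= M)%N by rewrite -ltnS.
  by rewrite -!pentagonal // ?(leq_trans (leq_subr _ _)) // (leq_trans iM).
rewrite (eq_bigr (fun i : 'I_M.+1 => \sum_(k <- zr M.+1) \sum_(l <- zr M.+1)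
    (psign k * (1%N%:Z * ((6 * k - 1) ^+ 2 - 1) == 24 * i%:Z)%:R)
    * (psign l * (23%N%:Z * ((6 * l - 1) ^+ 2 - 1) == 24 * (M - i)%N%:Z)%:R))); last first.
  by move=> i _; rewrite mulr_suml; apply: eq_bigr => k _; rewrite mulr_sumr.
rewrite exchange_big /=; apply: eq_bigr => k _.
rewrite exchange_big /=; apply: eq_bigr => l _.
have [e Ee] := pent_nat k; have [e' Ee'] := pent_nat l.
rewrite (eq_bigr (fun i : 'I_M.+1 => psign k * psign l * ((e == i) && (23 * e' == M - i))%N%:R)); last first.
  move=> i _; rewrite Ee Ee' mul1r mulrACA -natrM mulnb; congr (_ * (nat_of_bool (_ && _))%:R).
    by apply/eqP/eqP; lia.
  by apply/eqP/eqP; lia.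
rewrite -mulr_sumr; congr (_ * _).
have -> : ((6 * k - 1) ^+ 2 + 23 * (6 * l - 1) ^+ 2 == 24 * M.+1%:Z) = (e + 23 * e' == M)%N.
  by apply/eqP/eqP; lia.
case: eqP => [E|E].
  have eM : (e < M.+1)%N by lia.
  rewrite (bigD1 (Ordinal eM)) //= eqxx /= (_ : (23 * e' == M - e)%N) ?big1 ?addr0 //; last by lia.
  by move=> i; rewrite -val_eqE /= eq_sym => /negPf ->.
rewrite big1 // => i _; have := ltn_ord i.
by case: eqP => // <-; case: eqP => //; lia.
Qed.

End EtaProduct.

(** * The difference of the two theta series *)

Definition thetaq (a b c : int) : fps int := Fps (fun n =>
  \sum_(x <- zr n) \sum_(y <- zr n) (a * x ^+ 2 + b * x * y + c * y ^+ 2 == n%:Z)%:R).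

Definition chi12 (a : int) : int :=
  if ((a %% 12)%Z == 1) || ((a %% 12)%Z == 11) then 1
  else if ((a %% 12)%Z == 5) || ((a %% 12)%Z == 7) then -1 else 0.

Lemma chi12_pent k : chi12 (6 * k - 1) = psign int k.
Proof.
rewrite /psign -signr_odd /chi12.
have [h|h] : (k %% 2)%Z = 0 \/ (k %% 2)%Z = 1 by lia.
  have -> : ((6 * k - 1) %% 12)%Z = 11 by lia.
  by have -> : odd `|k| = false by lia.
have -> : ((6 * k - 1) %% 12)%Z = 5 by lia.
by have -> : odd `|k| = true by lia.
Qed.

Lemma chi12N a : chi12 (- a) = chi12 a.
Proof.
rewrite /chi12.
have [h|h] : (a %% 12)%Z = 0 \/ ((- a) %% 12)%Z = 12 - (a %% 12)%Z by lia.
  have -> : ((- a) %% 12)%Z = 0 by lia.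
  by rewrite h.
by rewrite h; do !case: eqP => //; lia.
Qed.

(** The integers prime to 6 are the [6 k - 1] and their opposites, and [chi12] is even; whence the
    factor 2. *)
Lemma sum_chi12 B (g : int -> int) : (forall a, g (- a) = g a) ->
  \sum_(a <- zr (6 * B + 1)%N) chi12 a * g a =
  2 * \sum_(k <- zr B) psign int k * g (6 * k - 1).
Proof.
move=> gN.
pose F1 (a : int) : int := if (6 %| a + 1)%Z then chi12 a * g a else 0.
have E1 : \sum_(a <- zr (6 * B + 1)%N) F1 a = \sum_(k <- zr B) psign int k * g (6 * k - 1).
  apply: (@sum_bij _ _ _ _ _ (fun a => ((a + 1) %/ 6)%Z) (fun k => 6 * k - 1)); rewrite ?zr_uniq //.
    move=> a; rewrite !mem_zr /F1 => aB; case: ifP; rewrite ?eqxx // => d _.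
    have E : 6 * ((a + 1) %/ 6)%Z - 1 = a by lia.
    by rewrite -chi12_pent E; split => //; lia.
  move=> k; rewrite !mem_zr /F1 => kB _.
  have -> : ((6 * k - 1 + 1) %/ 6)%Z = k by lia.
  have -> : (6 %| 6 * k - 1 + 1)%Z by lia.
  by rewrite chi12_pent; split => //; lia.
have E2 : \sum_(a <- zr (6 * B + 1)%N) F1 (- a) = \sum_(a <- zr (6 * B + 1)%N) F1 a.
  apply: (@sum_bij _ _ _ _ _ (fun a => - a) (fun a => - a)); rewrite ?zr_uniq //.
    by move=> a; rewrite !mem_zr abszN opprK.
  by move=> a; rewrite !mem_zr abszN opprK.
have -> : 2 * \sum_(k <- zr B) psign int k * g (6 * k - 1) =
    \sum_(a <- zr (6 * B + 1)%N) (F1 a + F1 (- a)).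
  by rewrite big_split /= E2 E1 mulr_natl mulr2n.
apply: eq_bigr => a _.
rewrite /F1 chi12N gN.
case: ifP => d1; case: ifP => d2; rewrite ?addr0 ?add0r //; first by lia.
have h : (a %% 12)%Z = 0 \/ (a %% 12)%Z = 2 \/ (a %% 12)%Z = 3 \/ (a %% 12)%Z = 4 \/
  (a %% 12)%Z = 6 \/ (a %% 12)%Z = 8 \/ (a %% 12)%Z = 9 \/ (a %% 12)%Z = 10 by lia.
by rewrite /chi12; case: h => [->|[->|[->|[->|[->|[->|[->|->]]]]]]]; rewrite mul0r.
Qed.

Lemma sq_le (x : int) (B : nat) : x ^+ 2 <= B%:Z ^+ 2 + 2 * B%:Z -> (`|x| <= B)%N.
Proof. by move=> h; rewrite leqNgt; apply/negP => xB; nia. Qed.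

Lemma sq_bound (s x : int) (c M : nat) : (c <= 24)%N ->
  c%:Z * M%:Z = s ^+ 2 + 23 * x ^+ 2 -> (`|x| <= M)%N.
Proof.
move=> c24; have := sqr_ge0 s; move: (s ^+ 2) => u u0 h; apply: sq_le.
have M0 := sqr_ge0 M%:Z; move: (x ^+ 2) h => v h.
have : c%:Z * M%:Z <= 24 * M%:Z by nia.
by move: (M%:Z ^+ 2) M0 => m2 m20; lia.
Qed.

Lemma sq_bound2 (a b : int) (M : nat) : a ^+ 2 + 23 * b ^+ 2 = 24 * M%:Z ->
  (`|a| <= 6 * M + 1)%N && (`|b| <= 6 * M + 1)%N.
Proof.
have := (sqr_ge0 a, sqr_ge0 b, sqr_ge0 M%:Z) => -[[a0 b0] M0] h.
have E : (6 * M + 1)%N%:Z ^+ 2 = 36 * M%:Z ^+ 2 + 12 * M%:Z + 1 by rewrite PoszD PoszM; ring.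
by apply/andP; split; apply: sq_le; rewrite E;
  move: (a ^+ 2) (b ^+ 2) (M%:Z ^+ 2) a0 b0 M0 h => u v m2 *; lia.
Qed.

Lemma mem_box (s t : seq int) (u : int * int) :
  (u \in [seq (x, y) | x <- s, y <- t]) = (u.1 \in s) && (u.2 \in t).
Proof.
apply/allpairsP/andP.
  by case=> v [? ? ->].
by case=> h1 h2; exists u; split => //; case: u {h1 h2}.
Qed.

Lemma sum_box (s t : seq int) (F : int -> int -> int) :
  \sum_(x <- s) \sum_(y <- t) F x y = \sum_(u <- [seq (x, y) | x <- s, y <- t]) F u.1 u.2.
Proof. by rewrite big_allpairs. Qed.

Lemma box_uniq M N : uniq [seq (x, y) | x <- zr M, y <- zr N].
Proof. by apply: allpairs_uniq; rewrite ?zr_uniq // => -[? ?] [? ?]. Qed.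

(** On the solutions of [a^2 + 23 b^2 = 24 M], the congruence [a = d b] modulo 12 cuts out a lattice
    carrying the first form for [d = 1] and the second for [d = 5]. *)
Definition dual12 (c M : nat) (d : int) : int := \sum_(a <- zr c) \sum_(b <- zr c)
  ((a ^+ 2 + 23 * b ^+ 2 == 24 * M%:Z) && (12 %| a - d * b)%Z)%:R.

Lemma dual12N c M d : dual12 c M (- d) = dual12 c M d.
Proof.
rewrite /dual12; apply: (@sum_bij _ _ _ _ _ (fun a => - a) (fun a => - a)); rewrite ?zr_uniq //.
  move=> a; rewrite !mem_zr abszN opprK => -> _; split => //.
  apply: eq_bigr => b _; rewrite sqrrN; congr ((_ && _)%:R).
  by rewrite (_ : - a - d * b = - (a - (- d) * b)) ?dvdzE ?abszN //; ring.
move=> a; rewrite !mem_zr abszN opprK => -> _; split => //.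
apply: eq_bigr => b _; rewrite sqrrN; congr ((_ && _)%:R).
by rewrite (_ : - a - (- d) * b = - (a - d * b)) ?dvdzE ?abszN //; ring.
Qed.

(** Uses [24 (x^2 + x y + 6 y^2) = (x - 11 y)^2 + 23 (x + y)^2]. *)
Lemma dual12_1 M : dual12 (6 * M + 1) M 1 = coef (thetaq 1 1 6) M.
Proof.
rewrite /dual12 /= !sum_box.
apply: (@sum_bij _ _ _ _ _ (fun u => (u.2 - ((u.2 - u.1) %/ 12)%Z, ((u.2 - u.1) %/ 12)%Z))
  (fun v => (v.1 - 11 * v.2, v.1 + v.2))); rewrite ?box_uniq //.
  move=> [a b]; rewrite !mem_box !mem_zr /= => _.
  rewrite pnatr_eq0 eqb0 negbK => /andP[/eqP E d]; have d' := d; rewrite mul1r in d'.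
  have [y Ey] : exists y, b - a = 12 * y by exists ((b - a) %/ 12)%Z; lia.
  have Eb : b = a + 12 * y by lia.
  have -> : ((b - a) %/ 12)%Z = y by rewrite Ey; lia.
  have Q : (b - y) ^+ 2 + (b - y) * y + 6 * y ^+ 2 = M%:Z.
    have : 24 * ((b - y) ^+ 2 + (b - y) * y + 6 * y ^+ 2) = 24 * M%:Z by rewrite -E Eb; ring.
    by move/mulfI; apply.
  split; last 1 first.
  - by rewrite E eqxx d !mul1r Q eqxx.
  - have e1 : 24%N%:Z * M%:Z = (12 * y + (b - y)) ^+ 2 + 23 * (b - y) ^+ 2 by rewrite -Q; ring.
    have e2 : 4%N%:Z * M%:Z = (2 * (b - y) + y) ^+ 2 + 23 * y ^+ 2 by rewrite -Q; ring.
    by rewrite (sq_bound _ e1) // (sq_bound _ e2).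
  - by congr (_, _); rewrite Eb; ring.
move=> [x y]; rewrite !mem_box !mem_zr /= !mul1r => _.
rewrite pnatr_eq0 eqb0 negbK => /eqP E.
have -> : ((x + y - (x - 11 * y)) %/ 12)%Z = y.
  by rewrite (_ : _ - _ = y * 12) ?mulzK //; ring.
have Q : (x - 11 * y) ^+ 2 + 23 * (x + y) ^+ 2 = 24 * M%:Z by rewrite -E; ring.
split; last 1 first.
- by rewrite Q E !eqxx (_ : x - 11 * y - (x + y) = (- y) * 12) ?dvdz_mull //; ring.
- exact: sq_bound2 Q.
- by congr (_, _); ring.
Qed.

(** Uses [24 (2 x^2 + x y + 3 y^2) = (5 x + 7 y)^2 + 23 (x - y)^2]. *)
Lemma dual12_5 M : dual12 (6 * M + 1) M 5 = coef (thetaq 2 1 3) M.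
Proof.
rewrite /dual12 /= !sum_box.
apply: (@sum_bij _ _ _ _ _ (fun u => (u.2 + ((u.1 - 5 * u.2) %/ 12)%Z, ((u.1 - 5 * u.2) %/ 12)%Z))
  (fun v => (5 * v.1 + 7 * v.2, v.1 - v.2))); rewrite ?box_uniq //.
  move=> [a b]; rewrite !mem_box !mem_zr /= => _.
  rewrite pnatr_eq0 eqb0 negbK => /andP[/eqP E d].
  have [y Ey] : exists y, a - 5 * b = 12 * y by exists ((a - 5 * b) %/ 12)%Z; lia.
  have Ea : a = 5 * b + 12 * y by lia.
  have -> : ((a - 5 * b) %/ 12)%Z = y by rewrite Ey; lia.
  have Q : 2 * (b + y) ^+ 2 + (b + y) * y + 3 * y ^+ 2 = M%:Z.
    have : 24 * (2 * (b + y) ^+ 2 + (b + y) * y + 3 * y ^+ 2) = 24 * M%:Z by rewrite -E Ea; ring.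
    by move/mulfI; apply.
  split; last 1 first.
  - by rewrite E eqxx d !mul1r Q eqxx.
  - have e1 : 12%N%:Z * M%:Z = (6 * y + (b + y)) ^+ 2 + 23 * (b + y) ^+ 2 by rewrite -Q; ring.
    have e2 : 8%N%:Z * M%:Z = (4 * (b + y) + y) ^+ 2 + 23 * y ^+ 2 by rewrite -Q; ring.
    by rewrite (sq_bound _ e1) // (sq_bound _ e2).
  - by rewrite Ea; congr (_, _); ring.
move=> [x y]; rewrite !mem_box !mem_zr /= !mul1r => _.
rewrite pnatr_eq0 eqb0 negbK => /eqP E.
have -> : ((5 * x + 7 * y - 5 * (x - y)) %/ 12)%Z = y.
  by rewrite (_ : _ - _ = y * 12) ?mulzK //; ring.
have Q : (5 * x + 7 * y) ^+ 2 + 23 * (x - y) ^+ 2 = 24 * M%:Z by rewrite -E; ring.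
split; last 1 first.
- by rewrite Q E !eqxx (_ : 5 * x + 7 * y - 5 * (x - y) = y * 12) ?dvdz_mull //; ring.
- exact: sq_bound2 Q.
- by congr (_, _); ring.
Qed.

(** The equation forces [a^2 = b^2] modulo 24. The hypothesis modulo 24 and both sides depend only
    on [a] and [b] modulo 24, which leaves a finite check. *)
Lemma chi12_split (a b M : int) : a ^+ 2 + 23 * b ^+ 2 = 24 * M -> chi12 a * chi12 b =
  (12 %| a - 1 * b)%Z%:R + (12 %| a - (- 1) * b)%Z%:R
  - (12 %| a - 5 * b)%Z%:R - (12 %| a - (- 5) * b)%Z%:R.
Proof.
move=> E.
pose r := `|(a %% 24)%Z|%N; pose s := `|(b %% 24)%Z|%N.
have [u Ea] : exists u, a = 24 * u + r%:Z by exists (a %/ 24)%Z; rewrite /r; lia.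
have [v Eb] : exists v, b = 24 * v + s%:Z by exists (b %/ 24)%Z; rewrite /s; lia.
have r24 : (r < 24)%N by rewrite /r; lia.
have s24 : (s < 24)%N by rewrite /s; lia.
have cE (w : int) (x : nat) : chi12 (24 * w + x%:Z) = chi12 x%:Z.
  by rewrite /chi12 (_ : ((24 * w + x%:Z) %% 12)%Z = (x%:Z %% 12)%Z) //; lia.
have dE d : (12 %| a - d * b)%Z = (12 %| r%:Z - d * s%:Z)%Z.
  rewrite Ea Eb (_ : _ - _ = (2 * u - 2 * d * v) * 12 + (r%:Z - d * s%:Z)); last by ring.
  by rewrite dvdzE -dvdzE; apply/idP/idP => h; lia.
have h24 : (24 %| r%:Z ^+ 2 + 23 * s%:Z ^+ 2)%Z.
  apply/dvdzP; exists (M - 24 * u ^+ 2 - 2 * u * r%:Z - 23 * (24 * v ^+ 2 + 2 * v * s%:Z)).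
  have : 24 * M = a ^+ 2 + 23 * b ^+ 2 by rewrite E.
  by rewrite Ea Eb => h; rewrite [LHS](_ : _ = 24 * M - (24 * 24 * u ^+ 2 + 24 * 2 * u * r%:Z + 23 * (24 * 24 * v ^+ 2 + 24 * 2 * v * s%:Z))); [ring | rewrite h; ring].
rewrite !dE Ea Eb !cE.
pose ok (x y : nat) := (24 %| x%:Z ^+ 2 + 23 * y%:Z ^+ 2)%Z ==>
  (chi12 x%:Z * chi12 y%:Z == (12 %| x%:Z - 1 * y%:Z)%Z%:R + (12 %| x%:Z - (- 1) * y%:Z)%Z%:R
  - (12 %| x%:Z - 5 * y%:Z)%Z%:R - (12 %| x%:Z - (- 5) * y%:Z)%Z%:R).
have all_ok : all (fun x => all (ok x) (iota 0 24)) (iota 0 24) by vm_compute.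
have /allP/(_ r) := all_ok; rewrite mem_iota => /(_ r24) /allP/(_ s).
by rewrite mem_iota => /(_ s24); rewrite /ok h24 /= => /eqP.
Qed.

Theorem theta_diff : thetaq 1 1 6 - thetaq 2 1 3 = hser int *+ 2.
Proof.
apply: fpsP => M; rewrite cfMn cfB; apply: (@mulfI _ 2) => //.
have -> : 2 * (coef (hser int) M *+ 2) = 2 * (2 * coef (hser int) M) by ring.
rewrite cf_hser.
pose g (a b : int) : int := (a ^+ 2 + 23 * b ^+ 2 == 24 * M%:Z)%:R.
have -> : 2 * (2 * \sum_(k <- zr M) \sum_(l <- zr M) psign int k * psign int l *
     ((6 * k - 1) ^+ 2 + 23 * (6 * l - 1) ^+ 2 == 24 * M%:Z)%:R) =
   \sum_(a <- zr (6 * M + 1)) \sum_(b <- zr (6 * M + 1)) chi12 a * chi12 b * g a b.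
  rewrite [RHS](eq_bigr (fun a => chi12 a * \sum_(b <- zr (6 * M + 1)) chi12 b * g a b)); last first.
    by move=> a _; rewrite mulr_sumr; apply: eq_bigr => b _; rewrite mulrA.
  rewrite sum_chi12; last by move=> a; apply: eq_bigr => b _; rewrite /g sqrrN.
  congr (_ * _); rewrite mulr_sumr; apply: eq_bigr => k _.
  rewrite sum_chi12; last by move=> b; rewrite /g sqrrN.
  rewrite [RHS]mulrCA; congr (_ * _); rewrite mulr_sumr; apply: eq_bigr => l _.
  by rewrite /g [RHS]mulrA.
rewrite -dual12_1 -dual12_5.
have -> : 2 * (dual12 (6 * M + 1) M 1 - dual12 (6 * M + 1) M 5) = dual12 (6 * M + 1) M 1
    + dual12 (6 * M + 1) M (- 1) - dual12 (6 * M + 1) M 5 - dual12 (6 * M + 1) M (- 5).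
  by rewrite !dual12N; ring.
rewrite /dual12 -!(sumrB, big_split) /=; apply: eq_bigr => a _.
rewrite -!(sumrB, big_split) /=; apply: eq_bigr => b _; rewrite /g.
case: eqP => E; last by rewrite !mulr0 !subrr.
by rewrite (chi12_split E) mulr1.
Qed.

(** * Representations by forms of discriminant -23 *)

(** A one-to-one correspondence given as a relation: a representation determines its root only
    through an existential choice of basis, so no map has to be written down. *)
Lemma size_rel (I J : eqType) (s : seq I) (t : seq J) (r : I -> J -> Prop) :
  uniq s -> uniq t ->
  (forall i, i \in s -> exists2 j, j \in t & r i j) ->
  (forall j, j \in t -> exists2 i, i \in s & r i j) ->
  (forall i j j', i \in s -> j \in t -> j' \in t -> r i j -> r i j' -> j = j') ->
  (forall i i' j, i \in s -> i' \in s -> j \in t -> r i j -> r i' j -> i = i') ->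
  size s = size t.
Proof.
move=> us ut h1 h2 u1 u2.
have le (K L : eqType) (a : seq K) (b : seq L) (q : K -> L -> Prop) : uniq a ->
    (forall k, k \in a -> exists2 l, l \in b & q k l) ->
    (forall k k' l, k \in a -> k' \in a -> l \in b -> q k l -> q k' l -> k = k') ->
    (size a <= size b)%N.
  move=> ua ex un.
  have ex' k : exists l : option L, k \in a -> exists2 l', l = Some l' & l' \in b /\ q k l'.
    case: (boolP (k \in a)) => [ka|_]; last by exists None.
    by have [l lb ql] := ex k ka; exists (Some l) => _; exists l.
  have [h hh] := choice ex'.
  rewrite -(size_map h a) -(size_map some b); apply: uniq_leq_size.
    rewrite map_inj_in_uniq // => k k' ka ka' E.
    have [l El [lb ql]] := hh k ka; have [l' El' [lb' ql']] := hh k' ka'.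
    by move: E; rewrite El El' => -[E]; apply: (un k k' l) => //; rewrite E.
  move=> x /mapP[k ka ->]; have [l -> [lb _]] := hh k ka.
  exact: map_f.
apply/eqP; rewrite eqn_leq (le _ _ _ _ r) //=.
  by apply: (le _ _ _ _ (fun j i => r i j)) => // k k' l ka ka' lb q1 q2; exact: (u1 l).
Qed.

(* The reduced forms [A x^2 + (2 beta + 1) x y + C y^2] of discriminant -23. *)
Definition fA (i : 'I_3) : int := if i == 0 :> nat then 1 else 2.
Definition fbeta (i : 'I_3) : int := if i == 2%N :> nat then -1 else 0.
Definition fC (i : 'I_3) : int := if i == 0 :> nat then 6 else 3.
Definition qf i (x y : int) : int :=
  fA i * x ^+ 2 + (2 * fbeta i + 1) * x * y + fC i * y ^+ 2.
(** In the basis [(x, y)], [(z, w)] of determinant 1 the form becomes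
    [m X^2 + (2 b + 1) X Y + c Y^2] with [b = pol i x y z w]; the summand [fbeta i] stands for
    [fbeta i * (x w - y z)]. *)
Definition pol i (x y z w : int) : int :=
  fA i * x * z + (2 * fbeta i + 1) * y * z + fC i * y * w + fbeta i.

(** Invariance of the discriminant: [m c = b^2 + b + 6] says that [(2 b + 1)^2 - 4 m c = -23]. *)
Lemma qf_pol i x y z w : x * w - y * z = 1 ->
  qf i x y * qf i z w = pol i x y z w ^+ 2 + pol i x y z w + 6.
Proof.
move=> d; have e : fA i * fC i = fbeta i ^+ 2 + fbeta i + 6.
  by case: i => -[|[|[]]].
rewrite /qf /pol; move: e; move: (fA i) (fbeta i) (fC i) => A b C e.
have -> : (A * x ^+ 2 + (2 * b + 1) * x * y + C * y ^+ 2) *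
   (A * z ^+ 2 + (2 * b + 1) * z * w + C * w ^+ 2) =
   (A * x * z + (2 * b + 1) * y * z + C * y * w + b * (x * w - y * z)) ^+ 2
   + (A * x * z + (2 * b + 1) * y * z + C * y * w + b * (x * w - y * z)) * (x * w - y * z)
   + (A * C - b ^+ 2 - b) * (x * w - y * z) ^+ 2 by ring.
by rewrite d e; ring.
Qed.

Definition proper (m b : int) := exists i x y z w,
  [/\ x * w - y * z = 1, qf i x y = m & pol i x y z w = b].

Lemma proper_shift m b k : proper m b -> proper m (b + k * m).
Proof.
case=> i [x [y [z [w [d q E]]]]]; exists i, x, y, (z + k * x), (w + k * y); split => //.
  by rewrite -d; ring.
by rewrite -E -q /pol /qf; ring.
Qed.

Lemma proper_swap m c b : m * c = b ^+ 2 + b + 6 -> proper c (- b - 1) -> proper m b.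
Proof.
move=> mc [i [x [y [z [w [d q E]]]]]]; exists i, (- z), (- w), x, y; split.
- by rewrite -d; ring.
- have := qf_pol i d; rewrite q E => h.
  have c0 : c != 0.
    apply/eqP => c0; move: mc; rewrite c0 mulr0 => h0; nia.
  apply: (mulfI c0); rewrite [c * m]mulrC mc.
  have -> : qf i (- z) (- w) = qf i z w by rewrite /qf; ring.
  by rewrite h; ring.
- have -> : pol i (- z) (- w) x y =
      - pol i x y z w + 2 * fbeta i - (2 * fbeta i + 1) * (x * w - y * z) by rewrite /pol; ring.
  by rewrite E d; ring.
Qed.

(** Gauss reduction as a descent on [m]: translate [b] until [|2 b + 1| <= m], then exchange the
    outer coefficients [m] and [c] whenever [c < m]. *)
Lemma proper_all (m : nat) : (0 < m)%N -> forall b : int, (m%:Z %| b ^+ 2 + b + 6)%Z -> proper m%:Z b.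
Proof.
have [n] := ubnP m; elim: n m => // n IH m; rewrite ltnS => mn m0 b0 mb0.
have [b [k [Eb lb ub]]] : exists b k : int, [/\ b0 = b + k * m%:Z, - m%:Z <= 2 * b + 1 & 2 * b + 1 <= m%:Z].
  pose r := (b0 %% m%:Z)%Z; have E := divz_eq b0 m%:Z.
  have r0 : 0 <= r by rewrite modz_ge0 //; lia.
  have rm : r < m%:Z by rewrite ltz_pmod //; lia.
  have [h|h] : 2 * r + 1 <= m%:Z \/ m%:Z < 2 * r + 1 by lia.
    exists r, (b0 %/ m%:Z)%Z; split => //; [by rewrite {1}E addrC | lia].
  exists (r - m%:Z), ((b0 %/ m%:Z)%Z + 1); split; [|lia|lia].
  by rewrite {1}E /r; ring.
have mb : (m%:Z %| b ^+ 2 + b + 6)%Z.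
  have -> : b ^+ 2 + b + 6 = b0 ^+ 2 + b0 + 6 - (k * (2 * b + 1 + k * m%:Z)) * m%:Z by rewrite Eb; ring.
  by apply: rpredB => //; exact: dvdz_mull.
rewrite Eb; apply: proper_shift.
have /dvdzP[c mc] := mb.
have c0 : 0 < c by nia.
have [cm|cm] := ltP c m%:Z.
  have [c' Ec] : exists c' : nat, c = c'%:Z by exists `|c|%N; rewrite gez0_abs // ltW.
  apply: (@proper_swap _ c); first by rewrite mc mulrC.
  rewrite Ec; apply: IH.
  - by move: cm; rewrite Ec; lia.
  - by move: c0; rewrite Ec; lia.
  - rewrite -Ec; apply/dvdzP; exists m%:Z; rewrite mulrC -mc; ring.
(* If [m <= c] then [4 m^2 <= 4 m c = (2 b + 1)^2 + 23 <= m^2 + 23], so [3 m^2 <= 23]. *)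
have m2 : (m <= 2)%N by nia.
have [Em|Em] : m = 1%N \/ m = 2%N by lia.
  have [-> | ->] : b = 0 \/ b = -1 by lia.
    by exists 0, 1, 0, 0, 1; rewrite Em.
  by exists 0, 1, 0, (-1), 1; rewrite Em.
have [-> | ->] : b = 0 \/ b = -1 by lia.
  by exists 1, 1, 0, 0, 1; rewrite Em.
by exists (inord 2), 1, 0, 0, 1; rewrite Em /qf /pol /fA /fbeta /fC inordK.
Qed.

Lemma qf_small i (x y : int) : 4 * fA i * qf i x y = (2 * fA i * x + (2 * fbeta i + 1) * y) ^+ 2 + 23 * y ^+ 2.
Proof. by rewrite /qf /fA /fbeta /fC; case: i => -[|[|[]]] //= _; ring. Qed.

Lemma int_mul1 (x y : int) : x * y = 1 -> x = y /\ (x = 1 \/ x = -1).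
Proof.
move=> xy; have /eqP : (`|x| * `|y|)%N = 1%N by rewrite -abszM xy.
rewrite muln_eq1 => /andP[/eqP a /eqP b].
have [ex|ex] : x = 1 \/ x = -1 by lia.
  by rewrite ex in xy *; split; [lia | left].
by rewrite ex in xy *; split; [lia | right].
Qed.

Lemma form_inj (i j : 'I_3) (e x : int) : e = 1 \/ e = -1 -> fA i = fA j ->
  fA i * e * x + fbeta i = fbeta j -> x = 0 /\ i = j.
Proof.
rewrite /fA /fbeta; case: i => -[|[|[|//]]] //= ?; case: j => -[|[|[|//]]] //= ? [->|->] //= _ h;
  (split; [lia | exact: val_inj]) || lia.
Qed.

(** The matrix with rows [(P, S)] and [(X, T)] is the change of basis between the two; it carries
    one reduced form to the other. From [4 A_i A_j = (...)^2 + 23 S^2] and [4 A_i A_j <= 16] follows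
    [S = 0]; then [P = T] is a sign, the forms agree and [X = 0], so the matrix is plus or minus the
    identity. *)
Lemma proper_uniq i j x y z w x' y' z' w' :
  x * w - y * z = 1 -> x' * w' - y' * z' = 1 ->
  qf i x y = qf j x' y' -> pol i x y z w = pol j x' y' z' w' ->
  i = j /\ ((x = x' /\ y = y') \/ (x = - x' /\ y = - y')).
Proof.
move=> d d' q p.
pose P := x * w' - z * y'; pose S := y * w' - w * y'.
pose X := z * x' - x * z'; pose T := w * x' - y * z'.
have dd : P * T - X * S = 1.
  have -> : P * T - X * S = (x * w - y * z) * (x' * w' - y' * z') by rewrite /P /T /X /S; ring.
  by rewrite d d'.
have h1 := qf_pol i d; have h2 := qf_pol j d'.
have m0 : qf i x y != 0.
  by apply/eqP => h; move: h1; rewrite h mul0r => h1; nia.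
have q2 : qf i z w = qf j z' w'.
  by apply: (mulfI m0); rewrite h1 p q h2.
have QP : qf i P S = fA j.
  have -> : qf i P S = qf i x y * w' ^+ 2 - (2 * (pol i x y z w - fbeta i * (1 - (x * w - y * z))) + (x * w - y * z)) * w' * y'
      + qf i z w * y' ^+ 2 by rewrite /qf /pol /P /S; ring.
  rewrite d q q2 p subrr mulr0 subr0.
  have -> : fA j = fA j * (x' * w' - y' * z') ^+ 2 by rewrite d' expr1n mulr1.
  have -> : 2 * pol j x' y' z' w' + 1 = 2 * (pol j x' y' z' w' - fbeta j * (1 - (x' * w' - y' * z'))) + (x' * w' - y' * z').
    by rewrite d' subrr mulr0 subr0.
  by rewrite /qf /pol; ring.
have PP : pol i P S X T = fbeta j.
  have -> : pol i P S X T =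
     - qf i x y * w' * z' + (pol i x y z w - fbeta i * (1 - (x * w - y * z))) * (w' * x' + y' * z')
     + (x * w - y * z) * y' * z' - qf i z w * y' * x' + fbeta i * (1 - (P * T - X * S)).
    by rewrite /qf /pol /P /S /X /T; ring.
  rewrite dd d q q2 p !subrr !mulr0 subr0 addr0.
  have -> : fbeta j = fbeta j * (x' * w' - y' * z') ^+ 2 by rewrite d' expr1n mulr1.
  have -> : pol j x' y' z' w' = pol j x' y' z' w' - fbeta j * (1 - (x' * w' - y' * z')).
    by rewrite d' subrr mulr0 subr0.
  have -> : 1 * y' * z' = (x' * w' - y' * z') * y' * z' by rewrite d'.
  by rewrite /qf /pol; ring.
have S0 : S = 0.
  have := qf_small i P S; rewrite QP => h.
  have := sqr_ge0 (2 * fA i * P + (2 * fbeta i + 1) * S).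
  have A16 : 4 * fA i * fA j <= 16 by rewrite /fA; case: ifP => _; case: ifP.
  move: h A16; move: (_ * fA j) ((_ + _) ^+ 2) => u v h A16 v0.
  by apply/eqP; rewrite -sqrf_eq0; have := sqr_ge0 S; move: h; move: (S ^+ 2) => s; lia.
have PT : P * T = 1 by move: dd; rewrite S0 mulr0 subr0.
have [P1 T1] := int_mul1 PT.
have A2 : fA i = fA j.
  by rewrite -QP S0 /qf; case: T1 => ->; ring.
have [X0 ij] : X = 0 /\ i = j.
  apply: (@form_inj i j P) => //; move: PP.
  by rewrite /pol S0 !mulr0 !mul0r !addr0.
split => //.
have Ex : x = P * x' + X * y'.
  have -> : P * x' + X * y' = x * (x' * w' - y' * z') by rewrite /P /X; ring.
  by rewrite d' mulr1.
have Ey : y = S * x' + T * y'.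
  have -> : S * x' + T * y' = y * (x' * w' - y' * z') by rewrite /S /T; ring.
  by rewrite d' mulr1.
rewrite Ex Ey X0 S0 -P1; case: T1 => ->; [left | right]; split; ring.
Qed.

Definition rootb (m b : nat) := (m %| b ^ 2 + b + 6)%N.

Lemma rootbE m b : rootb m b = (m%:Z %| b%:Z ^+ 2 + b%:Z + 6)%Z.
Proof.
by rewrite /rootb (_ : b%:Z ^+ 2 + b%:Z + 6 = (b ^ 2 + b + 6)%N%:Z) //;
  rewrite !PoszD -mulnn PoszM expr2.
Qed.

Definition nroots m : nat := \sum_(0 <= b < m) rootb m b.

(** Selects one vector in each pair of opposite nonzero vectors, which give the same root. *)
Definition half (x y : int) := (0 < y) || ((y == 0) && (0 < x)).

Definition reps_half n : seq ('I_3 * (int * int)) :=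
  [seq u <- [seq (i, v) | i <- enum 'I_3, v <- [seq (x, y) | x <- zr n, y <- zr n]]
     | half u.2.1 u.2.2 && (qf u.1 u.2.1 u.2.2 == n%:Z)].

Definition pairs n : seq (nat * nat) :=
  [seq u <- [seq (g, b) | g <- iota 1 n, b <- iota 0 n]
     | [&& u.1 ^ 2 %| n, u.2 < n %/ u.1 ^ 2 & rootb (n %/ u.1 ^ 2) u.2]%N].

Lemma qf_bound i x y (n : nat) : qf i x y = n%:Z -> (`|x| <= n)%N && (`|y| <= n)%N.
Proof.
move=> h; have hA := qf_small i x y.
have hC : 4 * fC i * qf i x y = (2 * fC i * y + (2 * fbeta i + 1) * x) ^+ 2 + 23 * x ^+ 2.
  by rewrite /qf /fA /fbeta /fC; case: i {h hA} => -[|[|[]]] //= _; ring.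
have [a' [Ea a4]] : exists a' : nat, 4 * fA i = a'%:Z /\ (a' <= 24)%N.
  by rewrite /fA; case: ifP; [exists 4%N | exists 8%N].
have [c' [Ec c4]] : exists c' : nat, 4 * fC i = c'%:Z /\ (c' <= 24)%N.
  by rewrite /fC; case: ifP; [exists 24%N | exists 12%N].
by move: hA hC; rewrite h Ea Ec => /sq_bound -> // /sq_bound ->.
Qed.

Lemma mem_reps n u : (u \in reps_half n) =
  half u.2.1 u.2.2 && (qf u.1 u.2.1 u.2.2 == n%:Z).
Proof.
rewrite mem_filter andb_idr // => /andP[_ /eqP h].
apply/allpairsP; exists u; split; rewrite ?mem_enum //; last by case: u {h}.
by rewrite mem_box !mem_zr; exact: qf_bound h.
Qed.

Lemma mem_pairs n g b : (0 < n)%N -> ((g, b) \in pairs n) =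
  [&& 0 < g, g ^ 2 %| n, b < n %/ g ^ 2 & rootb (n %/ g ^ 2) b]%N.
Proof.
move=> n0; rewrite mem_filter /=; apply/andP/and4P.
  case=> /and3P[d bn rb] /allpairsP[u [un _ E]].
  have /= Eg := congr1 fst E.
  by move: un; rewrite -Eg mem_iota => /andP[g0 _]; split.
case=> g0 d bn rb; split; first by apply/and3P.
have gn : (g <= n)%N by have := dvdn_leq n0 d; nia.
apply/allpairsP; exists (g, b); split; rewrite ?mem_iota //=; first by lia.
by apply: leq_trans bn _; exact: leq_div.
Qed.

(** To [(X, Y)] correspond the gcd [g] of its coordinates and the root modulo [n / g^2] attached to
    the primitive vector [(X, Y) / g]; existence comes from [proper_all], uniqueness up to sign from
    [proper_uniq]. *)
Lemma reps_roots n : (0 < n)%N -> size (reps_half n) = size (pairs n).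
Proof.
move=> n0.
pose r (u : 'I_3 * (int * int)) (v : nat * nat) := exists x y z w,
  [/\ u.2.1 = v.1%:Z * x, u.2.2 = v.1%:Z * y, x * w - y * z = 1 & pol u.1 x y z w = v.2%:Z].
have nE i g x y : qf i (g * x) (g * y) = g ^+ 2 * qf i x y by rewrite /qf; ring.
have rm i (x y : int) g : (0 < g)%N -> qf i (g%:Z * x) (g%:Z * y) = n%:Z ->
    (g ^ 2 %| n)%N /\ qf i x y = (n %/ g ^ 2)%N%:Z.
  move=> g0; rewrite nE => E.
  have q0 : 0 <= qf i x y by nia.
  have E' : n = (g ^ 2 * `|qf i x y|)%N by apply/eqP; rewrite -eqz_nat -E PoszM gez0_abs // -exprz_pintl //; lia.
  split; first by rewrite E' dvdn_mulr.
  by rewrite E' mulKn ?expn_gt0 ?g0 // gez0_abs.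
apply: (@size_rel _ _ _ _ r).
- apply: filter_uniq; apply: allpairs_uniq; rewrite ?enum_uniq ?box_uniq //.
  by move=> [? ?] [? ?].
- apply: filter_uniq; apply: allpairs_uniq; rewrite ?iota_uniq // => -[? ?] [? ?] //.
- move=> [i [X Y]]; rewrite mem_reps /= => /andP[hf /eqP q].
  have g0 : (0 < gcdn `|X| `|Y|)%N.
    rewrite gcdn_gt0 !absz_gt0; move: hf; rewrite /half.
    by case/orP => [Y0|/andP[_ X0]]; apply/orP; [right | left]; rewrite gt_eqF.
  pose g := gcdn `|X| `|Y|.
  have [x Ex] : exists x, X = g%:Z * x by have /dvdzP[x ->] : (g%:Z %| X)%Z by [rewrite dvdzE dvdn_gcdl]; exists x; rewrite mulrC.
  have [y Ey] : exists y, Y = g%:Z * y by have /dvdzP[y ->] : (g%:Z %| Y)%Z by [rewrite dvdzE dvdn_gcdr]; exists y; rewrite mulrC.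
  have [u [v uv]] : exists u v, u * x + v * y = 1.
    have [u [v uv]] := Bezoutz X Y; exists u, v.
    have gz : g%:Z != 0 by rewrite eqz_nat -lt0n.
    apply: (mulfI gz); rewrite mulr1 -[RHS]/(gcdz X Y) -uv Ex Ey; ring.
  have [dn qm] : (g ^ 2 %| n)%N /\ qf i x y = (n %/ g ^ 2)%N%:Z by apply: rm; rewrite -?Ex -?Ey.
  pose m := (n %/ g ^ 2)%N.
  have m0 : (0 < m)%N by rewrite divn_gt0 ?expn_gt0 ?g0 // dvdn_leq.
  (* Bezout completes [(x, y)] to a basis; subtracting [k] times the first vector from the second
     changes the root by [- k m], which brings it between 0 and [m - 1]. *)
  pose b0 := pol i x y (- v) u.
  pose k := (b0 %/ m%:Z)%Z.
  have Eb := divz_eq b0 m%:Z.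
  have r0 : 0 <= (b0 %% m%:Z)%Z by rewrite modz_ge0 //; lia.
  have rm' : (b0 %% m%:Z)%Z < m%:Z by rewrite ltz_pmod //; lia.
  have d : x * (u - k * y) - y * (- v - k * x) = 1 by rewrite -uv; ring.
  have pE : pol i x y (- v - k * x) (u - k * y) = (b0 %% m%:Z)%Z.
    have -> : pol i x y (- v - k * x) (u - k * y) = b0 - k * qf i x y by rewrite /b0 /pol /qf; ring.
    by rewrite qm {1}Eb -/k -/m; ring.
  exists (g, `|(b0 %% m%:Z)%Z|%N).
    rewrite mem_pairs // g0 dn /= -/m; apply/andP; split; first by lia.
    by rewrite rootbE gez0_abs // -pE -(qf_pol i d) qm dvdz_mulr.
  by exists x, y, (- v - k * x), (u - k * y); split => //=; rewrite pE gez0_abs.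
- move=> [g b]; rewrite mem_pairs // => /and4P[g0 d bm rb].
  pose m := (n %/ g ^ 2)%N.
  have m0 : (0 < m)%N by apply: leq_ltn_trans bm.
  have nm : n%:Z = g%:Z ^+ 2 * m%:Z by rewrite -{1}(divnK d) -/m PoszM mulrC; congr (_ * _); rewrite -mulnn PoszM expr2.
  have [i [x [y [z [w [dt q p]]]]]] : proper m%:Z b%:Z.
    by apply: proper_all => //; rewrite -rootbE.
  have xy0 : ~~ ((x == 0) && (y == 0)).
    by apply/negP => /andP[/eqP x0 /eqP y0]; move: dt; rewrite x0 y0; lia.
  have gz : 0 < g%:Z by lia.
  have [h|h] : half (g%:Z * x) (g%:Z * y) \/ half (g%:Z * - x) (g%:Z * - y).
    by move: xy0; rewrite /half !pmulr_rgt0 // !mulf_eq0 (gt_eqF gz) /=; lia.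
    exists (i, (g%:Z * x, g%:Z * y)); first by rewrite mem_reps /= h nE q nm eqxx.
    by exists x, y, z, w.
  exists (i, (g%:Z * - x, g%:Z * - y)).
    have qN : qf i (- x) (- y) = qf i x y by rewrite /qf; ring.
    by rewrite mem_reps /= h nE qN q nm eqxx.
  exists (- x), (- y), (- z), (- w); split => //=; first by rewrite -dt; ring.
  by rewrite -p /pol; ring.
- move=> [i [X Y]] [g b] [g' b']; rewrite mem_reps /= => /andP[hf /eqP q].
  rewrite !mem_pairs // => /and4P[g0 d bm rb] /and4P[g0' d' bm' rb'].
  move=> [x [y [z [w /= [Ex Ey dt p]]]]] [x' [y' [z' [w' /= [Ex' Ey' dt' p']]]]].
  have gcdE (h : nat) (s t s' t' : int) : s * t' - t * s' = 1 ->
      gcdn `|(h%:Z * s)%R| `|(h%:Z * t)%R| = h.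
    move=> st; rewrite !abszM !absz_nat -muln_gcdr (_ : gcdn `|s| `|t| = 1%N) ?muln1 //.
    apply/eqP; rewrite -dvdn1; suff : ((gcdn `|s| `|t|)%:Z %| (s * t' - t * s')%R)%Z by rewrite st dvdzE.
    by apply: rpredB; [apply: dvdz_mulr | apply: dvdz_mulr]; rewrite dvdzE absz_nat ?dvdn_gcdl ?dvdn_gcdr.
  have gg : g = g' by rewrite -(gcdE g x y z w) // -Ex -Ey Ex' Ey' (gcdE g' x' y' z' w').
  subst g'.
  have gz : g%:Z != 0 by rewrite eqz_nat -lt0n.
  have xx : x = x' by apply: (mulfI gz); rewrite -Ex -Ex'.
  have yy : y = y' by apply: (mulfI gz); rewrite -Ey -Ey'.
  subst x' y'; congr (_, _).
  have [_ qm] : (g ^ 2 %| n)%N /\ qf i x y = (n %/ g ^ 2)%N%:Z by apply: rm; rewrite -?Ex -?Ey.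
  pose k := z * w' - w * z'.
  have Ez : z - z' = k * x.
    have -> : k * x = z * (x * w' - y * z') - z' * (x * w - y * z) by rewrite /k; ring.
    by rewrite dt dt'; ring.
  have Ew : w - w' = k * y.
    have -> : k * y = w * (x * w' - y * z') - w' * (x * w - y * z) by rewrite /k; ring.
    by rewrite dt dt'; ring.
  have bb : b%:Z - b'%:Z = k * (n %/ g ^ 2)%N%:Z.
    rewrite -p -p' -qm.
    have -> : pol i x y z w - pol i x y z' w' = fA i * x * (z - z') + (2 * fbeta i + 1) * y * (z - z') + fC i * y * (w - w') by rewrite /pol; ring.
    by rewrite Ez Ew /qf; ring.
  by have k0 : k = 0 by [nia]; rewrite k0 in bb; lia.
move=> [i [X Y]] [j [X' Y']] [g b]; rewrite !mem_reps /= => /andP[hf /eqP q] /andP[hf' /eqP q'].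
rewrite mem_pairs // => /and4P[g0 d bm rb].
move=> [x [y [z [w /= [Ex Ey dt p]]]]] [x' [y' [z' [w' /= [Ex' Ey' dt' p']]]]].
have [_ qm] : (g ^ 2 %| n)%N /\ qf i x y = (n %/ g ^ 2)%N%:Z by apply: rm; rewrite -?Ex -?Ey.
have [_ qm'] : (g ^ 2 %| n)%N /\ qf j x' y' = (n %/ g ^ 2)%N%:Z by apply: rm; rewrite -?Ex' -?Ey'.
have [-> hxy] := proper_uniq dt dt' (etrans qm (esym qm')) (etrans p (esym p')).
have gz : 0 < g%:Z by lia.
case: hxy => -[ex ey]; first by rewrite Ex Ey Ex' Ey' ex ey.
exfalso; move: hf hf'; rewrite Ex Ey Ex' Ey' ex ey /half !mulrN oppr_gt0 oppr_eq0.
by rewrite oppr_gt0; move: (g%:Z * x') (g%:Z * y') => u v; lia.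
Qed.

(** * Roots of b^2 + b + 6 *)

Lemma chiM m n : chi (m * n) = chi m * chi n.
Proof.
have cE k : chi k = chi (k %% 23) by rewrite /chi /dvdn modn_mod.
rewrite (cE (m * n)%N) -modnMm -cE (cE m) (cE n).
have : (m %% 23 < 23)%N by rewrite ltn_mod.
have : (n %% 23 < 23)%N by rewrite ltn_mod.
move: (m %% 23)%N (n %% 23)%N => a b b23 a23.
have h : all (fun a => all (fun b => chi (a * b) == chi a * chi b) (iota 0 23)) (iota 0 23).
  by vm_compute.
have /allP/(_ a) := h; rewrite mem_iota => /(_ a23) /allP/(_ b).
by rewrite mem_iota => /(_ b23) /eqP.
Qed.

Lemma chiX m k : chi (m ^ k) = chi m ^+ k.
Proof. by elim: k => [|k IH]; rewrite ?expn0 // expnS exprS chiM IH. Qed.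

Lemma chi_mod m : chi (m %% 23) = chi m.
Proof. by rewrite /chi /dvdn modn_mod. Qed.

Section GaussSum.
Variables (p : nat) (K : fieldType) (z : K).
Hypotheses (pr : prime p) (p23 : p != 23%N) (ch : p \in [pchar K]).
Hypotheses (z23 : z ^+ 23 = 1) (z1 : z != 1).

Definition gsum : K := \sum_(1 <= a < 23) (chi a)%:~R * z ^+ a.

Lemma gsum_sqr : gsum ^+ 2 = - 23%:R.
Proof.
have gE : gsum = z + z ^+ 2 + z ^+ 3 + z ^+ 4 - z ^+ 5 + z ^+ 6 - z ^+ 7 + z ^+ 8 + z ^+ 9 - z ^+ 10 - z ^+ 11 + z ^+ 12 + z ^+ 13 - z ^+ 14 - z ^+ 15 + z ^+ 16 - z ^+ 17 + z ^+ 18 - z ^+ 19 - z ^+ 20 - z ^+ 21 - z ^+ 22.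
  have c1 : chi 1 = 1 by [].
  have c2 : chi 2 = 1 by [].
  have c3 : chi 3 = 1 by [].
  have c4 : chi 4 = 1 by [].
  have c5 : chi 5 = -1 by [].
  have c6 : chi 6 = 1 by [].
  have c7 : chi 7 = -1 by [].
  have c8 : chi 8 = 1 by [].
  have c9 : chi 9 = 1 by [].
  have c10 : chi 10 = -1 by [].
  have c11 : chi 11 = -1 by [].
  have c12 : chi 12 = 1 by [].
  have c13 : chi 13 = 1 by [].
  have c14 : chi 14 = -1 by [].
  have c15 : chi 15 = -1 by [].
  have c16 : chi 16 = 1 by [].
  have c17 : chi 17 = -1 by [].
  have c18 : chi 18 = 1 by [].
  have c19 : chi 19 = -1 by [].
  have c20 : chi 20 = -1 by [].
  have c21 : chi 21 = -1 by [].
  have c22 : chi 22 = -1 by [].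
  rewrite /gsum /index_iota /= !big_cons big_nil c1 c2 c3 c4 c5 c6 c7 c8 c9 c10 c11 c12 c13 c14 c15 c16 c17 c18 c19 c20 c21 c22.
  by ring.
have Phi : 1 + z + z ^+ 2 + z ^+ 3 + z ^+ 4 + z ^+ 5 + z ^+ 6 + z ^+ 7 + z ^+ 8 + z ^+ 9 + z ^+ 10 + z ^+ 11 + z ^+ 12 + z ^+ 13 + z ^+ 14 + z ^+ 15 + z ^+ 16 + z ^+ 17 + z ^+ 18 + z ^+ 19 + z ^+ 20 + z ^+ 21 + z ^+ 22 = 0.
  apply/eqP; have /eqP := subrr (1 : K); rewrite -{1}z23.
  have -> : z ^+ 23 - 1 = (z - 1) * (1 + z + z ^+ 2 + z ^+ 3 + z ^+ 4 + z ^+ 5 + z ^+ 6 + z ^+ 7 + z ^+ 8 + z ^+ 9 + z ^+ 10 + z ^+ 11 + z ^+ 12 + z ^+ 13 + z ^+ 14 + z ^+ 15 + z ^+ 16 + z ^+ 17 + z ^+ 18 + z ^+ 19 + z ^+ 20 + z ^+ 21 + z ^+ 22) by ring.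
  by rewrite mulf_eq0 subr_eq0 (negPf z1).
apply/eqP; rewrite -subr_eq0 opprK; apply/eqP.
(* The second factor is the exact quotient of the polynomial [gsum^2 + 23] by the 23rd cyclotomic
   polynomial. *)
transitivity ((1 + z + z ^+ 2 + z ^+ 3 + z ^+ 4 + z ^+ 5 + z ^+ 6 + z ^+ 7 + z ^+ 8 + z ^+ 9 + z ^+ 10 + z ^+ 11 + z ^+ 12 + z ^+ 13 + z ^+ 14 + z ^+ 15 + z ^+ 16 + z ^+ 17 + z ^+ 18 + z ^+ 19 + z ^+ 20 + z ^+ 21 + z ^+ 22) * (23 - 23 * z + z ^+ 2 + z ^+ 3 + z ^+ 4 + z ^+ 5 - 3 * z ^+ 6 + z ^+ 7 - 3 * z ^+ 8 + z ^+ 9 + 5 * z ^+ 10 - 7 * z ^+ 11 + 5 * z ^+ 12 - 7 * z ^+ 13 + 5 * z ^+ 14 + z ^+ 15 - 3 * z ^+ 16 + z ^+ 17 - 3 * z ^+ 18 + z ^+ 19 + z ^+ 20 + z ^+ 21 + z ^+ 22)).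
  by rewrite gE; ring.
by rewrite Phi mul0r.
Qed.

Lemma coprime_p23 : coprime p 23.
Proof. by rewrite prime_coprime // dvdn_prime2 // eq_sym. Qed.

Lemma p22 : (p ^ 22 = 1 %[mod 23])%N.
Proof. by have := Euler_exp_totient coprime_p23; rewrite totient_prime. Qed.

Lemma zmod a : z ^+ (a %% 23) = z ^+ a.
Proof. by rewrite {2}(divn_eq a 23) exprD mulnC exprM z23 expr1n mul1r. Qed.

(** The Frobenius replaces [z^a] by [z^(a p)]; reindexing by [a |-> a p] modulo 23, with inverse
    [b |-> b p^21], extracts [chi p]. *)
Lemma gsum_frob : (chi p)%:~R * gsum ^+ p = gsum.
Proof.
have -> : gsum ^+ p = \sum_(1 <= a < 23) (chi a)%:~R * z ^+ (a * p).
  rewrite /gsum -(pFrobenius_autE ch) rmorph_sum /=; apply: eq_bigr => a _.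
  by rewrite rmorphM /= rmorph_int rmorphXn /= pFrobenius_autE -exprM mulnC.
rewrite mulr_sumr /gsum.
have inv a : (a < 23)%N -> ((((a * p) %% 23) * p ^ 21) %% 23 = a)%N.
  move=> a23; rewrite modnMml -mulnA -expnS -modnMmr p22 modnMmr muln1 modn_small //.
have inv' a : (a < 23)%N -> ((((a * p ^ 21) %% 23) * p) %% 23 = a)%N.
  move=> a23; rewrite modnMml -mulnA -expnSr -modnMmr p22 modnMmr muln1 modn_small //.
apply: (@sum_bij _ _ _ _ _ (fun a => (a * p) %% 23)%N (fun b => (b * p ^ 21) %% 23)%N); rewrite ?iota_uniq //.
  move=> a; rewrite !mem_index_iota => /andP[a0 a23] _.
  rewrite inv // ltn_mod /= andbT zmod chi_mod chiM; split => //.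
    rewrite lt0n; apply: contraTneq a0 => h; have := inv a a23.
    by rewrite h mul0n mod0n => <-.
  by rewrite intrM -mulrA mulrCA.
move=> b; rewrite !mem_index_iota => /andP[b0 b23] _.
rewrite inv' // ltn_mod /= andbT; split => //.
  rewrite lt0n; apply: contraTneq b0 => h; have := inv' b b23.
  by rewrite h mul0n mod0n => <-.
by rewrite -zmod inv' // mulrA -rmorphM /= -chiM mulnC -chi_mod inv'.
Qed.

(** The polynomial [X^p - X] already has the [p] elements of the prime field as roots. *)
Lemma fixed_frob (x : K) : x ^+ p = x -> exists n : nat, x = n%:R.
Proof.
move=> xp; apply: contrapT => nx.
have p1 := prime_gt1 pr.
pose P : {poly K} := 'X^p - 'X.
have szP : size P = p.+1.
  by rewrite size_polyDl size_polyXn // size_polyN size_polyX ltnS.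
have Pn0 : P != 0 by rewrite -size_poly_eq0 szP.
pose rs := x :: [seq (i%:R : K) | i <- iota 0 p].
have := @max_poly_roots _ P rs Pn0; rewrite szP /= size_map size_iota ltnn => h.
suff : false by []; apply: h.
  rewrite /root !hornerE xp subrr eqxx /=; apply/allP => y /mapP[i _ ->].
  by rewrite /root !hornerE -(pFrobenius_autE ch) rmorph_nat subrr.
apply/andP; split; first by apply/mapP => -[i _ E]; apply: nx; exists i.
rewrite map_inj_in_uniq ?iota_uniq // => i j; rewrite !mem_iota /= => ip jp /eqP.
wlog ij : i j ip jp / (i <= j)%N => [hw|].
  by case/orP: (leq_total i j) => ij E; [exact: hw | symmetry; apply: hw => //; rewrite eq_sym].
rewrite eq_sym -subr_eq0 -natrB // -(dvdn_pcharf ch) => /dvdn_leq; lia.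
Qed.

Lemma natr_eq0 n : (n%:R == 0 :> K) = (p %| n)%N.
Proof. by rewrite (dvdn_pcharf ch). Qed.

(** For odd [p], a root exists if and only if -23 is a square in the prime field, that is, if its
    square root [gsum] is fixed by the Frobenius; by [gsum_frob] this means [chi p = 1]. The prime 2
    is apart because completing the square divides by 4; there both sides hold. *)
Lemma root_iff_chi : (exists b, rootb p b) <-> chi p = 1.
Proof.
have c23 : ~~ (p %| 23)%N by rewrite dvdn_prime2.
have n23 : (23%:R : K) != 0 by rewrite natr_eq0.
have g0 : gsum != 0.
  by apply/eqP => g0; have := gsum_sqr; rewrite g0 expr0n /= => /eqP; rewrite eq_sym oppr_eq0 (negPf n23).
have rE b : rootb p b = ((b%:R * 2 + 1) ^+ 2 == - 23%:R :> K) || (p == 2%N).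
  rewrite /rootb; have [->|p2] := eqVneq p 2%N.
    by rewrite orbT dvdn2 !oddD oddX /= addbF addbb.
  rewrite orbF -natr_eq0 !natrD natrX.
  have n4 : (4%:R : K) != 0.
    rewrite natr_eq0 (_ : 4 = 2 ^ 2)%N // Euclid_dvdX // andbT.
    by rewrite dvdn_prime2.
  rewrite -(inj_eq (mulfI n4)) mulr0 -[RHS]subr_eq0 opprK; congr (_ == _); ring.
have [p2|p2] := eqVneq p 2%N.
  by split => [_|_]; [rewrite p2 | exists 0%N; rewrite p2].
split.
  case=> b; rewrite rE (negPf p2) orbF => /eqP E.
  have gb : gsum = b%:R * 2 + 1 \/ gsum = - (b%:R * 2 + 1).
    have : gsum ^+ 2 == (b%:R * 2 + 1) ^+ 2 by rewrite gsum_sqr E.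
    by rewrite eqf_sqr => /orP[/eqP|/eqP]; [left | right].
  have gp : gsum ^+ p = gsum.
    rewrite -(pFrobenius_autE ch).
    have e : pFrobenius_aut ch (b%:R * 2 + 1) = b%:R * 2 + 1.
      by rewrite rmorphD rmorphM /= !rmorph_nat rmorph1.
    by case: gb => ->; rewrite ?rmorphN /= e.
  have := gsum_frob; rewrite gp -[X in _ = X]mul1r => /(mulIf g0) /eqP.
  rewrite /chi; case: ifP => d.
    by move: d p23; rewrite dvdn_prime2 // => /eqP <-.
  case: ifP => // _; rewrite rmorphN rmorph1 -subr_eq0 -opprD oppr_eq0 -[1 + 1]/(2%:R) natr_eq0.
  by rewrite dvdn_prime2 // (negPf p2).
move=> cp; have := gsum_frob; rewrite cp rmorph1 mul1r => /fixed_frob[n gn].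
have o2 : odd p by case: (even_prime pr) p2 => [->|].
(* This is [(n - 1) / 2] modulo [p]: the factor [(p + 1) / 2] inverts 2, and the added [p] keeps the
   subtraction from being truncated. *)
exists ((n + p - 1) * (p.+1)./2)%N; rewrite rE; apply/orP; left.
rewrite -gsum_sqr gn; apply/eqP; congr (_ ^+ 2).
have n0 : (0 < n + p - 1)%N by have := prime_gt1 pr; lia.
have h2 : (p.+1./2)%:R * 2 = p.+1%:R :> K.
  by rewrite -natrM muln2; congr _%:R; lia.
rewrite natrM -mulrA h2.
rewrite natrB ?natrD; last by have := prime_gt1 pr; lia.
have -> : p.+1%:R = 1 :> K by rewrite -natr1 (pcharf0 ch) add0r.
by rewrite (pcharf0 ch); ring.
Qed.

End GaussSum.

(** The field with [p^22] elements contains a primitive 23rd root of unity, since 23 divides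
    [p^22 - 1]. *)
Lemma root_chi p : prime p -> p != 23%N -> (exists b, rootb p b) <-> chi p = 1.
Proof.
move=> pr p23.
have [K chK cK] := PrimePowerField pr (isT : (0 < 22)%N).
have d23 : (23 %| #|[set: {unit K}]|)%N.
  rewrite card_finField_unit cK -subn1 -eqn_mod_dvd ?expn_gt0 ?prime_gt0 //.
  by rewrite p22.
have [x _ ox] := Cauchy (isT : prime 23) d23.
apply: (@root_iff_chi p K (val x) pr p23 chK).
  by rewrite -FinRing.val_unitX -ox expg_order FinRing.val_unit1.
apply/eqP => x1; have : x = 1%g by apply: val_inj; rewrite x1 FinRing.val_unit1.
by move=> E; move: ox; rewrite E order1.
Qed.

Lemma rootb_mod m x : rootb m (x %% m) = rootb m x.
Proof.
rewrite /rootb /dvdn -!mulnn; congr (_ == _)%N.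
apply/eqP; rewrite eqn_modDr; apply/eqP.
by rewrite -modnDm modnMm modn_mod modnDm.
Qed.

Lemma nrootsM a b : (0 < a)%N -> (0 < b)%N -> coprime a b -> nroots (a * b) = (nroots a * nroots b)%N.
Proof.
move=> a0 b0 cab.
rewrite /nroots /index_iota !subn0 big_distrl /=.
transitivity (\sum_(u <- [seq (x, y) | x <- iota 0 a, y <- iota 0 b]) (rootb a u.1 * rootb b u.2)%N); last first.
  by rewrite big_allpairs; apply: eq_bigr => x _; rewrite big_distrr.
apply: (@sum_bij _ _ _ _ _ (fun x => (x %% a, x %% b)%N) (fun u => (chinese a b u.1 u.2 %% (a * b))%N)).
- exact: iota_uniq.
- by apply: allpairs_uniq; rewrite ?iota_uniq // => -[? ?] [? ?].
- move=> x; rewrite mem_iota /= => xab _.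
  split.
  + by apply/allpairsP; exists (x %% a, x %% b)%N; rewrite !mem_iota /= !ltn_mod.
  + by rewrite -(chinese_mod cab x) modn_small.
  + by rewrite !rootb_mod mulnb /rootb Gauss_dvd.
move=> [x y] /allpairsP[[x' y'] /= [+ + [-> ->]]]; rewrite !mem_iota /= => xa yb _.
have ea : (chinese a b x' y' %% (a * b) %% a = x')%N.
  by rewrite modn_dvdm ?dvdn_mulr // chinese_modl // modn_small.
have eb : (chinese a b x' y' %% (a * b) %% b = y')%N.
  by rewrite modn_dvdm ?dvdn_mull // chinese_modr // modn_small.
rewrite ea eb ltn_mod muln_gt0 a0 b0; split => //.
by rewrite /rootb Gauss_dvd // -!/(rootb _ _) -(rootb_mod a) ea -(rootb_mod b) eb mulnb.
Qed.

Section RootCount.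
Variables (p : nat).
Hypothesis pr : prime p.

Lemma root_dvd k b : rootb (p ^ k.+1) b -> rootb p b.
Proof. by rewrite /rootb; apply: dvdn_trans; rewrite expnS dvdn_mulr. Qed.

Lemma nroots0 m : (forall b, ~~ rootb m b) -> nroots m = 0%N.
Proof. by move=> h; rewrite /nroots big1 // => b _; rewrite (negPf (h b)). Qed.

Section Split.
Hypothesis chip : chi p = 1.

Lemma chi1_neq23 : p != 23%N.
Proof. by apply/eqP => p23; move: chip; rewrite p23. Qed.

Lemma root_simple b : (p%:Z %| b ^+ 2 + b + 6)%Z -> ~~ (p%:Z %| 2 * b + 1)%Z.
Proof.
move=> rb; apply/negP => d.
have : (p%:Z %| 23%:Z)%Z.
  have -> : 23%:Z = 4 * (b ^+ 2 + b + 6) - (2 * b + 1) * (2 * b + 1) by ring.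
  by apply: rpredB; apply: dvdz_mull.
by rewrite dvdzE /= dvdn_prime2 // (negPf chi1_neq23).
Qed.

Lemma hensel k : exists b : int, ((p ^ k.+1)%N%:Z %| b ^+ 2 + b + 6)%Z.
Proof.
elim: k => [|k [b /dvdzP[c E]]].
  have [b rb] := (root_chi pr chi1_neq23).2 chip.
  by exists b%:Z; rewrite expn1 -rootbE.
have pb : (p%:Z %| b ^+ 2 + b + 6)%Z.
  by rewrite E; apply: dvdz_mull; rewrite dvdzE /= expnS dvdn_mulr.
have co : coprimez (2 * b + 1) p%:Z.
  by rewrite coprimezE coprime_sym prime_coprime // -(dvdzE p%:Z) root_simple.
have [u [v]] := Bezoutz (2 * b + 1) p%:Z.
rewrite (eqP (co : gcdz _ _ == 1)) => uv.
(* Newton's step: [u] inverts the derivative [2 b + 1] modulo [p]. *)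
exists (b - c * u * (p ^ k.+1)%N%:Z).
have -> : (b - c * u * (p ^ k.+1)%N%:Z) ^+ 2 + (b - c * u * (p ^ k.+1)%N%:Z) + 6 =
   (b ^+ 2 + b + 6) - c * (p ^ k.+1)%N%:Z * (u * (2 * b + 1)) + (c * u) ^+ 2 * ((p ^ k.+1)%N%:Z * (p ^ k.+1)%N%:Z) by ring.
have -> : b ^+ 2 + b + 6 - c * (p ^ k.+1)%N%:Z * (u * (2 * b + 1)) = c * v * ((p ^ k.+1)%N%:Z * p%:Z).
  by rewrite E (_ : u * (2 * b + 1) = 1 - v * p%:Z); [ring | by apply/eqP; rewrite eq_sym subr_eq uv].
apply: rpredD; apply: dvdz_mull; rewrite -PoszM dvdzE /= ?absz_nat; first by rewrite -expnSr.
by rewrite [X in (X %| _)%N]expnS mulnC dvdn_mul // expnS dvdn_mulr.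
Qed.

(** Modulo [q = p^(k+1)] the polynomial is [(x - b)(x + b + 1)]. The two factors cannot both be
    divisible by [p], as [p] would divide [2 b + 1]; so [q] divides one of them and the roots are
    [b] and [q - 1 - b]. *)
Lemma nroots_split k : nroots (p ^ k.+1) = 2%N.
Proof.
set q := (p ^ k.+1)%N; have q0 : (0 < q)%N by rewrite expn_gt0 prime_gt0.
have pq : (p%:Z %| q%:Z)%Z by rewrite dvdzE /= /q expnS dvdn_mulr.
have cop y z : ~~ (p%:Z %| y)%Z -> (q%:Z %| y * z)%Z -> (q%:Z %| z)%Z.
  move=> py; rewrite Gauss_dvdzr // coprimezE /q coprimeXl // prime_coprime //.
have [b0 rb0] := hensel k; rewrite -/q in rb0; clearbody q.
have r0 : 0 <= (b0 %% q%:Z)%Z by rewrite modz_ge0 //; lia.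
have rq : (b0 %% q%:Z)%Z < q%:Z by rewrite ltz_pmod //; lia.
have [b [Eb bq]] : exists b : nat, (b0 %% q%:Z)%Z = b%:Z /\ (b < q)%N.
  by exists `|(b0 %% q%:Z)%Z|%N; rewrite gez0_abs //; split => //; lia.
have rb : (q%:Z %| b%:Z ^+ 2 + b%:Z + 6)%Z.
  have -> : b%:Z ^+ 2 + b%:Z + 6 = b0 ^+ 2 + b0 + 6 - ((b0 %/ q%:Z)%Z * (b0 + b%:Z + 1)) * q%:Z.
    by move: (divz_eq b0 q%:Z); rewrite Eb; move: (b0 %/ q%:Z)%Z => h ->; ring.
  by apply: rpredB => //; exact: dvdz_mull.
have nd := root_simple (dvdz_trans pq rb).
have bb : b != (q - 1 - b)%N.
  apply: contra nd => /eqP E; have -> : 2 * b%:Z + 1 = q%:Z by clear -E bq; lia.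
  by [].
have other x : (x < q)%N -> rootb q x = (x == b) || (x == (q - 1 - b)%N).
  move=> xq; rewrite rootbE.
  have -> : (q%:Z %| x%:Z ^+ 2 + x%:Z + 6)%Z = (q%:Z %| (x%:Z - b%:Z) * (x%:Z + b%:Z + 1))%Z.
    have -> : x%:Z ^+ 2 + x%:Z + 6 = (x%:Z - b%:Z) * (x%:Z + b%:Z + 1) + (b%:Z ^+ 2 + b%:Z + 6) by ring.
    by rewrite rpredDr.
  apply/idP/idP => [d|/orP[/eqP->|/eqP E]]; last first.
  - have E' : x%:Z + b%:Z + 1 = q%:Z by clear -E bq; lia.
    by rewrite E' dvdz_mull.
  - by rewrite subrr mul0r.
  have [h|h] := boolP (p%:Z %| x%:Z - b%:Z)%Z.
    have h' : ~~ (p%:Z %| x%:Z + b%:Z + 1)%Z.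
      apply: contra nd => h'; have -> : 2 * b%:Z + 1 = (x%:Z + b%:Z + 1) - (x%:Z - b%:Z) by ring.
      exact: rpredB.
    have /dvdzP[c Ec] : (q%:Z %| x%:Z - b%:Z)%Z by apply: (cop _ _ h'); rewrite mulrC.
    have c0 : c = 0 by clear -Ec xq bq q0; nia.
    by apply/orP; left; rewrite c0 mul0r in Ec; clear -Ec; lia.
  have /dvdzP[c Ec] := cop _ _ h d.
  have c1 : c = 1 by clear -Ec xq bq q0; nia.
  by apply/orP; right; rewrite c1 mul1r in Ec; clear -Ec xq bq; lia.
rewrite /nroots /index_iota subn0.
have -> : (\sum_(x <- iota 0 q) rootb q x = size [seq x <- iota 0 q | rootb q x])%N.
  by rewrite size_filter -sum1_count [in RHS]big_mkcond; apply: eq_bigr => x _; case: rootb.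
rewrite (perm_size (_ : perm_eq _ [:: b; (q - 1 - b)%N])) //.
apply: uniq_perm; rewrite ?filter_uniq ?iota_uniq //=; first by rewrite inE bb.
move=> x; rewrite mem_filter mem_iota /= !inE.
rewrite add0n; have [xq|xq] := ltnP x q; first by rewrite other // andbT.
by rewrite andbF; clear -xq bq; lia.
Qed.

End Split.

Lemma nroots23_1 : nroots 23 = 1%N.
Proof. by rewrite /nroots /index_iota /= !big_cons big_nil. Qed.

(** In [23 = 4 (b^2 + b + 6) - (2 b + 1)^2] a root modulo 529 would make the right-hand side
    divisible by 529. *)
Lemma nroots23 k : nroots (23 ^ k.+2) = 0%N.
Proof.
apply: nroots0 => b; apply/negP; rewrite rootbE => d.
have d2 : (529%:Z %| b%:Z ^+ 2 + b%:Z + 6)%Z.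
  by apply: dvdz_trans d; rewrite dvdzE /= !expnS mulnA dvdn_mulr.
have d1 : (23%:Z %| 2 * b%:Z + 1)%Z.
  have : (23%:Z %| (2 * b%:Z + 1) * (2 * b%:Z + 1))%Z.
    have -> : (2 * b%:Z + 1) * (2 * b%:Z + 1) = 4 * (b%:Z ^+ 2 + b%:Z + 6) - 23%:Z by ring.
    apply: rpredB => //; apply: dvdz_mull; apply: dvdz_trans d2; by [].
  by rewrite !dvdzE abszM Euclid_dvdM // orbb.
have : (529%:Z %| 23%:Z)%Z.
  have -> : 23%:Z = 4 * (b%:Z ^+ 2 + b%:Z + 6) - (2 * b%:Z + 1) * (2 * b%:Z + 1) by ring.
  apply: rpredB; first by apply: dvdz_mull.
  by rewrite (_ : 529%:Z = 23%:Z * 23%:Z) // dvdz_mul.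
by [].
Qed.

Lemma chi_cases m : [\/ (23 %| m)%N /\ chi m = 0, chi m = 1 | chi m = -1].
Proof.
rewrite /chi; case: ifP => d; first by constructor 1.
by case: ifP => _; [constructor 2 | constructor 3].
Qed.

(** One formula for the split, inert and ramified cases; for [p = 23] the convention [0^0 = 1] gives
    the single root modulo 23. *)
Lemma nroots_pp k : (nroots (p ^ k.+1))%:Z = chi p ^+ k + chi p ^+ k.+1.
Proof.
case: (chi_cases p) => [[d ->]|c|c].
- have -> : p = 23%N by apply/eqP; rewrite eq_sym -dvdn_prime2.
  rewrite expr0n exprS mul0r addr0; case: k => [|k] /=; first by rewrite expn1 nroots23_1.
  by rewrite nroots23.
- by rewrite (nroots_split c) c !expr1n.
- rewrite nroots0; first by rewrite exprS c mulN1r subrr.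
  move=> b; apply/negP => /root_dvd rb.
  have p23 : p != 23%N by apply/eqP => p23; move: c; rewrite p23.
  by have := (root_chi pr p23).1 (ex_intro _ b rb); rewrite c.
Qed.

Definition hterm N g := if (g ^ 2 %| N)%N then nroots (N %/ g ^ 2) else 0%N.
Definition Hn N := (\sum_(g <- iota 1 N) hterm N g)%N.
Definition dsum (w : nat -> int) N : int := \sum_(d <- iota 1 N) if (d %| N)%N then w d else 0.
Definition En := dsum chi.

Variable m : nat.
Hypotheses (m0 : (0 < m)%N) (pm : ~~ (p %| m)%N).

Let pm0 v : (0 < p ^ v * m)%N.
Proof. by rewrite muln_gt0 expn_gt0 prime_gt0. Qed.

Lemma Hn_unit v : (\sum_(g <- iota 1 (p ^ v * m) | ~~ (p %| g)) hterm (p ^ v * m) g = nroots (p ^ v) * Hn m)%N.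
Proof.
have nE g : (g ^ 2 %| m)%N -> nroots ((p ^ v * m) %/ g ^ 2) = (nroots (p ^ v) * nroots (m %/ g ^ 2))%N.
  move=> d; have g0 := dvdn_gt0 m0 d; rewrite -muln_divA // nrootsM //.
  - by rewrite expn_gt0 prime_gt0.
  - by rewrite divn_gt0 // dvdn_leq.
  - by apply: coprimeXl; rewrite prime_coprime //; apply: contra pm => h; apply: dvdn_trans h _; exact: dvdn_div.
rewrite /Hn big_distrr /= -big_filter.
apply: (@sum_bij _ _ _ _ _ id id); rewrite ?filter_uniq ?iota_uniq // => g.
- rewrite mem_filter mem_iota => /andP[pg gl]; rewrite /hterm.
  have cg : coprime (g ^ 2) (p ^ v) by rewrite coprime_sym coprimeXl // coprimeXr // prime_coprime.
  rewrite Gauss_dvdr //; case: ifP => // d _; split; rewrite ?nE //.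
  by rewrite mem_iota; have := dvdn_leq m0 d; nia.
- rewrite mem_iota /hterm => gl; case: ifP => [d _|]; last by rewrite muln0.
  have pg : ~~ (p %| g)%N.
    by apply: contra pm => h; apply: dvdn_trans d; rewrite -mulnn; apply: dvdn_mulr.
  have cg : coprime (g ^ 2) (p ^ v) by rewrite coprime_sym coprimeXl // coprimeXr // prime_coprime.
  split => //.
    rewrite mem_filter pg mem_iota /=; have : (0 < p ^ v)%N by rewrite expn_gt0 prime_gt0.
    by nia.
  by rewrite Gauss_dvdr // d nE.
Qed.

Lemma Hn1 : Hn (p ^ 1 * m) = (nroots (p ^ 1) * Hn m)%N.
Proof.
rewrite {1}/Hn (bigID (fun g => p %| g)%N) /= Hn_unit big1 // => g pg.
rewrite /hterm; case: ifP => // d; case/negP: pm.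
rewrite -(dvdn_pmul2l (prime_gt0 pr)) -{2}(expn1 p); apply: dvdn_trans d.
by rewrite -mulnn dvdn_mul.
Qed.

(** The [g] prime to [p] give the product, by multiplicativity of [nroots]; the multiples [g = p g']
    give the same sum for [p^v m]. *)
Lemma HnSS v : Hn (p ^ v.+2 * m) = (nroots (p ^ v.+2) * Hn m + Hn (p ^ v * m))%N.
Proof.
rewrite {1}/Hn (bigID (fun g => p %| g)%N) /= Hn_unit addnC; congr (_ + _)%N.
have p0 := prime_gt0 pr.
have hE g : hterm (p ^ v.+2 * m) (p * g) = hterm (p ^ v * m) g.
  by rewrite /hterm (_ : (p ^ v.+2 * m)%N = (p ^ 2 * (p ^ v * m))%N) ?expnMn ?dvdn_pmul2l ?divnMl ?expn_gt0 ?p0 //; rewrite mulnA -expnD.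
rewrite /Hn -big_filter; apply: (@sum_bij _ _ _ _ _ (fun g => g %/ p)%N (fun g => p * g)%N);
  rewrite ?filter_uniq ?iota_uniq // => g.
- rewrite mem_filter mem_iota => /andP[/dvdnP[g' ->] gl]; rewrite mulnK // (mulnC g' p) hE => h; split => //.
  rewrite mem_iota; move: h; rewrite /hterm; case: ifP => // d _.
  by have := dvdn_leq (pm0 v) d; nia.
- rewrite mem_iota => gl h; rewrite mulKn //; split => //.
  rewrite mem_filter dvdn_mulr //= mem_iota; move: h; rewrite /hterm; case: ifP => // d _.
  have := dvdn_leq (pm0 v) d; have : (p ^ v.+2 * m = p * p * (p ^ v * m))%N by rewrite !expnS !mulnA.
  by have := prime_gt1 pr; nia.
Qed.

Lemma dvd_drop v d : (d %| p ^ v.+1 * m)%N -> ~~ (p ^ v.+1 %| d)%N -> (d %| p ^ v * m)%N.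
Proof.
move=> dn nd; have d0 : (0 < d)%N by apply: dvdn_gt0 dn.
have [e ce Ed] := pfactor_coprime pr d0.
have jv : (logn p d <= v)%N.
  rewrite leqNgt; apply: contra nd => h; rewrite {1}Ed; apply: dvdn_mull; exact: dvdn_exp2l.
rewrite Ed mulnC dvdn_mul ?dvdn_exp2l //.
have : (e %| p ^ v.+1 * m)%N by apply: dvdn_trans dn; rewrite {1}Ed dvdn_mulr.
by rewrite Gauss_dvdr // coprime_sym coprimeXl.
Qed.

(** The divisors gained in passing from [p^v m] to [p^(v+1) m] are the [p^(v+1) e] with [e] dividing
    [m]. This recursion serves both the count of representations and the Gauss congruences. *)
Lemma dsumS w v : dsum w (p ^ v.+1 * m) = dsum w (p ^ v * m) + dsum (fun e => w (p ^ v.+1 * e)%N) m.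
Proof.
have p0 := prime_gt0 pr.
have q0 : (0 < p ^ v.+1)%N by rewrite expn_gt0 p0.
rewrite {1}/dsum (bigID (fun d => p ^ v.+1 %| d)%N) /= addrC; congr (_ + _).
- rewrite /dsum -big_filter; apply: (@sum_bij _ _ _ _ _ id id); rewrite ?filter_uniq ?iota_uniq // => d.
  + rewrite mem_filter mem_iota => /andP[nd dl]; case: ifP => // dn _.
    have h := dvd_drop dn nd; rewrite h; split => //.
    by rewrite mem_iota; have := dvdn_leq (pm0 v) h; lia.
  + rewrite mem_iota => dl; case: ifP => // dn _; rewrite (_ : (d %| p ^ v.+1 * m)%N); last first.
      by apply: dvdn_trans dn _; rewrite dvdn_mul ?dvdn_exp2l.
    split => //; rewrite mem_filter mem_iota; apply/andP; split.
      apply: contra pm => h; have := dvdn_trans h dn.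
      by rewrite expnSr dvdn_pmul2l // expn_gt0 p0.
    by have := dvdn_leq (pm0 v) dn; rewrite expnS; nia.
- rewrite /dsum -big_filter.
  apply: (@sum_bij _ _ _ _ _ (fun d => d %/ p ^ v.+1)%N (fun d => p ^ v.+1 * d)%N);
    rewrite ?filter_uniq ?iota_uniq // => d.
  + rewrite mem_filter mem_iota => /andP[/dvdnP[d' ->] dl]; rewrite mulnK // mulnC dvdn_pmul2l //.
    case: ifP => // dn _; split => //.
    by rewrite mem_iota; have := dvdn_leq m0 dn; nia.
  + rewrite mem_iota => dl; rewrite dvdn_pmul2l // mulKn //; case: ifP => [dn _|]; last by rewrite eqxx.
    split => //; by rewrite mem_filter dvdn_mulr //= mem_iota; nia.
Qed.

Lemma EnS v : En (p ^ v.+1 * m) = En (p ^ v * m) + chi p ^+ v.+1 * En m.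
Proof.
rewrite /En dsumS /dsum mulr_sumr; congr (_ + _); apply: eq_bigr => e _.
by case: ifP => _; rewrite ?mulr0 // chiM chiX.
Qed.

End RootCount.

(** Two steps of the recursion [EnS] add [(chi(p)^(v+1) + chi(p)^(v+2)) En m], which by [nroots_pp]
    is the term added by [HnSS]; the case of exponent 1 starts the induction at each prime. *)
Lemma Hn_En n : (0 < n)%N -> (Hn n)%:Z = En n.
Proof.
have [N] := ubnP n; elim: N n => // N IH n; rewrite ltnS => nN n0.
have [n1|n1] := leqP n 1.
  have -> : n = 1%N by lia.
  by rewrite /Hn /En /dsum /hterm /nroots unlock; vm_compute.
have pr := pdiv_prime n1; set p := pdiv n in pr.
have [m cm En'] := pfactor_coprime pr n0.
have pm : ~~ (p %| m)%N by rewrite -prime_coprime.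
have m0 : (0 < m)%N by move: n0; rewrite En'; case: (m).
have p1 := prime_gt1 pr.
have : (0 < logn p n)%N by rewrite logn_gt0 pi_pdiv.
rewrite mulnC in En'; move: (logn p n) En' => k En'; case: k En' => // v En' _; rewrite En'.
have mn : (m < n)%N by rewrite En' -{1}(mul1n m) ltn_pmul2r // -{1}(exp1n v.+1) ltn_exp2r.
have hm := IH m (leq_trans mn nN) m0.
case: v En' => [|v] En'.
  rewrite (Hn1 pr m0 pm) (EnS pr m0 pm) PoszM hm (nroots_pp pr) expn0 mul1n; ring.
have ln : (p ^ v * m < n)%N.
  by rewrite En' ltn_pmul2r // ltn_exp2l.
rewrite (HnSS pr m0 pm) !(EnS pr m0 pm) PoszD PoszM hm (nroots_pp pr) IH //.
- ring.
- exact: leq_trans ln nN.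
- by rewrite muln_gt0 expn_gt0 prime_gt0.
Qed.

Lemma size_pairs n : size (pairs n) = Hn n.
Proof.
rewrite size_filter -sum1_count big_mkcond big_allpairs /Hn; apply: eq_big_seq => g.
rewrite mem_iota => gn; rewrite /hterm; case: ifP => d; last by rewrite big1.
rewrite /= /nroots /index_iota subn0.
set M := (n %/ g ^ 2)%N; have Mn : (M <= n)%N by exact: leq_div.
rewrite -(subnKC Mn) iotaD big_cat /= [X in (_ + X)%N]big1_seq; last first.
  by move=> b /andP[_]; rewrite mem_iota add0n => /andP[bM _]; rewrite ltnNge bM.
rewrite addn0; apply: eq_big_seq => b; rewrite mem_iota add0n /= => ->.
by case: rootb.
Qed.

Lemma theta_sum n : (0 < n)%N ->
  coef (thetaq 1 1 6) n + 2 * coef (thetaq 2 1 3) n = 2 * En n.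
Proof.
move=> n0; rewrite -Hn_En // -size_pairs -reps_roots //.
pose box := [seq (x, y) | x <- zr n, y <- zr n].
pose R i := \sum_(u <- box) ((qf i u.1 u.2 == n%:Z)%:R : int).
pose H i := \sum_(u <- box) ((half u.1 u.2 && (qf i u.1 u.2 == n%:Z))%:R : int).
have bN u : (- u.1, - u.2) \in box = (u \in box) by rewrite !mem_box !mem_zr !abszN.
have R2H i : R i = 2 * H i.
  have -> : R i = H i + \sum_(u <- box) ((~~ half u.1 u.2 && (qf i u.1 u.2 == n%:Z))%:R : int).
    by rewrite /R /H -big_split /=; apply: eq_bigr => u _; case: half; rewrite /= ?addr0 ?add0r.
  rewrite mulr2n mulrDl !mul1r; congr (_ + _).
  have hE x y : (half (- x) (- y) && (qf i (- x) (- y) == n%:Z)) = (~~ half x y && (qf i x y == n%:Z)).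
    have -> : qf i (- x) (- y) = qf i x y by rewrite /qf; ring.
    case: eqP => [E|]; rewrite ?andbF // !andbT.
    have nz : ~~ ((x == 0) && (y == 0)).
      by apply/negP => /andP[/eqP x0 /eqP y0]; move: E; rewrite x0 y0 /qf !mulr0 !addr0; lia.
    by move: nz; rewrite /half; lia.
  apply: (@sum_bij _ _ _ _ _ (fun u => (- u.1, - u.2)) (fun u => (- u.1, - u.2))); rewrite ?box_uniq // => -[x y] hu _;
    rewrite bN /= !opprK hu; split => //; first by rewrite hE.
  by have := hE (- x) (- y); rewrite !opprK => ->.
(* The forms of indices 1 and 2 are exchanged by [y |-> - y]; this is why the second theta series is
   counted twice. *)
have R12 : R (inord 2) = R (inord 1).
  have qE x y : qf (inord 2) x (- y) = qf (inord 1) x y.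
    by rewrite /qf /fA /fbeta /fC !inordK //=; ring.
  apply: (@sum_bij _ _ _ _ _ (fun u => (u.1, - u.2)) (fun u => (u.1, - u.2))); rewrite ?box_uniq // => -[x y] + _;
    rewrite !mem_box /= !mem_zr !abszN /= !opprK => hu; split => //; last by rewrite qE.
  by rewrite -qE opprK.
have sH : (size (reps_half n))%:Z = H ord0 + H (inord 1) + H (inord 2).
  have e3 : enum 'I_3 = [:: ord0; inord 1; inord 2].
    by apply: (inj_map val_inj); rewrite val_enum_ord /= !inordK.
  have s3 (K : 'I_3 -> nat) a b c : (\sum_(i <- [:: a; b; c]) K i = K a + K b + K c)%N.
    by rewrite !big_cons big_nil addn0 addnA.
  rewrite size_filter -sum1_count big_mkcond big_allpairs e3 s3 !PoszD -/box.
  by congr (_ + _ + _); rewrite /H (big_morph Posz PoszD (erefl 0%:Z)); apply: eq_bigr => u _; rewrite /=; case: (_ && _).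
have -> : coef (thetaq 1 1 6) n = R ord0.
  transitivity (\sum_(x <- zr n) \sum_(y <- zr n) ((1 * x ^+ 2 + 1 * x * y + 6 * y ^+ 2 == n%:Z)%:R : int)) => //.
  have qE x y : qf ord0 x y = 1 * x ^+ 2 + 1 * x * y + 6 * y ^+ 2.
    by rewrite /qf /fA /fbeta /fC /= mulr0 add0r.
  by rewrite /R sum_box; apply: eq_bigr => u _; rewrite qE.
have -> : coef (thetaq 2 1 3) n = R (inord 1).
  transitivity (\sum_(x <- zr n) \sum_(y <- zr n) ((2 * x ^+ 2 + 1 * x * y + 3 * y ^+ 2 == n%:Z)%:R : int)) => //.
  have qE x y : qf (inord 1) x y = 2 * x ^+ 2 + 1 * x * y + 3 * y ^+ 2.
    by rewrite /qf /fA /fbeta /fC !inordK //= mulr0 add0r.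
  by rewrite /R sum_box; apply: eq_bigr => u _; rewrite qE.
by rewrite sH mulrDr mulrDr -!R2H R12; ring.
Qed.

Lemma cf_lam_dvd w N : coef (lam w) N =
  \sum_(1 <= d < N.+1) if (d %| N)%N then w d (N %/ d)%N else 0.
Proof.
apply: eq_big_nat => d /andP[d0 dn]; case: ifP => h; last first.
  by rewrite big1 // => x /eqP E; move: h; rewrite -E dvdn_mulr.
have N0 : (0 < N)%N by lia.
rewrite big_mkcond (bigD1_seq (N %/ d)%N) ?iota_uniq //=; last first.
  rewrite mem_index_iota divn_gt0 // (dvdn_leq N0 h) //.
  by rewrite ltnS leq_div.
rewrite mulnC divnK // eqxx big1 ?addr0 // => x /eqP nx.
by case: eqP => // E; case: nx; rewrite -E mulKn.
Qed.

Lemma dsum_rat w N : (dsum w N)%:~R = \sum_(1 <= d < N.+1) (if (d %| N)%N then (w d)%:~R else 0) :> rat.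
Proof.
rewrite /dsum rmorph_sum /index_iota subn1; apply: eq_bigr => d _.
by case: ifP.
Qed.

Lemma dsum_swap (w : nat -> nat -> int) N :
  dsum (fun d => w d (N %/ d)%N) N = dsum (fun d => w (N %/ d)%N d) N.
Proof.
have inv d : (0 < d < 1 + N)%N -> (d %| N)%N -> [/\ (N %/ d \in iota 1 N)%N, (N %/ (N %/ d) = d)%N & (N %/ d %| N)%N].
  move=> dN h; have N0 : (0 < N)%N by lia.
  split; last exact: dvdn_div.
    rewrite mem_iota divn_gt0; last by lia.
    by rewrite (dvdn_leq N0 h) /= add1n ltnS leq_div.
  by rewrite divnA // mulKn.
apply: (@sum_bij _ _ _ _ _ (fun d => N %/ d)%N (fun d => N %/ d)%N); rewrite ?iota_uniq // => d; rewrite mem_iota => dN;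
  case: ifP => // h _; have [i1 i2 i3] := inv d dN h; split => //; by rewrite i3 i2.
Qed.

Lemma theta_E3 : fps_map intr (thetaq 1 1 6 + thetaq 2 1 3 *+ 2) = E3.
Proof.
apply: fpsP => -[|n].
  have t0 a b c : coef (thetaq a b c) 0 = 1.
    by rewrite /= /zr /= !(big_cons, big_nil) /= subrr !mulr0 !addr0.
  by rewrite cf_map cfD cfMn !t0 cfD cfC /= big_geq // addr0.
rewrite cf_map cfD cfMn -(mulr_natl (coef (thetaq 2 1 3) n.+1) 2) theta_sum // cfD cfC add0r.
have h2 (z : int) : (2 * z)%:~R = 2 * z%:~R :> rat by rewrite intrM.
apply: (etrans (h2 _)); rewrite cf_lam_dvd dsum_rat mulr_sumr; apply: eq_bigr => d _.
by case: ifP; rewrite ?mulr0.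
Qed.

(** * Logarithmic derivatives and congruences *)

(** The expansion of [q^k / (1 - q^k)]. *)
Definition geo k : fps int := Fps (fun N => ((0 < N) && (k %| N))%N%:R).

Lemma theta_geo k : (0 < k)%N -> theta (1 - fpsXn int k) = (1 - fpsXn int k) * - (geo k *+ k).
Proof.
move=> k0; have g : (1 - fpsXn int k) * geo k = fpsXn int k.
  apply: fpsP => N; rewrite mulrBl mul1r cfB cfXnM /=.
  case: (leqP k N) => h; last first.
    rewrite subr0 ltn_eqF //; case: N h => [|N] h //.
    by rewrite gtnNdvd.
  rewrite -{2}(subnK h) dvdn_addl // subn_gt0 [in X in X - _](leq_trans k0 h) /=.
  case: ltngtP h => // [h _|-> _]; first by rewrite subrr.
  by rewrite subnn dvdn0 subr0.
rewrite raddfB /= theta1 sub0r mulrN mulrnAr g.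
congr (- _); apply: fpsP => N; rewrite cf_theta cfMn /=.
by case: eqP => [->|]; rewrite // !mul0rn.
Qed.

Lemma theta_prodq s K : (0 < s)%N -> theta (prodq int s K) =
  prodq int s K * - \sum_(1 <= i < K.+1) geo (s * i) *+ (s * i).
Proof.
move=> s0; elim: K => [|K IH]; first by rewrite /prodq !big_geq // theta1 oppr0 mulr0.
rewrite /prodq big_nat_recr //= -/(prodq int s K) thetaM IH theta_geo ?muln_gt0 ?s0 //.
by rewrite [in RHS]big_nat_recr //=; ring.
Qed.

(** Minus the logarithmic derivative of the infinite product of the [1 - q^(s i)]. *)
Definition ldser s : fps int := Fps (fun N => dsum (fun d => if (s %| d)%N then d%:Z else 0) N).

Lemma cf_geo_sum s K N : (0 < s)%N -> (N <= K)%N ->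
  coef (\sum_(1 <= i < K.+1) geo (s * i) *+ (s * i)) N = coef (ldser s) N.
Proof.
move=> s0 NK; rewrite cf_sum /= /dsum.
apply: (@sum_bij _ _ _ _ _ (fun i => s * i)%N (fun d => d %/ s)%N); rewrite ?iota_uniq // => i.
- rewrite mem_index_iota => iK; rewrite cfMn /= mulKn //.
  case N0 : (0 < N)%N; last by rewrite mul0rn eqxx.
  case d : (s * i %| N)%N; last by rewrite mul0rn eqxx.
  split => //; last by rewrite dvdn_mulr //= mulr1n natz.
  by rewrite mem_iota add1n ltnS (dvdn_leq N0 d) muln_gt0 s0; case/andP: iK => ->.
- rewrite mem_iota => iN; case: ifP => // d; case: ifP => // sd _.
  rewrite muln_divA // mulKn //; have i0 : (0 < i)%N by lia.
  rewrite mem_index_iota divn_gt0 // (dvdn_leq i0 sd) cfMn /= d; split => //.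
    by rewrite ltnS; apply: leq_trans (leq_div _ _) _; lia.
  have -> : (0 < N)%N by lia.
  by rewrite /= mulr1n natz.
Qed.

Lemma theta_eprod s : (0 < s)%N -> theta (eprod int s) = eprod int s * - ldser s.
Proof.
move=> s0; apply: fpsP => N.
have -> : coef (theta (eprod int s)) N = coef (theta (prodq int s N)) N by rewrite !cf_theta.
rewrite theta_prodq // !cfM; apply: eq_bigr => i _; rewrite !cfN cf_geo_sum //; last by lia.
by rewrite (prodq_stable _ s0) //; have := ltn_ord i; lia.
Qed.

Definition Pint : fps int := 1 - ldser 1 - ldser 23.

Lemma theta_hser : theta (hser int) = hser int * Pint.
Proof.
have tX : theta (fpsXn int 1) = fpsXn int 1.
  by apply: fpsP => n; rewrite cf_theta /=; case: eqP => [->|]; rewrite ?mul0rn.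
by rewrite /hser !thetaM tX !theta_eprod // /Pint; ring.
Qed.

Definition pw (d : nat) : int := d%:Z * (1 + (23 %| d)%N%:R).

Lemma cf_Pint N : coef Pint N = (N == 0%N)%:R - dsum pw N.
Proof.
rewrite /Pint !cfB cf1 -addrA -opprD; congr (_ - _).
rewrite /= /dsum -big_split /=; apply: eq_bigr => d _; rewrite /pw.
rewrite dvd1n; case: ifP => _; last by rewrite addr0.
by case: ifP => _ /=; ring.
Qed.

Lemma fps_map_Pint : fps_map intr Pint = Pser.
Proof.
apply: fpsP => N; rewrite cf_map cf_Pint /Pser cfD cf1 rmorphB; congr (_ + _); first by rewrite rmorph_nat.
rewrite cf_lam_dvd (_ : dsum pw N = dsum (fun d => pw (N %/ d)%N) N); last exact: (dsum_swap (fun d _ => pw d)).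
rewrite /= dsum_rat -sumrN; apply: eq_bigr => d _.
by case: ifP => _; rewrite ?oppr0 // /pw intrM rmorphD /= rmorph1 !rmorph_nat.
Qed.

Definition Gint : fps int := thetaq 1 1 6 * Pint - theta (thetaq 1 1 6).

(** The two theta series differ by [2 h], and [h P - theta h = 0]. *)
Lemma Gint2 : thetaq 2 1 3 * Pint - theta (thetaq 2 1 3) = Gint.
Proof.
have d := theta_diff.
have -> : thetaq 2 1 3 = thetaq 1 1 6 - hser int *+ 2 by rewrite -d; ring.
have -> : theta (thetaq 1 1 6 - hser int *+ 2) = theta (thetaq 1 1 6) - theta (hser int) *+ 2.
  by rewrite raddfB raddfMn.
rewrite /Gint theta_hser; ring.
Qed.

Lemma fps_map_Gint : fps_map intr (Gint *+ 3) = G3.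
Proof.
rewrite -eis_identity -theta_E3 -fps_map_Pint -fps_map_theta -rmorphM -rmorphB; congr (fps_map _ _).
rewrite raddfD /= raddfMn /= mulrDl.
have -> : Gint *+ 3 = (thetaq 1 1 6 * Pint - theta (thetaq 1 1 6)) +
    (thetaq 2 1 3 * Pint - theta (thetaq 2 1 3)) *+ 2 by rewrite Gint2 -/Gint; ring.
by ring.
Qed.

Definition gw N (d : nat) : int := d%:Z ^+ 2 * (chi d + 23 * chi (N %/ d)).

Lemma cf_Gint N : (0 < N)%N -> 24 * coef Gint N = - dsum (gw N) N.
Proof.
move=> N0; apply: (@intr_inj rat).
have := congr1 (fun s => coef s N) fps_map_Gint; rewrite cf_map cfMn /G3 cfD cfC gtn_eqF // add0r cf_lam_dvd => h.
have -> : dsum (gw N) N = dsum (fun d => d%:Z ^+ 2 * chi d) N + dsum (fun d => 23 * (N %/ d)%N%:Z ^+ 2 * chi d) N.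
  rewrite [X in _ = _ + X](dsum_swap (fun d n => 23 * n%:Z ^+ 2 * chi d)) /dsum -big_split /=; apply: eq_bigr => d _.
  by case: ifP => _; rewrite ?addr0 // /gw; ring.
have -> : (24 * coef Gint N)%:~R = 8 * (coef Gint N *+ 3)%:~R :> rat by rewrite -[8]/(8%:~R) -intrM; congr (_%:~R); ring.
rewrite h rmorphN rmorphD /= !dsum_rat -big_split /= -sumrN mulr_sumr; apply: eq_bigr => d _.
case: ifP => _; last by rewrite addr0 oppr0 mulr0.
have e23 : (23%:~R : rat) = 23 by [].
by rewrite !expr2 !intrM e23 -!pmulrn; field.
Qed.

(** * Gauss congruences for [P] and [G] *)

Section Gauss.
Variable p : nat.
Hypotheses (pr : prime p) (chip : chi p = 1).

Lemma gauss_split (a : nat -> int) :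
  (forall v m, (0 < m)%N -> ~~ (p %| m)%N -> ((p ^ v.+1)%N %| a (p ^ v.+1 * m)%N - a (p ^ v * m)%N)%Z) ->
  gauss p a.
Proof.
move=> h k k0 pk; have [m cm Ek] := pfactor_coprime pr k0.
have v0 : (0 < logn p k)%N by rewrite logn_gt0 mem_primes pr k0.
move: (logn p k) v0 Ek => [//|v] _ ->.
have m0 : (0 < m)%N by case: m cm => // ; rewrite /coprime gcdn0 => /eqP E; move: pr; rewrite E.
have -> : ((m * p ^ v.+1) %/ p = p ^ v * m)%N by rewrite expnSr mulnA mulnK ?prime_gt0 // mulnC.
by rewrite mulnC; apply: h => //; rewrite -prime_coprime.
Qed.

(** The divisors gained are multiples of [p^(v+1)], and each contributes a multiple of itself. *)
Lemma gauss_Pint : gauss p (coef Pint).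
Proof.
apply: gauss_split => v m m0 pm; rewrite !cf_Pint.
have e0 w : ((p ^ w * m)%N == 0%N) = false by apply/negbTE; rewrite -lt0n muln_gt0 expn_gt0 prime_gt0.
rewrite !e0 (dsumS pr m0 pm) !sub0r opprK opprD addrC addrA subrr add0r.
rewrite rpredN; apply: rpred_sum => e _; case: ifP => _; last exact: rpred0.
by rewrite /pw PoszM -mulrA dvdz_mulr.
Qed.

(** Because [chi p = 1], the old divisors keep their weight when [N] is multiplied by [p], and the
    new ones give [p^(2(v+1))] times the coefficient at [m]. The factor 24 is cancelled in the
    integers, where the coefficient at [m] lives, so [p = 2] and [p = 3] are covered. *)
Lemma gauss_Gint : gauss p (coef Gint).
Proof.
apply: gauss_split => v m m0 pm.
have q0 w : (0 < p ^ w)%N by rewrite expn_gt0 prime_gt0.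
have n0 w : (0 < p ^ w * m)%N by rewrite muln_gt0 q0.
have chq w : chi (p ^ w) = 1 by rewrite chiX chip expr1n.
have E : coef Gint (p ^ v.+1 * m)%N - coef Gint (p ^ v * m)%N = (p ^ v.+1)%N%:Z ^+ 2 * coef Gint m.
  apply: (@mulfI _ (24 : int)) => //; rewrite mulrBr mulrCA !cf_Gint // (dsumS pr m0 pm).
  have -> : dsum (gw (p ^ v.+1 * m)) (p ^ v * m) = dsum (gw (p ^ v * m)) (p ^ v * m).
    apply: eq_bigr => d _; case: ifP => // h; rewrite /gw; congr (_ * (_ + _ * _)).
    by rewrite expnS -mulnA -muln_divA // chiM chip mul1r.
  have -> : dsum (fun e => gw (p ^ v.+1 * m) (p ^ v.+1 * e)%N) m = (p ^ v.+1)%N%:Z ^+ 2 * dsum (gw m) m.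
    rewrite /dsum mulr_sumr; apply: eq_bigr => d _; case: ifP => h; last by rewrite mulr0.
    by rewrite /gw divnMl // chiM chq mul1r PoszM exprMn mulrA.
  by ring.
by rewrite E expr2 -mulrA dvdz_mulr.
Qed.

End Gauss.

Lemma legendre_chi p : legendre p 23 = 1 -> chi p = 1.
Proof.
rewrite /legendre; case: ifP => // d; case: ifP => // /existsP[x /eqP E] _.
have h : all (fun y => (y ^ 2 %% 23 == 0) || (y ^ 2 %% 23 \in qres))%N (iota 0 23) by [].
have := allP h x; rewrite mem_iota /= ltn_ord => /(_ isT); rewrite E.
by rewrite -/(dvdn 23 p) d /chi d /= => ->.
Qed.

Lemma theta_coef0 a b c : coef (thetaq a b c) 0 = 1.
Proof. by rewrite /= /zr /= !(big_cons, big_nil) /= subrr !mulr0 !addr0. Qed.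

Lemma hser_div f : coef f 0 = 1 -> let t := hser int * fps_inv f in
  [/\ coef t 0 = 0, coef t 1 = 1 & t * f = hser int].
Proof.
move=> f0 t.
have fi : coef (fps_inv f) 0 = 1.
  by have := congr1 (fun s => coef s 0) (fps_mulV f0); rewrite cfM0 f0 mul1r cf1.
have e0 s : coef (eprod int s) 0 = 1 by rewrite /= /prodq big_geq // cf1.
have tE : t = fpsXn int 1 * (eprod int 1 * eprod int 23 * fps_inv f) by rewrite /t /hser; ring.
split; first by rewrite tE cfXnM.
  by rewrite tE cfXnM subnn !cfM0 !e0 fi.
by rewrite /t -mulrA [fps_inv f * f]mulrC fps_mulV // mulr1.
Qed.

Lemma expansion_gauss p (f : fps int) (c : nat -> int) : prime p -> chi p = 1 -> coef f 0 = 1 ->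
  f * Pint - theta f = Gint ->
  (forall k, coef f k = \sum_(n < k.+1) c n * coef ((hser int * fps_inv f) ^+ n) k) ->
  gauss p c.
Proof.
move=> pr cp f0 hG hc; have [t0 t1 tf] := hser_div f0.
apply: (transfer pr f0 t0 t1 _ hG hc); first by rewrite tf theta_hser.
  exact: gauss_Pint.
exact: gauss_Gint.
Qed.

(** * Asymptotic expansions at 0 *)

Section Asymptotics.
Variable R : realType.

Definition bigO N (g : R -> R) := exists C d, [/\ 0 <= C, 0 < d &
  forall x, 0 < x -> x < d -> `|g x| <= C * x ^+ N].

Lemma bigO_near N (g h : R -> R) d : 0 < d -> (forall x, 0 < x -> x < d -> g x = h x) ->
  bigO N g -> bigO N h.
Proof.
move=> d0 gh [C [d' [C0 d'0 H]]]; exists C, (Num.min d d'); split; rewrite ?lt_min ?d0 //.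
by move=> x x0; rewrite lt_min => /andP[xd xd']; rewrite -gh //; exact: H.
Qed.

Lemma bigO_ext N (g h : R -> R) : (forall x, g x = h x) -> bigO N g -> bigO N h.
Proof. by move=> gh; apply: (@bigO_near _ _ _ 1). Qed.

Lemma bigO_weak N M g : (N <= M)%N -> bigO M g -> bigO N g.
Proof.
move=> NM [C [d [C0 d0 H]]]; exists C, (Num.min d 1); split; rewrite ?lt_min ?d0 ?ltr01 //.
move=> x x0; rewrite lt_min => /andP[xd x1]; apply: le_trans (H x x0 xd) _.
by apply: ler_wpM2l => //; apply: ler_wiXn2l => //; exact: ltW.
Qed.

Lemma bigOD N g h : bigO N g -> bigO N h -> bigO N (fun x => g x + h x).
Proof.
move=> [C [d [C0 d0 H]]] [C' [d' [C0' d0' H']]].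
exists (C + C'), (Num.min d d'); split; rewrite ?lt_min ?d0 ?addr_ge0 //.
move=> x x0; rewrite lt_min => /andP[xd xd']; apply: le_trans (ler_normD _ _) _.
by rewrite mulrDl lerD ?H ?H'.
Qed.

Lemma bigOM N M g h : bigO N g -> bigO M h -> bigO (N + M) (fun x => g x * h x).
Proof.
move=> [C [d [C0 d0 H]]] [C' [d' [C0' d0' H']]].
exists (C * C'), (Num.min d d'); split; rewrite ?lt_min ?d0 ?mulr_ge0 //.
move=> x x0; rewrite lt_min => /andP[xd xd']; rewrite normrM exprD.
by rewrite (_ : C * C' * _ = (C * x ^+ N) * (C' * x ^+ M)); [rewrite ler_pM ?H ?H' | ring].
Qed.

Lemma bigO_cst c : bigO 0 (fun=> c).
Proof. by exists `|c|, 1; split => // x _ _; rewrite expr0 mulr1. Qed.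

Lemma bigO_X N : bigO N (fun x => x ^+ N).
Proof. by exists 1, 1; split => // x x0 _; rewrite mul1r ger0_norm // exprn_ge0 // ltW. Qed.

Lemma bigON N g : bigO N g -> bigO N (fun x => - g x).
Proof. by move=> [C [d [C0 d0 H]]]; exists C, d; split => // x x0 xd; rewrite normrN H. Qed.

Lemma bigOB N g h : bigO N g -> bigO N h -> bigO N (fun x => g x - h x).
Proof. by move=> ? ?; apply: bigOD => //; exact: bigON. Qed.

Lemma bigO_poly0 (p : {poly R}) : bigO 0 (fun x => p.[x]).
Proof.
elim/poly_ind: p => [|p c IH]; first by apply: bigO_ext (bigO_cst 0) => x; rewrite horner0.
apply: (@bigO_ext _ (fun x => p.[x] * x ^+ 1 + c)); first by move=> x; rewrite !hornerE.
apply: bigOD; last exact: bigO_cst.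
by apply: (@bigO_weak 0 (0 + 1)) => //; apply: bigOM => //; exact: bigO_X.
Qed.

Lemma bigO_poly N (p : {poly R}) : (forall k, (k < N)%N -> p`_k = 0) -> bigO N (fun x => p.[x]).
Proof.
move=> h; have -> : p = drop_poly N p * 'X^N.
  rewrite -[LHS](poly_take_drop N p) [take_poly N p](_ : _ = 0) ?add0r //.
  by apply/polyP => k; rewrite coef_take_poly coef0; case: ifP => // /h.
apply: (@bigO_ext _ (fun x => (drop_poly N p).[x] * x ^+ N)); first by move=> x; rewrite !hornerE.
exact: (bigOM (bigO_poly0 _) (bigO_X _)).
Qed.

Lemma bigO_cst_eq0 c : bigO 1 (fun=> c) -> c = 0.
Proof.
move=> [C [d [C0 d0 H]]]; apply/eqP; apply: contraT => c0.
have c1 : 0 < `|c| by rewrite normr_gt0.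
pose x := Num.min (d / 2) (`|c| / (2 * (C + 1))).
have x0 : 0 < x by rewrite lt_min !divr_gt0 // mulr_gt0 //; lra.
have xd : x < d by rewrite /x gt_min; apply/orP; left; lra.
have xc : x * (2 * (C + 1)) <= `|c|.
  by rewrite -ler_pdivlMr ?ge_min ?lexx ?orbT // mulr_gt0 //; lra.
have := H x x0 xd; rewrite expr1 => h; nra.
Qed.

Lemma bigO_poly_eq0 N (p : {poly R}) : bigO N (fun x => p.[x]) -> forall k, (k < N)%N -> p`_k = 0.
Proof.
elim: N p => // N IH p Hp.
have Ep : p = drop_poly 1 p * 'X + (p`_0)%:P.
  apply/polyP => k; rewrite coefD coefMX coefC coef_drop_poly.
  by case: k => [|k] /=; rewrite ?add0r // addr0 addn1.
set q := drop_poly 1 p in Ep.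
have px x : p.[x] = q.[x] * x ^+ 1 + p`_0 by rewrite {1}Ep !hornerE.
have p0 : p`_0 = 0.
  apply: bigO_cst_eq0; apply: (@bigO_ext _ (fun x => p.[x] - q.[x] * x ^+ 1)).
    by move=> x; rewrite px; ring.
  apply: bigOB; first exact: bigO_weak Hp.
  exact: (bigOM (bigO_poly0 _) (bigO_X _)).
have Hq : bigO N (fun x => q.[x]).
  have [C [d [C0 d0 H]]] := Hp; exists C, d; split => // x x0 xd.
  have := H x x0 xd; rewrite px p0 addr0 expr1 normrM (gtr0_norm x0) exprSr mulrA.
  by rewrite ler_pM2r.
case=> [|k] kN //; have := IH q Hq k kN.
by rewrite Ep coefD coefMX coefC /= addr0.
Qed.

(** Terms of degree at least [N] are left free in the polynomial, being absorbed by the error;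
    products then need no truncation. *)
Definition asy N (g : R -> R) (s : fps R) := exists2 p : {poly R},
  (forall k, (k < N)%N -> p`_k = coef s k) & bigO N (fun x => g x - p.[x]).

Lemma asy_near N (g h : R -> R) s d : 0 < d -> (forall x, 0 < x -> x < d -> g x = h x) ->
  asy N g s -> asy N h s.
Proof.
move=> d0 gh [p ps H]; exists p => //; apply: bigO_near d0 _ H => x x0 xd; by rewrite gh.
Qed.

Lemma asy_coef N g s t : (forall k, (k < N)%N -> coef s k = coef t k) -> asy N g s -> asy N g t.
Proof. by move=> st [p ps H]; exists p => // k kN; rewrite ps // st. Qed.

Lemma asy_add_bigO N g h s : asy N g s -> bigO N h -> asy N (fun x => g x + h x) s.
Proof.
move=> [p ps H] hO; exists p => //.
by apply: bigO_ext (bigOD H hO) => x; ring.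
Qed.

Lemma asy_bigO0 N g s : asy N g s -> bigO 0 g.
Proof.
move=> [p ps H]; apply: (@bigO_ext _ (fun x => (g x - p.[x]) + p.[x])); first by move=> x; ring.
by apply: bigOD; [exact: bigO_weak H | exact: bigO_poly0].
Qed.

Lemma asyD N g h s t : asy N g s -> asy N h t -> asy N (fun x => g x + h x) (s + t).
Proof.
move=> [p ps H] [q qt H']; exists (p + q); first by move=> k kN; rewrite coefD cfD ps ?qt.
by apply: bigO_ext (bigOD H H') => x; rewrite hornerD; ring.
Qed.

Lemma asyM N g h s t : asy N g s -> asy N h t -> asy N (fun x => g x * h x) (s * t).
Proof.
move=> Hg Hh; have h0 := asy_bigO0 Hh; move: Hg Hh => [p ps H] [q qt H'].
exists (p * q).
  move=> k kN; rewrite coefM cfM; apply: eq_bigr => i _; rewrite ps ?qt //; first lia.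
  by have := ltn_ord i; lia.
have O1 := bigOM H h0; have O2 := bigOM (bigO_poly0 p) H'.
rewrite addn0 in O1; rewrite add0n in O2.
by apply: bigO_ext (bigOD O1 O2) => x; rewrite hornerM; ring.
Qed.

Lemma asyC N c : asy N (fun=> c) (fpsC c).
Proof.
exists c%:P; first by move=> k _; rewrite coefC.
by apply: (@bigO_near _ (fun x => (0 : {poly R}).[x]) _ 1) => // [x _ _|]; [rewrite !hornerE subrr | apply: bigO_poly => k _; rewrite coef0].
Qed.

Lemma asyXn N k : asy N (fun x => x ^+ k) (fpsXn R k).
Proof.
exists 'X^k; first by move=> i _; rewrite coefXn.
by apply: (@bigO_near _ (fun x => (0 : {poly R}).[x]) _ 1) => // [x _ _|]; [rewrite !hornerE subrr | apply: bigO_poly => i _; rewrite coef0].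
Qed.

Lemma asy_ext N (g h : R -> R) s t : (forall x, g x = h x) -> s = t -> asy N g s -> asy N h t.
Proof. by move=> gh <-; apply: (@asy_near _ _ _ _ 1). Qed.

Lemma asyX N g s k : asy N g s -> asy N (fun x => g x ^+ k) (s ^+ k).
Proof.
move=> H; elim: k => [|k IH].
  by apply: asy_ext (asyC N 1); [move=> x; rewrite expr0 | rewrite expr0 rmorph1].
by apply: asy_ext (asyM H IH); [move=> x; rewrite exprS | rewrite exprS].
Qed.

Lemma asy_sum N (I : Type) (r : seq I) (G : I -> R -> R) S : (forall i, asy N (G i) (S i)) ->
  asy N (fun x => \sum_(i <- r) G i x) (\sum_(i <- r) S i).
Proof.
move=> H; elim: r => [|i r IH].
  by apply: asy_ext (asyC N 0); [move=> x; rewrite big_nil | rewrite big_nil rmorph0].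
by apply: asy_ext (asyD (H i) IH); [move=> x; rewrite big_cons | rewrite big_cons].
Qed.

Lemma asy_prod N (I : Type) (r : seq I) (G : I -> R -> R) S : (forall i, asy N (G i) (S i)) ->
  asy N (fun x => \prod_(i <- r) G i x) (\prod_(i <- r) S i).
Proof.
move=> H; elim: r => [|i r IH].
  by apply: asy_ext (asyC N 1); [move=> x; rewrite big_nil | rewrite big_nil rmorph1].
by apply: asy_ext (asyM (H i) IH); [move=> x; rewrite big_cons | rewrite big_cons].
Qed.

(** The passage from analytic to formal identities: two expansions of one function as [x] tends to 0
    from the right coincide. *)
Lemma asy_uniq N g s t : asy N g s -> asy N g t -> forall k, (k < N)%N -> coef s k = coef t k.
Proof.
move=> [p ps H] [q qt H'] k kN; rewrite -ps // -qt //; apply/eqP; rewrite -subr_eq0 -coefB.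
apply/eqP; apply: (bigO_poly_eq0 _ kN); apply: bigO_ext (bigOB H' H) => x.
by rewrite !hornerE; ring.
Qed.

Lemma asy_ge N g s : asy N.+1 g s -> coef s 0 = 1 ->
  exists2 d, 0 < d & forall x, 0 < x -> x < d -> 1 / 2 <= g x /\ g x <= 2.
Proof.
move=> [p ps H] s0.
have [C [d [C0 d0 h]]] : bigO 1 (fun x => g x - 1).
  apply: (@bigO_ext _ (fun x => (g x - p.[x]) + (p - 1%:P).[x])); first by move=> x; rewrite hornerD hornerN hornerC; ring.
  apply: bigOD; first exact: bigO_weak H.
  by apply: bigO_poly => -[|//] _; rewrite coefB coefC ps // s0 subrr.
exists (Num.min d (1 / (2 * (C + 1)))).
  by rewrite lt_min d0 divr_gt0 // mulr_gt0 //; lra.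
move=> x x0; rewrite lt_min => /andP[xd xc].
have C2 : 0 < 2 * (C + 1) by rewrite mulr_gt0 //; lra.
have {}xc : x * (2 * (C + 1)) < 1 by rewrite -ltr_pdivlMr.
have := h x x0 xd; rewrite expr1 ler_norml => /andP[h1 h2].
by split; nra.
Qed.

(** The order is positive so that the expansion sees the constant term 1, which keeps [g] above 1/2
    near 0 and makes [1 / g] bounded. *)
Lemma asy_div N g h s t : coef s 0 = 1 -> asy N.+1 g s -> asy N.+1 h (s * t) -> asy N.+1 (fun x => h x / g x) t.
Proof.
move=> s0 Hg Hh; have [d d0 hd] := asy_ge Hg s0.
pose p := trunc N.+1 t.
have pt k : (k < N.+1)%N -> p`_k = coef t k by rewrite coef_trunc => ->.
have Hp : asy N.+1 (fun x => p.[x]) t.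
  by exists p => //; apply: (@bigO_ext _ (fun x => (0 : {poly R}).[x])) => [x|]; [rewrite horner0 subrr | apply: bigO_poly => i _; rewrite coef0].
have [q qt Hq] := asyM Hg Hp; have [q' qt' Hq'] := Hh.
have HO : bigO N.+1 (fun x => h x - g x * p.[x]).
  apply: (@bigO_ext _ (fun x => (h x - q'.[x]) - (g x * p.[x] - q.[x]) + (q' - q).[x])).
    by move=> x; rewrite hornerD hornerN; ring.
  apply: bigOD; first exact: bigOB.
  by apply: bigO_poly => k kN; rewrite coefB qt' // qt // subrr.
exists p => //; apply: (@bigO_near _ (fun x => (h x - g x * p.[x]) * (g x)^-1) _ d) => //.
  move=> x x0 xd; have [g1 _] := hd x x0 xd.
  have gn : g x != 0 by rewrite gt_eqF //; apply: lt_le_trans g1; rewrite divr_gt0.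
  by field.
apply: (@bigO_weak _ (N.+1 + 0)); first by rewrite addn0.
apply: bigOM => //.
exists 2, d; split => // x x0 xd; have [g1 _] := hd x x0 xd.
have g0 : 0 < g x by apply: lt_le_trans g1; rewrite divr_gt0.
by rewrite expr0 mulr1 gtr0_norm ?invr_gt0 // -[2]invrK lef_pV2 ?posrE ?invr_gt0 // -div1r.
Qed.

End Asymptotics.

Local Open Scope classical_set_scope.
Local Open Scope ring_scope.

(** * Bilateral sums of reals dominated by a geometric series *)

Section RealSums.
Variable R : realType.
Implicit Types (u : nat -> R) (a : int -> R).

Lemma series_fin u M : (forall k, (M <= k)%N -> u k = 0) -> series u @ \oo --> \sum_(0 <= i < M) u i.
Proof.
move=> h; apply: cvg_near_cst; near=> n.
have Mn : (M <= n)%N by near: n; exists M.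
rewrite /series /= (@big_cat_nat _ _ _ M 0 n) //= [X in _ + X]big_nat_cond [X in _ + X]big1 ?addr0 //.
by move=> i /andP[/andP[Mi _] _]; exact: h.
Unshelve. all: by end_near. Qed.

Lemma geo_half n : \sum_(0 <= i < n) (1 / 2 : R) ^+ i = 2 - 2 * (1 / 2) ^+ n.
Proof.
elim: n => [|n IH]; first by rewrite big_geq // expr0; ring.
by rewrite big_nat_recr //= IH exprS; field.
Qed.

Lemma series_dom u K : 0 <= K -> (forall k, 0 <= u k <= K * (1 / 2) ^+ k) ->
  exists2 s, series u @ \oo --> s & 0 <= s <= 2 * K.
Proof.
move=> K0 h.
have ub n : series u n <= 2 * K.
  apply: (@le_trans _ _ (\sum_(0 <= i < n) K * (1 / 2) ^+ i)).
    by apply: ler_sum => i _; case/andP: (h i).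
  rewrite -mulr_sumr geo_half; have : 0 <= (1 / 2 : R) ^+ n by rewrite exprn_ge0 // divr_ge0.
  by nra.
have ge n : 0 <= series u n by apply: sumr_ge0 => i _; case/andP: (h i).
have cv : cvgn (series u).
  apply: nondecreasing_is_cvgn.
    by apply: nondecreasing_series => i _ _; case/andP: (h i).
  by exists (2 * K) => _ [n _ <-].
exists (limn (series u)) => //; apply/andP; split.
  by apply: limr_ge => //; apply: nearW.
by apply: limr_le => //; apply: nearW.
Qed.

(** Records convergence of the two halves used by [sumZ], since the limit operator also returns a
    value on divergent sequences. *)
Definition hsZ a s := exists s1 s2, [/\ series (fun k : nat => a k%:Z) @ \oo --> s1,
  series (fun k : nat => a (- k.+1%:Z)) @ \oo --> s2 & s = s1 + s2].

Definition rsZ a : R := limn (series (fun k : nat => a k%:Z)) + limn (series (fun k : nat => a (- k.+1%:Z))).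

Lemma hsZ_lim a s : hsZ a s -> rsZ a = s.
Proof. by case=> s1 [s2 [h1 h2 ->]]; rewrite /rsZ !(cvg_lim _ h1, cvg_lim _ h2) //; exact: Rhausdorff. Qed.

Lemma seriesDE u v : series (fun k => u k + v k) = (fun n => series u n + series v n).
Proof. by apply/funext => n; rewrite /series /= big_split. Qed.

Lemma hsZD a b s t : hsZ a s -> hsZ b t -> hsZ (fun k => a k + b k) (s + t).
Proof.
case=> s1 [s2 [h1 h2 ->]] [t1 [t2 [k1 k2 ->]]]; exists (s1 + t1), (s2 + t2).
by split; rewrite ?seriesDE; [exact: cvgD | exact: cvgD | ring].
Qed.

Lemma hsZ_ext a b s : (forall k, a k = b k) -> hsZ a s -> hsZ b s.
Proof. by move=> ab; rewrite (_ : a = b) //; apply/funext. Qed.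

Lemma hsZ_fin a M : (forall k, (M < `|k|)%N -> a k = 0) -> hsZ a (\sum_(k <- zr M) a k).
Proof.
move=> h; exists (\sum_(0 <= i < M.+1) a i%:Z), (\sum_(0 <= i < M) a (- i.+1%:Z)); split.
- by apply: (@series_fin (fun i => a i%:Z)) => k Mk; apply: h.
- by apply: (@series_fin (fun i => a (- i.+1%:Z))) => k Mk; apply: h; lia.
- by rewrite sum_zr big_split /= addrA [in RHS]big_nat_recl // -[X in _ = _ + X + _](big_add1 _ _ 0 M.+1 xpredT (fun i => a i%:Z)) /= (big_add1 _ _ 0 M.+1 xpredT (fun i => a (- i%:Z))).
Qed.

Lemma hsZ_dom a K : 0 <= K -> (forall k, 0 <= a k <= K * (1 / 2) ^+ `|k|%N) ->
  exists2 s, hsZ a s & 0 <= s <= 4 * K.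
Proof.
move=> K0 h.
have [s1 h1 /andP[l1 u1]] := @series_dom (fun k => a k%:Z) K K0 (fun k => h k%:Z).
have [k|s2 h2 /andP[l2 u2]] := @series_dom (fun k => a (- k.+1%:Z)) K K0.
  have /andP[-> /= le] := h (- k.+1%:Z); apply: le_trans le _.
  apply: ler_wpM2l => //; apply: ler_wiXn2l => //; lra.
by exists (s1 + s2); [exists s1, s2 | lra].
Qed.

End RealSums.

(** * The theta series on the positive reals near 0 *)

Section ThetaReal.
Variable R : realType.
Variables a b c : int.

Let e (m n : int) : nat := absz (a * m ^+ 2 + b * m * n + c * n ^+ 2).
Hypothesis eE : forall m n, a * m ^+ 2 + b * m * n + c * n ^+ 2 = (e m n)%:Z.
Hypothesis em : forall m n, (`|m| <= e m n)%N.
Hypothesis en : forall m n, (`|n| <= e m n)%N.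

Definition thetar (x : R) := rsZ (fun m => rsZ (fun n => x ^+ e m n)).

Let low N (x : R) m n := if (e m n < N)%N then x ^+ e m n else 0.

(** For [e >= N] one has [x^e <= x^N 4^(N - e) = (4 x)^N 4^(- e)], and [4^(- e) <= 2^(- |m| - |n|)]
    because [|m|] and [|n|] are at most [e]. One bound thus gives both the convergence of the double
    sum and an error of order [x^N]. *)
Lemma theta_tail x N m n : 0 < x -> x <= 1 / 4 ->
  0 <= x ^+ e m n - low N x m n <= (4 * x) ^+ N * (1 / 2) ^+ `|m|%N * (1 / 2) ^+ `|n|%N.
Proof.
move=> x0 x4; rewrite /low; have X0 k : 0 <= x ^+ k by rewrite exprn_ge0 // ltW.
have h0 k : 0 <= (1 / 2 : R) ^+ k by rewrite exprn_ge0 // divr_ge0.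
case: ltnP => h.
  by rewrite subrr lexx /= !mulr_ge0 // exprn_ge0 // mulr_ge0 // ltW.
rewrite subr0 X0 /= -mulrA -exprD.
apply: (@le_trans _ _ (x ^+ N * (1 / 4) ^+ (e m n - N))).
  rewrite -{1}(subnKC h) exprD; apply: ler_wpM2l => //; apply: lerXn2r => //; rewrite nnegrE ?divr_ge0 //; lra.
rewrite [(4 * x) ^+ N]exprMn [4 ^+ N * x ^+ N]mulrC -mulrA; apply: ler_wpM2l => //.
have -> : (4 : R) ^+ N * (1 / 2) ^+ (`|m| + `|n|) = (1 / 4) ^+ (e m n - N) * (4 ^+ (e m n) * (1 / 2) ^+ (`|m| + `|n|)).
  have -> : (4 : R) ^+ e m n = 4 ^+ N * 4 ^+ (e m n - N) by rewrite -exprD subnKC.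
  have c4 : (1 / 4 : R) ^+ (e m n - N) * 4 ^+ (e m n - N) = 1.
    by rewrite -exprMn (_ : 1 / 4 * 4 = 1) ?expr1n //; field.
  transitivity ((1 / 4 : R) ^+ (e m n - N) * 4 ^+ (e m n - N) * (4 ^+ N * (1 / 2) ^+ (`|m| + `|n|))); last by ring.
  by rewrite c4 [RHS]mul1r.
rewrite -[X in X <= _]mulr1; apply: ler_wpM2l; first by rewrite exprn_ge0 // divr_ge0.
have -> : (4 : R) ^+ e m n = 2 ^+ (e m n + e m n) by rewrite exprD -exprMn; congr (_ ^+ _); ring.
have le2 : (`|m| + `|n| <= e m n + e m n)%N by rewrite leq_add.
rewrite -(subnK le2) exprD -mulrA -exprMn (_ : 2 * (1 / 2) = 1 :> R) ?expr1n ?mulr1; last by field.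
by rewrite exprn_ege1 // ler1n.
Qed.

Lemma low0 N x m n : (N < `|n|)%N -> low N x m n = 0.
Proof. by move=> h; rewrite /low ltnNge (leq_trans (ltnW h) (en m n)). Qed.

Lemma low0' N x m n : (N < `|m|)%N -> low N x m n = 0.
Proof. by move=> h; rewrite /low ltnNge (leq_trans (ltnW h) (em m n)). Qed.

Lemma theta_inner x N m : 0 < x -> x <= 1 / 4 -> exists2 t,
  hsZ (fun n => x ^+ e m n) (\sum_(n <- zr N) low N x m n + t) &
  0 <= t <= 4 * ((4 * x) ^+ N * (1 / 2) ^+ `|m|%N).
Proof.
move=> x0 x4; pose K := (4 * x) ^+ N * (1 / 2) ^+ `|m|%N.
have K0 : 0 <= K by rewrite mulr_ge0 // exprn_ge0 // ?divr_ge0 // mulr_ge0 // ltW.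
have [t ht tb] := hsZ_dom K0 (fun n => theta_tail N m n x0 x4).
exists t => //; apply: hsZ_ext (hsZD (hsZ_fin (fun n => @low0 N x m n)) ht) => n.
by rewrite /=; ring.
Qed.

Lemma theta_outer x N : 0 < x -> x <= 1 / 4 -> exists2 t,
  hsZ (fun m => rsZ (fun n => x ^+ e m n)) (\sum_(m <- zr N) \sum_(n <- zr N) low N x m n + t) &
  0 <= t <= 16 * (4 * x) ^+ N.
Proof.
move=> x0 x4.
have h m : 0 <= rsZ (fun n => x ^+ e m n) - \sum_(n <- zr N) low N x m n <= (4 * (4 * x) ^+ N) * (1 / 2) ^+ `|m|%N.
  have [t ht tb] := theta_inner N m x0 x4.
  by rewrite (hsZ_lim ht) addrAC subrr add0r -mulrA.
have K0 : 0 <= 4 * (4 * x) ^+ N by rewrite mulr_ge0 // exprn_ge0 // mulr_ge0 // ltW.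
have [t ht tb] := hsZ_dom K0 h.
exists t; last by rewrite (_ : 16 * _ = 4 * (4 * (4 * x) ^+ N)) //; ring.
have hf : hsZ (fun m => \sum_(n <- zr N) low N x m n) (\sum_(m <- zr N) \sum_(n <- zr N) low N x m n).
  by apply: hsZ_fin => m mN; rewrite big1 // => n _; exact: low0'.
by apply: hsZ_ext (hsZD hf ht) => m; rewrite /=; ring.
Qed.

Lemma theta_asy N : asy N thetar (fps_map intr (thetaq a b c)).
Proof.
exists (\sum_(m <- zr N) \sum_(n <- zr N) if (e m n < N)%N then 'X^(e m n) else 0).
  move=> k kN; rewrite coef_sum cf_map.
  transitivity ((\sum_(m <- zr N) \sum_(n <- zr N) ((e m n == k)%:R : int))%:~R : R).
    rewrite rmorph_sum; apply: eq_bigr => m _; rewrite coef_sum rmorph_sum; apply: eq_bigr => n _.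
    rewrite rmorph_nat; case: ifP => h; first by rewrite coefXn eq_sym.
    by rewrite coef0; case: eqP => // E; rewrite E kN in h.
  congr (_%:~R); rewrite -[RHS]/(\sum_(m <- zr k) \sum_(n <- zr k) (a * m ^+ 2 + b * m * n + c * n ^+ 2 == k%:Z)%:R).
  rewrite !sum_box; apply: (@sum_bij _ _ _ _ _ id id); rewrite ?box_uniq // => -[m n]; rewrite !mem_box !mem_zr /= eE eqz_nat => h.
    case: (e m n =P k) => [E _|_]; last by rewrite eqxx.
    by split => //; rewrite -E em en.
  case: (e m n =P k) => [E _|_]; last by rewrite eqxx.
  case/andP: h => h1 h2; split => //.
  by rewrite (leq_trans h1 (ltnW kN)) (leq_trans h2 (ltnW kN)).
exists (16 * 4 ^+ N), (1 / 4); split; rewrite ?mulr_ge0 ?exprn_ge0 ?divr_gt0 //.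
move=> x x0 x4; have [t ht /andP[t0 t1]] := theta_outer N x0 (ltW x4).
rewrite /thetar (hsZ_lim ht) horner_sum.
have -> : \sum_(i <- zr N) (\sum_(n <- zr N) (if (e i n < N)%N then 'X^(e i n) else 0)).[x] = \sum_(m <- zr N) \sum_(n <- zr N) low N x m n.
  by apply: eq_bigr => m _; rewrite horner_sum; apply: eq_bigr => n _; rewrite /low; case: ifP; rewrite ?hornerXn ?horner0.
by rewrite addrAC subrr add0r ger0_norm // -mulrA -exprMn.
Qed.

End ThetaReal.

(** * The Euler product on the positive reals near 0 *)

Section EulerProduct.
Variable R : realType.

Definition pprod s (x : R) K := \prod_(1 <= n < K.+1) (1 - x ^+ (s * n)).
Definition eulerr s (x : R) := limn (pprod s x).

Section Fixed.
Variables (s : nat) (x : R).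
Hypotheses (s0 : (0 < s)%N) (x0 : 0 < x) (x2 : x <= 1 / 2).

Let x1 : x <= 1.
Proof. by apply: le_trans x2 _; rewrite ler_pdivrMr // mul1r ler1n. Qed.

Let P01 K : 0 <= pprod s x K <= 1.
Proof.
rewrite /pprod; elim: K => [|K IH]; first by rewrite big_geq // ler01 lexx.
rewrite big_nat_recr //=; case/andP: IH => i0 i1.
have y0 : 0 <= x ^+ (s * K.+1) by rewrite exprn_ge0 // ltW.
have y1 : x ^+ (s * K.+1) <= 1 by rewrite exprn_ile1 // ltW.
apply/andP; split; first by rewrite mulr_ge0 // subr_ge0.
by rewrite mulr_ile1 // ?subr_ge0 // gerBl.
Qed.

(** Each new factor lowers the product by at most [x^(N+j+1)], and [x <= 1/2] gives
    [x^(j+1) <= x^j - x^(j+1)], so the bound telescopes. *)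
Let PB N j : 0 <= pprod s x N - pprod s x (N + j) <= x ^+ N * (1 - x ^+ j).
Proof.
have xN : 0 <= x ^+ N by rewrite exprn_ge0 // ltW.
elim: j => [|j /andP[h1 h2]]; first by rewrite addn0 subrr expr0 subrr mulr0 lexx.
have -> : pprod s x (N + j.+1) = pprod s x (N + j) * (1 - x ^+ (s * (N + j).+1)).
  by rewrite addnS /pprod big_nat_recr.
have y0 : 0 <= x ^+ (s * (N + j).+1) by rewrite exprn_ge0 // ltW.
have y1 : x ^+ (s * (N + j).+1) <= x ^+ N * x ^+ j * x.
  by rewrite -exprD -exprSr; apply: ler_wiXn2l => //; [exact: ltW | nia].
have xj : 0 <= x ^+ j by rewrite exprn_ge0 // ltW.
have xNj : 0 <= x ^+ N * x ^+ j by rewrite mulr_ge0.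
have /andP[p0 p1] := P01 (N + j).
move: h1 h2 y0 y1 xNj p0 p1; rewrite exprSr.
move: (x ^+ (s * _)) (pprod s x N) (pprod s x (N + j)) (x ^+ N) (x ^+ j) => y p q u v h1 h2 y0 y1 uv p0 p1.
have qy : q * y <= u * v * x by apply: le_trans y1; rewrite -[X in _ <= X]mul1r ler_wpM2r.
have qy0 : 0 <= q * y by rewrite mulr_ge0.
have ux : u * v * x <= u * v * (1 / 2) by rewrite ler_wpM2l.
by apply/andP; split; lra.
Qed.

Lemma pprod_cvg : cvgn (pprod s x).
Proof.
apply: nonincreasing_is_cvgn.
  by move=> M N MN; have /andP[h _] := PB M (N - M); move: h; rewrite subnKC // subr_ge0.
by exists 0 => _ [n _ <-]; case/andP: (P01 n).
Qed.

Lemma euler_tail N : `|eulerr s x - pprod s x N| <= x ^+ N.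
Proof.
have xN : 0 <= x ^+ N by rewrite exprn_ge0 // ltW.
have nb n : (N <= n)%N -> pprod s x N - x ^+ N <= pprod s x n <= pprod s x N.
  move=> Nn; have /andP[h1 h2] := PB N (n - N); move: h1 h2; rewrite subnKC // => h1 h2.
  have xj : 0 <= x ^+ (n - N) by rewrite exprn_ge0 // ltW.
  by apply/andP; split; nra.
have l1 : pprod s x N - x ^+ N <= eulerr s x.
  by apply: limr_ge; [exact: pprod_cvg | exists N => // n /nb /andP[]].
have l2 : eulerr s x <= pprod s x N.
  by apply: limr_le; [exact: pprod_cvg | exists N => // n /nb /andP[]].
by rewrite ler_norml; apply/andP; split; lra.
Qed.

End Fixed.

Lemma euler_asy s N : (0 < s)%N -> asy N (eulerr s) (eprod R s).
Proof.
move=> s0; have h : asy N (fun x => pprod s x N) (prodq R s N).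
  apply: asy_prod => i; apply: asy_ext (asyD (asyC N 1) (asyM (asyC N (-1)) (asyXn R N (s * i)))).
    by move=> x; rewrite mulN1r.
  have cN : fpsC (-1 : R) = -1 by rewrite rmorphN rmorph1.
  by rewrite cN mulN1r rmorph1.
have h' : asy N (fun x => pprod s x N) (eprod R s).
  apply: asy_coef h => k kN; rewrite (prodq_stable _ s0 (ltnW kN)) //.
have := asy_add_bigO h' (_ : bigO N (fun x => eulerr s x - pprod s x N)).
apply: (fun H => _) => H; apply: (@asy_ext _ _ (fun x => pprod s x N + (eulerr s x - pprod s x N)) _ (eprod R s)) => //.
  by move=> x; ring.
apply: H; exists 1, (1 / 2); split; rewrite ?divr_gt0 // => x x0 x2.
by rewrite mul1r; apply: euler_tail => //; exact: ltW.
Qed.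

Definition hreal (x : R) := x * eulerr 1 x * eulerr 23 x.

Lemma fps_map_hser : fps_map intr (hser int) = hser R.
Proof.
have mX k : fps_map intr (fpsXn int k) = fpsXn R k.
  by apply: fpsP => n; rewrite cf_map /= rmorph_nat.
have mp s : fps_map intr (eprod int s) = eprod R s.
  apply: fpsP => n; rewrite cf_map /eprod /= -[LHS]/(coef (fps_map (intr : int -> R) (prodq int s n)) n).
  congr (coef _ n); rewrite /prodq rmorph_prod; apply: eq_bigr => i _.
  by rewrite rmorphB rmorph1 /= mX.
by rewrite /hser !rmorphM /= mX !mp.
Qed.

Lemma hreal_asy N : asy N hreal (fps_map intr (hser int)).
Proof.
rewrite fps_map_hser; apply: asyM; last exact: euler_asy.
apply: asyM; last exact: euler_asy.
by apply: asy_ext (asyXn R N 1) => // x; rewrite expr1.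
Qed.

End EulerProduct.

(** * From a convergent expansion in [tau] to an identity of formal series *)

Section Expansion.
Variable R : realType.
Variables (g tau : R -> R) (s t : fps R) (c : nat -> R).
Hypotheses (gs : forall N, asy N g s) (taut : forall N, asy N tau t).
Hypotheses (t0 : coef t 0 = 0) (t1 : coef t 1 = 1).
Hypothesis cg : exists2 d, 0 < d & forall x, 0 < x -> x < d ->
  series (fun n => c n * tau x ^+ n) @ \oo --> g x.

Lemma tau_lin : exists2 d, 0 < d & forall x, 0 < x -> x < d -> x / 2 <= tau x <= 2 * x.
Proof.
have [p pt Hp] := taut 2.
have [C [d [C0 d0 H]]] : bigO 2 (fun x => tau x - x).
  apply: (@bigO_ext _ _ (fun x => (tau x - p.[x]) + (p - 'X).[x])).
    by move=> x; rewrite hornerD hornerN hornerX; ring.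
  apply: bigOD => //; apply: bigO_poly => -[|[|//]] _; rewrite coefB coefX pt // ?t0 ?t1 subrr //.
exists (Num.min d (1 / (2 * (C + 1)))).
  by rewrite lt_min d0 divr_gt0 // mulr_gt0 //; lra.
move=> x x0; rewrite lt_min => /andP[xd xc].
have C2 : 0 < 2 * (C + 1) by rewrite mulr_gt0 //; lra.
have {}xc : x * (2 * (C + 1)) < 1 by rewrite -ltr_pdivlMr.
have := H x x0 xd; rewrite expr2 ler_norml => /andP[h1 h2].
have : C * (x * x) <= x / 2 by nra.
by move=> h3; apply/andP; split; lra.
Qed.

(** Convergence at one point [x0] bounds the terms [c_n tau(x0)^n]. Since [tau x] lies between
    [x / 2] and [2 x], for smaller [x] the terms decay geometrically and the tail is of order
    [x^N]. *)
Lemma expansion_tail N : bigO N (fun x => g x - \sum_(0 <= n < N) c n * tau x ^+ n).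
Proof.
have [d d0 hd] := cg; have [d' d'0 hd'] := tau_lin.
pose x0 := Num.min d d' / 2.
have m0 : 0 < Num.min d d' by rewrite lt_min d0.
have x00 : 0 < x0 by rewrite divr_gt0.
have x0m : x0 < Num.min d d' by rewrite /x0; lra.
have [x0d x0d'] : x0 < d /\ x0 < d' by move: x0m; rewrite lt_min => /andP[].
pose T := tau x0.
have T0 : 0 < T by have /andP[h _] := hd' x0 x00 x0d'; apply: lt_le_trans h; rewrite divr_gt0.
have [B B0 hB] : exists2 B, 0 <= B & forall n, `|c n * T ^+ n| <= B.
  have cv : cvgn (series (fun n => c n * T ^+ n)) by apply: cvgP (hd x0 x00 x0d).
  have [M [_ hM]] := cvg_series_bounded cv.
  exists (Num.max 0 (M + 1)); first by rewrite le_max lexx.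
  move=> n; apply: le_trans (hM (M + 1) _ n I) _; first by rewrite ltrDl.
  by rewrite le_max lexx orbT.
(* For [x < T / 4] the ratio [tau x / T] is at most [2 x / T < 1 / 2], so the tail from [N] on is at
   most twice its first bound. *)
exists (2 * B * (2 / T) ^+ N), (Num.min (Num.min d d') (T / 4)); split.
- by rewrite !mulr_ge0 // exprn_ge0 // divr_ge0 // ltW.
- by rewrite lt_min m0 divr_gt0.
move=> x xx0; rewrite !lt_min => /andP[/andP[xd xd'] xT].
have /andP[tl tu] := hd' x xx0 xd'.
pose r := tau x / T.
have tx0 : 0 <= tau x by apply: le_trans tl; rewrite divr_ge0 // ltW.
have r0 : 0 <= r by rewrite divr_ge0 // ltW.
have r2 : r <= 1 / 2 by rewrite /r ler_pdivrMr //; lra.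
have rx : r <= 2 / T * x by rewrite /r mulrAC ler_pM2r ?invr_gt0.
have ct n : `|c n * tau x ^+ n| <= B * r ^+ n.
  have -> : c n * tau x ^+ n = (c n * T ^+ n) * r ^+ n.
    by rewrite /r expr_div_n; field; rewrite expf_neq0 // gt_eqF.
  by rewrite normrM [`|r ^+ n|]ger0_norm ?exprn_ge0 // ler_wpM2r // exprn_ge0.
pose S := series (fun n => c n * tau x ^+ n).
have rN : 0 <= B * r ^+ N by rewrite mulr_ge0 // exprn_ge0.
have hj j : `|S (N + j)%N - S N| <= 2 * (B * r ^+ N) * (1 - (1 / 2) ^+ j).
  elim: j => [|j IH]; first by rewrite addn0 subrr normr0 expr0 subrr mulr0.
  have -> : S (N + j.+1)%N - S N = (S (N + j)%N - S N) + c (N + j)%N * tau x ^+ (N + j).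
    by rewrite addnS /S /series /= big_nat_recr //=; ring.
  apply: le_trans (ler_normD _ _) _.
  have h1 := ct (N + j)%N.
  have h2 : B * r ^+ (N + j) <= B * r ^+ N * (1 / 2) ^+ j.
    rewrite exprD mulrA; by apply: ler_wpM2l => //; apply: lerXn2r; rewrite ?nnegrE //; exact: divr_ge0.
  have h3 := le_trans h1 h2.
  apply: le_trans (lerD IH h3) _.
  rewrite exprS (_ : 2 * _ * _ + _ = 2 * (B * r ^+ N) * (1 - 1 / 2 * (1 / 2) ^+ j)) //; by field.
have nb n : (N <= n)%N -> `|S n - S N| <= 2 * (B * r ^+ N).
  move=> Nn; have := hj (n - N)%N; rewrite subnKC // => h; apply: le_trans h _.
  have : 0 <= (1 / 2 : R) ^+ (n - N) by rewrite exprn_ge0 // divr_ge0.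
  by nra.
have cvS : S @ \oo --> g x := hd x xx0 xd.
have gl : limn S = g x by apply: cvg_lim => //; exact: Rhausdorff.
have cv : cvgn S by apply: cvgP cvS.
have l1 : S N - 2 * (B * r ^+ N) <= g x.
  by rewrite -gl; apply: limr_ge => //; exists N => // n /nb; rewrite /= ler_norml => /andP[h1 h2]; lra.
have l2 : g x <= S N + 2 * (B * r ^+ N).
  by rewrite -gl; apply: limr_le => //; exists N => // n /nb; rewrite /= ler_norml => /andP[h1 h2]; lra.
apply: (@le_trans _ _ (2 * (B * r ^+ N))).
  have -> : \sum_(0 <= n < N) c n * tau x ^+ n = S N by [].
  move: l1 l2; move: (S N) (B * r ^+ N) (g x) => v w y l1 l2.
  by rewrite ler_norml; apply/andP; split; lra.
rewrite -!mulrA ler_pM2l // ler_wpM2l // -exprMn; apply: lerXn2r; rewrite ?nnegrE //.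
by apply: le_trans rx.
Qed.

Lemma expansion_coef k : coef s k = \sum_(n < k.+1) c n * coef (t ^+ n) k.
Proof.
have h : asy k.+1 g (\sum_(0 <= n < k.+1) fpsC (c n) * t ^+ n).
  have := asy_add_bigO (asy_sum (index_iota 0 k.+1) (fun n => asyM (asyC k.+1 (c n)) (asyX n (taut k.+1)))) (expansion_tail k.+1).
  by apply: asy_ext => // x; ring.
rewrite (asy_uniq (gs k.+1) h (ltnSn k)) cf_sum big_mkord.
by apply: eq_bigr => n _; rewrite cfCM.
Qed.

End Expansion.

(** * Restriction to the imaginary axis *)

Local Open Scope complex_scope.

Section Embedding.
Variable R : realType.

Lemma norm_real_complex (x : R) : `|x%:C : Cplx R| = (`|x|)%:C.
Proof. by rewrite [LHS](normc_def (x%:C)) /= expr0n addr0 sqrtr_sqr. Qed.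

Lemma cvg_real_complex (u : nat -> R) (l : R) : u @ \oo --> l <->
  (fun n => ((u n)%:C : Cplx R)) @ \oo --> (l%:C : Cplx R).
Proof.
have nE n : `|(l%:C : Cplx R) - (u n)%:C| = (`|l - u n|)%:C.
  by rewrite -norm_real_complex; congr `|_|; rewrite rmorphB.
split=> /cvgrPdist_lt h; apply/cvgrPdist_lt => e e0.
  have [e1 e2] : e = (complex.Re e)%:C /\ 0 < complex.Re e.
    move: (e0); rewrite ltcE /= => /andP[/eqP im re]; split => //.
    by case: (e) im => a b /= ->.
  by apply: filterS (h _ e2) => n hn; rewrite nE e1 ltcR.
have ec : 0 < (e%:C : Cplx R) by rewrite -[0]/(0%:C) ltcR.
by apply: filterS (h _ ec) => n; rewrite nE ltcR.
Qed.

Lemma lim_real_complex (u : nat -> R) (l : R) : u @ \oo --> l ->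
  lim ((fun n => ((u n)%:C : Cplx R)) @ \oo) = l%:C.
Proof. by move=> /cvg_real_complex; apply: cvg_lim; exact: norm_hausdorff. Qed.

Lemma series_real_complex (u : nat -> R) :
  series (fun k => ((u k)%:C : Cplx R)) = fun n => (series u n)%:C.
Proof. by apply/funext => n; rewrite /series /= rmorph_sum. Qed.

Lemma sumZ_real_complex (a : int -> R) s : hsZ a s -> sumZ (fun k => ((a k)%:C : Cplx R)) = s%:C.
Proof.
case=> s1 [s2 [h1 h2 ->]]; rewrite /sumZ.
rewrite (series_real_complex (fun k : nat => a k%:Z)) (series_real_complex (fun k : nat => a (- k.+1%:Z))).
by rewrite (lim_real_complex h1) (lim_real_complex h2) rmorphD.
Qed.

Lemma e2pii_imag (y : R) : e2pii (0 +i* y) = (expR (- ((pi *+ 2) * y)))%:C.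
Proof.
rewrite /e2pii /cexp /= !mul0r !mulr0 sub0r addr0 cos0 sin0 mulr0 mulr1.
by [].
Qed.

Lemma imagE (y : R) : 0 +i* y = 'i%C * y%:C :> R[i].
Proof. by apply/eqP; rewrite eq_complex; simpc. Qed.

Lemma imag_divn (y : R) n : (0 +i* y : R[i]) / n%:R = 0 +i* (y / n%:R).
Proof.
by rewrite (imagE y) (imagE (y / n%:R)) -mulrA; congr (_ * _); rewrite fmorph_div /= rmorph_nat.
Qed.

Lemma imag_muln (y : R) n : n%:R * (0 +i* y : R[i]) = 0 +i* (n%:R * y).
Proof.
by rewrite (imagE y) (imagE (n%:R * y)) mulrCA; congr (_ * _); rewrite rmorphM /= rmorph_nat.
Qed.

Section Point.
Variable y : R.
Let x := expR (- ((pi *+ 2) * y)).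
Let z : R[i] := 0 +i* y.

Lemma qvar_imag : qvar z = x%:C. Proof. exact: e2pii_imag. Qed.

Lemma qvar_imag_muln n : qvar (n%:R * z) = (x ^+ n)%:C.
Proof.
rewrite imag_muln [LHS]e2pii_imag /x -expRM_natl; congr ((expR _)%:C).
by rewrite mulrCA mulrN.
Qed.

Lemma euler_imag s : (0 < s)%N -> x <= 1 / 2 ->
  lim ((fun N : nat => \prod_(1 <= n < N.+1) (1 - qvar (s%:R * z) ^+ n)) @ \oo) = (eulerr s x)%:C.
Proof.
move=> s0 x2; rewrite -(lim_real_complex (pprod_cvg s0 (expR_gt0 _) x2)); congr (lim (_ @ \oo)).
apply/funext => N; rewrite /pprod rmorph_prod; apply: eq_bigr => n _.
by rewrite qvar_imag_muln rmorphB rmorph1 -rmorphXn /= -exprM.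
Qed.

Lemma eta_imag s : (0 < s)%N -> x <= 1 / 2 ->
  eta (s%:R * z) = (expR (- ((pi *+ 2) * (s%:R * y / 24%:R))) * eulerr s x)%:C.
Proof.
by move=> s0 x2; rewrite /eta euler_imag // imag_muln imag_divn e2pii_imag rmorphM.
Qed.

(** The fractional powers combine to [q^(1/24 + 23/24) = q]. *)
Lemma etaM_imag : x <= 1 / 2 -> eta z * eta (23%:R * z) = (hreal x)%:C.
Proof.
move=> x2; have -> : eta z = eta (1%:R * z) by rewrite mul1r.
rewrite !eta_imag // -rmorphM /hreal.
congr (_%:C); rewrite mulrACA -expRD -[RHS]mulrA; congr (_ * _); rewrite /x; congr (expR _).
by rewrite mul1r; field.
Qed.

Section Theta.
Variables a b c : int.
Let e (m n : int) : nat := absz (a * m ^+ 2 + b * m * n + c * n ^+ 2).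
Hypothesis eE : forall m n, a * m ^+ 2 + b * m * n + c * n ^+ 2 = (e m n)%:Z.
Hypothesis em : forall m n, (`|m| <= e m n)%N.
Hypothesis en : forall m n, (`|n| <= e m n)%N.

Lemma theta_imag : x <= 1 / 4 -> theta_qf a b c z = (thetar a b c x)%:C.
Proof.
move=> x4; have x0 : 0 < x := expR_gt0 _.
have inner m : sumZ (fun n : int => qvar z ^ (a * m ^+ 2 + b * m * n + c * n ^+ 2)) =
    (rsZ (fun n => x ^+ e m n))%:C.
  have [t ht _] := theta_inner em en 0 m x0 x4.
  rewrite (hsZ_lim ht) -(sumZ_real_complex ht); congr sumZ; apply/funext => n.
  by rewrite eE qvar_imag rmorphXn.
rewrite /theta_qf; have [t ht _] := theta_outer em en 0 x0 x4.
rewrite /thetar (hsZ_lim ht) -(sumZ_real_complex ht); congr sumZ; apply/funext => m.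
exact: inner.
Qed.

End Theta.
End Point.

Section Transfer.
Variables a b c : int.
Let e (m n : int) : nat := absz (a * m ^+ 2 + b * m * n + c * n ^+ 2).
Hypothesis eE : forall m n, a * m ^+ 2 + b * m * n + c * n ^+ 2 = (e m n)%:Z.
Hypothesis em : forall m n, (`|m| <= e m n)%N.
Hypothesis en : forall m n, (`|n| <= e m n)%N.

(** At [z = i y] with [y = - ln x / (2 pi)] the variable [q] is the real number [x], and every
    series and product involved becomes real. *)
Lemma expansion_real (k : nat -> int) :
  expands_near_q0 (@theta_qf R a b c)
    (fun z : R[i] => eta z * eta (23%:R * z) / theta_qf a b c z) k ->
  exists2 d : R, 0 < d & forall x : R, 0 < x -> x < d ->
    series (fun n => (k n)%:~R * (hreal x / thetar a b c x) ^+ n) @ \oo --> thetar a b c x.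
Proof.
move=> [d d0 h]; exists (Num.min (1 / 4) d); first by rewrite lt_min d0 divr_gt0.
move=> x x0; rewrite lt_min => /andP[x4 xd].
have p0 : (pi *+ 2 : R) != 0 by rewrite mulrn_eq0 /= gt_eqF // pi_gt0.
pose y := - ln x / (pi *+ 2).
have Ex : expR (- ((pi *+ 2) * y)) = x.
  by rewrite /y mulrCA divff // mulr1 opprK lnK.
have x1 : x < 1 by apply: lt_trans x4 _; rewrite ltr_pdivrMr // mul1r ltr1n.
have y0 : 0 < y.
  rewrite divr_gt0 //; first by rewrite oppr_gt0 ln_lt0 // x0.
  by rewrite mulrn_wgt0 // pi_gt0.
have xx4 : expR (- ((pi *+ 2) * y)) <= 1 / 4 by rewrite Ex ltW.
have xx2 : expR (- ((pi *+ 2) * y)) <= 1 / 2.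
  by apply: le_trans xx4 _; rewrite ler_pM2l // lef_pV2 ?posrE // ler_nat.
have := h (0 +i* y) y0; rewrite qvar_imag norm_real_complex Ex ltcR gtr0_norm // => /(_ xd).
rewrite (etaM_imag xx2) (theta_imag eE em en xx4) Ex => H.
apply/cvg_real_complex; rewrite -series_real_complex.
rewrite [X in series X](_ : _ = fun n : nat => (k n)%:~R * ((hreal x)%:C / (thetar a b c x)%:C : Cplx R) ^+ n) //.
by apply/funext => n; rewrite rmorphM rmorph_int rmorphXn /= fmorph_div.
Qed.

Lemma expansion_formal (k : nat -> int) :
  expands_near_q0 (@theta_qf R a b c)
    (fun z : R[i] => eta z * eta (23%:R * z) / theta_qf a b c z) k ->
  forall n, coef (thetaq a b c) n =
    \sum_(i < n.+1) k i * coef ((hser int * fps_inv (thetaq a b c)) ^+ i) n.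
Proof.
move=> h n; have f0 := theta_coef0 a b c; have [t0 t1 tf] := hser_div f0.
set t := hser int * _ in t0 t1 tf *.
pose g := (intr : int -> R).
have asyt N : asy N (fun x => hreal x / thetar a b c x) (fps_map g t).
  (* One order more than needed, because [asy_div] requires a positive order; the result is then
     weakened to [N]. *)
  have [p pt Hp] : asy N.+1 (fun x => hreal x / thetar a b c x) (fps_map g t).
    apply: (@asy_div _ _ _ _ (fps_map g (thetaq a b c))).
    - by rewrite cf_map f0 /g.
    - by apply: theta_asy.
    - by rewrite -rmorphM mulrC tf; exact: hreal_asy.
  exists p; first by move=> i iN; apply: pt; exact: leqW.
  by apply: bigO_weak Hp.
have ath N : asy N (thetar a b c : R -> R) (fps_map g (thetaq a b c)) by apply: theta_asy.
have := @expansion_coef R _ _ _ _ (fun n => (k n)%:~R) ath asyt _ _ (expansion_real h) n.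
rewrite !cf_map t0 t1 => /(_ erefl erefl) E; apply: (@intr_inj R).
rewrite [LHS]E rmorph_sum; apply: eq_bigr => i _.
by rewrite rmorphM /= -rmorphXn cf_map.
Qed.

End Transfer.
End Embedding.

Theorem theorem1p2 (R : realType) (fc Fc : nat -> int)
    (hf : expands_near_q0 (@f R) (@t1 R) fc)
    (hF : expands_near_q0 (@F R) (@t2 R) Fc)
    (p n r : nat) (hp : prime p) (hp23 : legendre p 23 = 1%R)
    (hn : (1 <= n)%N) (hr : (1 <= r)%N) :
  (fc (n * p ^ r)%N = fc (n * p ^ (r - 1))%N %[mod (p ^ r)%N%:Z])%Z /\
  (Fc (n * p ^ r)%N = Fc (n * p ^ (r - 1))%N %[mod (p ^ r)%N%:Z])%Z.
Proof.
have cp := legendre_chi hp23.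
have qE i x y : exists m : nat, [/\ qf i x y = m%:Z, (`|x| <= m)%N & (`|y| <= m)%N].
  have q0 : 0 <= qf i x y.
    have := qf_small i x y; have : 0 < 4 * fA i by rewrite /fA; case: ifP.
    by move=> A0 h; rewrite -(pmulr_rge0 _ A0) h addr_ge0 ?sqr_ge0 // mulr_ge0 // sqr_ge0.
  exists `|qf i x y|%N; have E : qf i x y = `|qf i x y|%N%:Z by rewrite gez0_abs.
  by have /andP[h1 h2] := qf_bound E; split.
have q1 x y : qf ord0 x y = 1 * x ^+ 2 + 1 * x * y + 6 * y ^+ 2.
  by rewrite /qf /fA /fbeta /fC /= mulr0 add0r.
have q2 x y : qf (inord 1) x y = 2 * x ^+ 2 + 1 * x * y + 3 * y ^+ 2.
  by rewrite /qf /fA /fbeta /fC !inordK //= mulr0 add0r.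
(* The Gauss congruence at [n p^r] holds modulo the full power of [p] in that number, whose exponent
   is at least [r]. *)
have fin c : gauss p c -> (c (n * p ^ r)%N = c (n * p ^ (r - 1))%N %[mod (p ^ r)%N%:Z])%Z.
  move=> gc; have k0 : (0 < n * p ^ r)%N by rewrite muln_gt0 hn expn_gt0 prime_gt0.
  have pk : (p %| n * p ^ r)%N by apply: dvdn_mull; case: r hr {k0} => // r' _; rewrite expnS dvdn_mulr.
  have := gc _ k0 pk; rewrite (_ : (n * p ^ r) %/ p = n * p ^ (r - 1))%N; last first.
    by case: r hr {k0 pk} => // r' _; rewrite subn1 expnSr mulnA mulnK ?prime_gt0.
  move=> d; apply/eqP; rewrite eqz_mod_dvd; apply: dvdz_trans d.
  by rewrite dvdzE /= dvdn_exp2l // -pfactor_dvdn // dvdn_mull.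
have hyp i a b c : (forall x y, qf i x y = a * x ^+ 2 + b * x * y + c * y ^+ 2) ->
   [/\ forall m n, a * m ^+ 2 + b * m * n + c * n ^+ 2 = (absz (a * m ^+ 2 + b * m * n + c * n ^+ 2))%:Z,
     forall m n, (`|m| <= absz (a * m ^+ 2 + b * m * n + c * n ^+ 2)%R)%N &
     forall m n, (`|n| <= absz (a * m ^+ 2 + b * m * n + c * n ^+ 2)%R)%N].
  move=> E; split=> u v; rewrite -E; have [m [-> h1 h2]] := qE i u v => //.
have [e1 m1 n1] := hyp _ _ _ _ q1; have [e2 m2 n2] := hyp _ _ _ _ q2.
split; apply: fin.
  by apply: (expansion_gauss hp cp (theta_coef0 1 1 6) (erefl Gint)); exact: expansion_formal hf.
by apply: (expansion_gauss hp cp (theta_coef0 2 1 3) Gint2); exact: expansion_formal hF.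
Qed.
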